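(* Let $(A,+,\times,0_A,1_A)$ be a semiring, $B$ a set, and $\Omega$ a poly-time computable strong $A$-pre-morphism with weights in $B$ that is corestriction independent. Let $H$ be an $\mathbf{e}$-free edge-labelled graph, $X$ a finite set, and $\mathcal{R}\subseteq X\times X_H$ (with $H$, $\mathcal{R}$, $\Omega$ fixed). Then there is an algorithm which, given an instance $G$ of $H$-($\mathcal{R}$-MORPHISM) on $n\geq 1$ vertices (an $\mathbf{e}$-free edge-labelled graph with $X_G=X$), a weight matrix $W\in B^{V_G\times V_H}$, and an optimal contraction sequence of $G$, outputs $\Omega_W(\{f : f \text{ is an } \mathcal{R}\text{-morphism from } G \text{ to } H\})$ in time $O\big((2^{|V_H|}-1)^{\mathrm{ctww}(G)}\cdot |V_G|^2\big)$.
   Context: An edge-labelled graph is $G=(V_G,l_G,X_G)$ with $V_G,X_G$ finite sets and $l_G:V_G^2\to X_G$. A special symbol $\mathbf{e}$ (occurring nowhere else) is used; $G$ is $\mathbf{e}$-free if $\mathbf{e}\notin X_G$. For $S\subseteq V_G$, $G[S]=(S,l_G|_{S^2},X_G)$. For $\mathbf{e}$-free $G,H$ and $\mathcal{R}\subseteq X_G\times X_H$, a map $f:V_G\to V_H$ is an $\mathcal{R}$-morphism if $(l_G(u,v),l_H(f(u),f(v)))\in\mathcal{R}$ for all $(u,v)\in V_G^2$. Contraction: for a partition $\mathcal{S}$ of $V_H$ into nonempty parts, the contraction $H_{\mathcal{S}}$ has vertex set $\mathcal{S}$, label set $X_H\cup\{\mathbf{e}\}$, and for $S_1,S_2\in\mathcal{S}$,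 $l_{H_{\mathcal{S}}}(S_1,S_2)=x$ if $l_H(u,v)=x$ for all $(u,v)\in S_1\times S_2$, and $=\mathbf{e}$ otherwise. A contraction sequence of an $\mathbf{e}$-free $H$ with $n$ vertices is $(H_n,\dots,H_1)$ with $H_n=H$ and $H_k$ the contraction of $H$ relative to a partition $\mathcal{P}_k$ with $k$ parts, where $\mathcal{P}_n$ is the partition into singletons and each $\mathcal{P}_k$ is obtained from $\mathcal{P}_{k+1}$ by merging two parts. The $\mathbf{e}$-connected components of an edge-labelled graph are the connected components of the undirected graph on its vertices with an edge $\{u,v\}$ whenever $\mathbf{e}\in\{l(u,v),l(v,u)\}$. The component-width of a contraction sequence is the maximum number of vertices of an $\mathbf{e}$-connected component of $H_{n-1},\dots,H_1$; the component twin-width $\mathrm{ctww}(H)$ is the minimum component-width over all contraction sequences; a sequence attaining it is optimal. Semiring: $(A,+,0_A)$ commutative monoid, $(A,\times,1_A)$ monoid, $\times$ distributes over $+$, $0_A$ absorbing for $\times$. For disjoint sets $S_1,S_2$ and $f_i:S_i\to T_i$, the join $f_1\bowtie f_2:S_1\uplus S_2\to T_1\cup T_2$ restricts to $f_i$ on $S_i$; for sets of functions $\mathcal{F}_1\bowtie\mathcal{F}_2=\{f_1\bowtie f_2:(f_1,f_2)\in\mathcal{F}_1\times\mathcal{F}_2\}$. An $A$-pre-morphism with weights in $B$ is a map $\Omega$ assigning to every pair of edge-labelled graphs $G,H$, every $S\subseteq V_G$, $T\subseteq V_H$, every set $\mathcal{F}$ of functions $S\to T$ and every $W\in B^{V_G\times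 V_H}$ a value $\Omega_W(\mathcal{F})\in A$ such that: (i) for disjoint sets $\mathcal{F}_1,\mathcal{F}_2$ of functions $S\to T$, $\Omega_W(\mathcal{F}_1\uplus\mathcal{F}_2)=\Omega_W(\mathcal{F}_1)+\Omega_W(\mathcal{F}_2)$; (ii) for disjoint $S_1,S_2\subseteq V_G$, disjoint $T_1,T_2\subseteq V_H$ and sets $\mathcal{F}_i$ of functions $S_i\to T_i$, $\Omega_W(\mathcal{F}_1\bowtie\mathcal{F}_2)=\Omega_W(\mathcal{F}_1)\times\Omega_W(\mathcal{F}_2)$; (iii) $\Omega_W(\emptyset)=0_A$. It is strong if (ii) holds without assuming $T_1,T_2$ disjoint. It is poly-time computable if $+,\times$ take constant time and $\Omega_W(\{f\})$ for the constant function $f:S\to\{a\}$ is computable in polynomial time. It is corestriction independent if for all $S\subseteq V_G$, $T'\subseteq T\subseteq V_H$, $f:S\to T$ with $f(S)\subseteq T'$, and $W$, $\Omega_W(\{f\})=\Omega_W(\{f'\})$ where $f':S\to T'$ is $f$ with codomain $T'$. *)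

(* Defs.v *)
From HB Require Import structures.
From mathcomp Require Import all_boot all_algebra.

Set Implicit Arguments.
Unset Strict Implicit.
Unset Printing Implicit Defensive.

(** * Edge-labelled graphs *)

(* The label set is the type X.  The special symbol e is the [None] of
   [option X]: a graph with labels in X is e-free by construction, and a graph
   that may use e has label set [option X]. *)
Record elgraph (X : finType) := ELGraph {
  vert : finType;
  lab : vert -> vert -> X
}.

Definition is_morphism (X Y : finType) (R : {set X * Y})
    (G : elgraph X) (H : elgraph Y) (f : vert G -> vert H) : bool :=
  [forall u, forall v, (lab u v, lab (f u) (f v)) \in R].

(* The parts of a partition are nonempty, so the [x] picked is unique. *)
Definition contraction (X : finType) (H : elgraph X)
    (P : {set {set vert H}}) : elgraph (option X) :=
  @ELGraph (option X) {S : {set vert H} | S \in P}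
    (fun S1 S2 => [pick x | [forall u in val S1, forall v in val S2,
                               lab u v == x]]).
Arguments contraction {X} H P.

Definition e_adj (X : finType) (K : elgraph (option X)) : rel (vert K) :=
  fun u v => (lab u v == None) || (lab v u == None).

Definition e_component (X : finType) (K : elgraph (option X)) (u : vert K) :
    {set vert K} :=
  [set v | connect (@e_adj X K) u v].

Definition max_component (X : finType) (K : elgraph (option X)) : nat :=
  \max_(u : vert K) #|e_component u|.

Definition merge_step (V : finType) : rel {set {set V}} := fun P Q =>
  [exists S1 in P, exists S2 in P,
    (S1 != S2) && (Q == (S1 :|: S2) |: (P :\ S1 :\ S2))].

Definition singletons (V : finType) : {set {set V}} := [set [set v] | v : V].

(* The sequence of partitions (P_n, ..., P_1), n being the number of vertices;
   the graph H_k is [contraction H P_k]. *)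
Definition partition_seq (X : finType) (H : elgraph X) : Type :=
  #|vert H|.-tuple {set {set vert H}}.

Definition is_contraction_seq (X : finType) (H : elgraph X)
    (P : partition_seq H) : bool :=
  (head set0 P == singletons (vert H)) && sorted (@merge_step (vert H)) P.

(* [behead] drops P_n: only H_{n-1}, ..., H_1 count. *)
Definition component_width (X : finType) (H : elgraph X)
    (P : partition_seq H) : nat :=
  \max_(Q <- behead P) max_component (contraction H Q).

(* A component-width never exceeds #|vert H|, so the neutral element of the
   minimum is harmless. *)
Definition ctww (X : finType) (H : elgraph X) : nat :=
  \big[minn/#|vert H|]_(P : #|vert H|.-tuple {set {set vert H}}
                          | is_contraction_seq P) component_width P.

Definition optimal_contraction_seq (X : finType) (H : elgraph X)
    (P : partition_seq H) : Prop :=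
  is_contraction_seq P /\ component_width P = ctww H.

(** * Pre-morphisms *)

(* Functions between subsets; the codomain T is part of the type. *)
Definition fn (V U : finType) (S : {set V}) (T : {set U}) : finType :=
  {ffun {x : V | x \in S} -> {y : U | y \in T}}.

Definition const_fn (V U : finType) (S : {set V}) (a : U) : fn S [set a] :=
  [ffun _ => exist _ a (set11 a)].

Definition is_join (V U : finType) (S1 S2 : {set V}) (T1 T2 : {set U})
    (f1 : fn S1 T1) (f2 : fn S2 T2) (h : fn (S1 :|: S2) (T1 :|: T2)) : bool :=
  [forall x, forall x1, (val x1 == val x) ==> (val (h x) == val (f1 x1))] &&
  [forall x, forall x2, (val x2 == val x) ==> (val (h x) == val (f2 x2))].

Definition join_set (V U : finType) (S1 S2 : {set V}) (T1 T2 : {set U})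
    (F1 : {set fn S1 T1}) (F2 : {set fn S2 T2}) :
    {set fn (S1 :|: S2) (T1 :|: T2)} :=
  [set h | [exists f1 in F1, exists f2 in F2, is_join f1 f2 h]].

Definition weighting (A B : Type) : Type :=
  forall (X Y : finType) (G : elgraph X) (H : elgraph Y)
    (W : {ffun vert G * vert H -> B})
    (S : {set vert G}) (T : {set vert H}), {set fn S T} -> A.

Record pre_morphism (A : pzSemiRingType) (B : Type) (Omega : weighting A B) :
    Prop := PreMorphism {
  pre_morphism_union :
    forall (X Y : finType) (G : elgraph X) (H : elgraph Y)
      (W : {ffun vert G * vert H -> B}) (S : {set vert G}) (T : {set vert H})
      (F1 F2 : {set fn S T}),
    [disjoint F1 & F2] ->
    Omega X Y G H W S T (F1 :|: F2) =
      (Omega X Y G H W S T F1 + Omega X Y G H W S T F2)%R;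
  pre_morphism_join :
    forall (X Y : finType) (G : elgraph X) (H : elgraph Y)
      (W : {ffun vert G * vert H -> B})
      (S1 S2 : {set vert G}) (T1 T2 : {set vert H})
      (F1 : {set fn S1 T1}) (F2 : {set fn S2 T2}),
    [disjoint S1 & S2] -> [disjoint T1 & T2] ->
    Omega X Y G H W (S1 :|: S2) (T1 :|: T2) (join_set F1 F2) =
      (Omega X Y G H W S1 T1 F1 * Omega X Y G H W S2 T2 F2)%R;
  pre_morphism_empty :
    forall (X Y : finType) (G : elgraph X) (H : elgraph Y)
      (W : {ffun vert G * vert H -> B}) (S : {set vert G}) (T : {set vert H}),
    Omega X Y G H W S T set0 = 0%R
}.

Definition strong_pre_morphism (A : pzSemiRingType) (B : Type)
    (Omega : weighting A B) : Prop :=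
  pre_morphism Omega /\
  forall (X Y : finType) (G : elgraph X) (H : elgraph Y)
    (W : {ffun vert G * vert H -> B})
    (S1 S2 : {set vert G}) (T1 T2 : {set vert H})
    (F1 : {set fn S1 T1}) (F2 : {set fn S2 T2}),
  [disjoint S1 & S2] ->
  Omega X Y G H W (S1 :|: S2) (T1 :|: T2) (join_set F1 F2) =
    (Omega X Y G H W S1 T1 F1 * Omega X Y G H W S2 T2 F2)%R.

Definition corestriction_independent (A B : Type) (Omega : weighting A B) :
    Prop :=
  forall (X Y : finType) (G : elgraph X) (H : elgraph Y)
    (W : {ffun vert G * vert H -> B})
    (S : {set vert G}) (T T' : {set vert H}) (f : fn S T) (f' : fn S T'),
  T' \subset T -> (forall x, val (f x) = val (f' x)) ->
  Omega X Y G H W S T [set f] = Omega X Y G H W S T' [set f'].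

(* R-morphisms from G to H, as functions from the full set V_G to V_H. *)
Definition morphisms (X Y : finType) (R : {set X * Y})
    (G : elgraph X) (H : elgraph Y) :
    {set fn [set: vert G] [set: vert H]} :=
  [set f : fn [set: vert G] [set: vert H] |
    is_morphism R (fun u => val (f (exist _ u (in_setT u))))].

(* [tau G H W S a] is the time taken to evaluate Omega_W({S -> {a} constant}). *)
Definition evaluation_time (B : Type) : Type :=
  forall (X Y : finType) (G : elgraph X) (H : elgraph Y)
    (W : {ffun vert G * vert H -> B}) (S : {set vert G}) (a : vert H), nat.

(* Polynomial in the size of the data attached to S -> {a}: the induced graph
   G[S], the graph H and the restriction of W to S x V_H.  The constant-time
   cost of + and * is built into the machine below. *)
Definition poly_time (B : Type) (tau : evaluation_time B) : Prop :=
  exists c d : nat,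
  forall (X Y : finType) (G : elgraph X) (H : elgraph Y)
    (W : {ffun vert G * vert H -> B}) (S : {set vert G}) (a : vert H),
  tau X Y G H W S a <= c * (1 + #|S| + #|vert H| + #|X| + #|Y|) ^ d.

(** * Uniform-cost random access machine

    There is a read-only input tape of natural numbers, a memory of natural
    numbers and a memory of semiring elements, all randomly accessible.  Every
    elementary operation costs 1; numbers can only be added and subtracted. *)

Inductive nexp :=
  | NConst of nat
  | NInput of nexp
  | NCell of nexp
  | NAdd of nexp & nexp
  | NSub of nexp & nexp.

Inductive aexp :=
  | AZero
  | AOne
  | ACell of nexp
  | AAdd of aexp & aexp
  | AMul of aexp & aexp.

Inductive cmd :=
  | Skip
  | NStore of nexp & nexp
  | AStore of nexp & aexp
  | Query of nexp & nexp & nexp & nexp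
  | Seq of cmd & cmd
  | If of nexp & cmd & cmd
  | While of nexp & cmd.

Record state (A : Type) := State { nmem : nat -> nat; amem : nat -> A }.

Definition update (T : Type) (m : nat -> T) (i : nat) (x : T) : nat -> T :=
  fun j => if j == i then x else m j.

Fixpoint neval (inp mem : nat -> nat) (e : nexp) : nat :=
  match e with
  | NConst c => c
  | NInput e1 => inp (neval inp mem e1)
  | NCell e1 => mem (neval inp mem e1)
  | NAdd e1 e2 => neval inp mem e1 + neval inp mem e2
  | NSub e1 e2 => neval inp mem e1 - neval inp mem e2
  end.

Fixpoint ncost (e : nexp) : nat :=
  match e with
  | NConst _ => 1
  | NInput e1 | NCell e1 => (ncost e1).+1
  | NAdd e1 e2 | NSub e1 e2 => (ncost e1 + ncost e2).+1
  end.

Fixpoint aeval (A : pzSemiRingType) (inp : nat -> nat) (s : state A)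
    (e : aexp) : A :=
  match e with
  | AZero => 0%R
  | AOne => 1%R
  | ACell e1 => amem s (neval inp (nmem s) e1)
  | AAdd e1 e2 => (aeval inp s e1 + aeval inp s e2)%R
  | AMul e1 e2 => (aeval inp s e1 * aeval inp s e2)%R
  end.

Fixpoint acost (e : aexp) : nat :=
  match e with
  | AZero | AOne => 1
  | ACell e1 => (ncost e1).+1
  | AAdd e1 e2 | AMul e1 e2 => (acost e1 + acost e2).+1
  end.

(* [exec inp query p s s' t]: program p, started in s, halts in s' after t time
   units.  [Query addr base len tgt] stores at semiring address addr the answer
   of the evaluation oracle on the list of the len numbers stored from address
   base on and on the number tgt; the oracle returns a value and the time
   needed to compute it, and [None] blocks the machine. *)
Inductive exec (A : pzSemiRingType) (inp : nat -> nat)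
    (query : seq nat -> nat -> option (A * nat)) :
    cmd -> state A -> state A -> nat -> Prop :=
  | ExecSkip s : exec inp query Skip s s 0
  | ExecNStore addr e s :
      exec inp query (NStore addr e) s
        (State (update (nmem s) (neval inp (nmem s) addr)
                       (neval inp (nmem s) e))
               (amem s))
        (1 + ncost addr + ncost e)
  | ExecAStore addr e s :
      exec inp query (AStore addr e) s
        (State (nmem s)
               (update (amem s) (neval inp (nmem s) addr) (aeval inp s e)))
        (1 + ncost addr + acost e)
  | ExecQuery addr base len tgt s x t :
      query [seq nmem s (neval inp (nmem s) base + i)
                | i <- iota 0 (neval inp (nmem s) len)]
            (neval inp (nmem s) tgt) = Some (x, t) ->
      exec inp query (Query addr base len tgt) s
        (State (nmem s) (update (amem s) (neval inp (nmem s) addr) x))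
        (1 + ncost addr + ncost base + ncost len + ncost tgt
           + neval inp (nmem s) len + t)
  | ExecSeq p q s1 s2 s3 t1 t2 :
      exec inp query p s1 s2 t1 -> exec inp query q s2 s3 t2 ->
      exec inp query (Seq p q) s1 s3 (t1 + t2)
  | ExecIf e p q s s' t :
      exec inp query (if neval inp (nmem s) e != 0 then p else q) s s' t ->
      exec inp query (If e p q) s s' (1 + ncost e + t)
  | ExecWhileDone e p s :
      neval inp (nmem s) e = 0 ->
      exec inp query (While e p) s s (1 + ncost e)
  | ExecWhileStep e p s1 s2 s3 t1 t2 :
      neval inp (nmem s1) e != 0 ->
      exec inp query p s1 s2 t1 -> exec inp query (While e p) s2 s3 t2 ->
      exec inp query (While e p) s1 s3 (1 + ncost e + t1 + t2).

Definition init_state (A : pzSemiRingType) : state A :=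
  State (fun _ => 0) (fun _ => 0%R).

(* Vertices and labels are numbered by [enum_rank].  The tape holds the number n
   of vertices, then the n * n label matrix of G row by row, then, for each of
   P_n, ..., P_1, a row of n numbers giving for each vertex the least vertex
   of its part. *)
Definition part_number (V : finType) (Q : {set {set V}}) (v : V) : nat :=
  find [in pblock Q v] (enum V).

Definition input_tape (X : finType) (G : elgraph X) (P : partition_seq G) :
    seq nat :=
  #|vert G| ::
  [seq nat_of_ord (enum_rank (lab u v)) | u <- enum (vert G),
                                          v <- enum (vert G)] ++
  [seq part_number Q v | Q <- tval P, v <- enum (vert G)].

(* W enters a computation only through values of Omega_W on singletons of
   constant functions S -> {a}. *)
Definition evaluation_oracle (A B : Type) (Omega : weighting A B)
    (tau : evaluation_time B) (X Y : finType) (G : elgraph X) (H : elgraph Y)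
    (W : {ffun vert G * vert H -> B}) (s : seq nat) (k : nat) :
    option (A * nat) :=
  let S := [set v : vert G | nat_of_ord (enum_rank v) \in s] in
  omap (fun a => (Omega X Y G H W S [set a] [set const_fn S a],
                  tau X Y G H W S a))
       [pick a : vert H | nat_of_ord (enum_rank a) == k].

(* The program halts on the given input within time T, with output (the
   semiring element at address 0) equal to x. *)
Definition computes_within (A : pzSemiRingType) (tape : seq nat)
    (query : seq nat -> nat -> option (A * nat)) (p : cmd) (x : A) (T : nat) :
    Prop :=
  exists (s : state A) (t : nat),
    [/\ exec (nth 0 tape) query p (init_state A) s t, amem s 0 = x & t <= T].

(* Main.v *)
From HB Require Import structures.
Require Import Defs.
From mathcomp Require Import all_boot all_algebra zify.

Set Implicit Arguments.
Unset Strict Implicit.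
Unset Printing Implicit Defensive.
Import GRing.Theory.

(** Since [Omega] is strong and corestriction independent, [Omega W F] is the sum
    over [f] in [F] of the products of the values [q v (f v)] of [Omega W] on the
    functions {v} -> {f v}, and these values commute for distinct [v].  So oracle
    calls on single vertices suffice, each taking constant time, and it remains
    to sum the products of the [q v (f v)] over all morphisms [f].

    For each e-connected component of the current contraction, a table stores,
    for each profile (a nonempty subset of V_H for each part of the component),
    the sum over the partial morphisms whose image on each part is the
    prescribed subset.  A table is only required to be correct for the profiles
    compatible with the homogeneous labels of the component.  This is what
    allows the step that merges two parts s and t to test only the pairs
    involving s or t, hence to spend O(n) per profile: all other pairs keep
    their labels and can be tested later.  A step enumerates the at most
    (2^|V_H| - 1)^(ctww + 1) profiles of the components that it joins, and there
    are n - 1 steps. *)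

(** * A program logic for the random access machine *)

Inductive register :=
  | RSize | RIndex | RStage | RTape | RKept | RDropped | RFree | RBlock
  | RRunning | RCarry | RBad | RTarget | RLive | RComp | RTable | RMark
  | RDigit | RAcc | RRow | RLabel | RClash | RUnion | RPlace.

(* Every register is an unbounded array, cell [i] of register [a] being stored
   at address [32 * i + register_code a]; a scalar lives in cell [0]. *)
Definition register_code (a : register) : nat :=
  match a with
  | RSize => 0 | RIndex => 1 | RStage => 2 | RTape => 3 | RKept => 4
  | RDropped => 5 | RFree => 6 | RBlock => 7 | RRunning => 8 | RCarry => 9
  | RBad => 10 | RTarget => 11 | RLive => 12 | RComp => 13 | RTable => 14
  | RMark => 15 | RDigit => 16 | RAcc => 17 | RRow => 18 | RLabel => 19
  | RClash => 20 | RUnion => 21 | RPlace => 22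
  end.

Lemma register_code_inj : injective register_code.
Proof. by case; case. Qed.

Lemma register_code_lt a : register_code a < 32.
Proof. by case: a. Qed.

HB.instance Definition _ := Equality.copy register (inj_type register_code_inj).

Fixpoint nscale (c : nat) (e : nexp) : nexp :=
  if c is c'.+1 then NAdd e (nscale c' e) else NConst 0.

Definition address (a : register) (i : nexp) : nexp :=
  NAdd (nscale 32 i) (NConst (register_code a)).
Definition read (a : register) (i : nexp) : nexp := NCell (address a i).
Definition write (a : register) (i x : nexp) : cmd := NStore (address a i) x.
Definition var (a : register) : nexp := read a (NConst 0).
Definition assign (a : register) (x : nexp) : cmd := write a (NConst 0) x.
Definition ndist (e1 e2 : nexp) : nexp := NAdd (NSub e1 e2) (NSub e2 e1).
Definition is_zero (e : nexp) : nexp := NSub (NConst 1) e.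

Notation "p ;; q" := (Seq p q) (at level 60, right associativity).

Definition seqs (cs : seq cmd) : cmd := foldr Seq Skip cs.
Definition For (bound : nexp) (body : cmd) : cmd :=
  assign RIndex (NConst 0) ;;
  While (NSub bound (var RIndex))
    (body ;; assign RIndex (NAdd (var RIndex) (NConst 1))).
Definition store_table (a : register) (m : nat) (x : nat -> nat) : cmd :=
  seqs [seq write a (NConst k) (NConst (x k)) | k <- iota 0 m].

Fixpoint straight_line (c : cmd) : bool :=
  match c with
  | Query _ _ _ _ | While _ _ => false
  | Seq p q | If _ p q => straight_line p && straight_line q
  | _ => true
  end.

(* The running time when every loop body is run once and every oracle call has
   a list of length one and takes time [C]. *)
Fixpoint static_cost (C : nat) (c : cmd) : nat :=
  match c with
  | Skip => 0
  | NStore a e => 1 + ncost a + ncost e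
  | AStore a e => 1 + ncost a + acost e
  | Query a b l t => 1 + ncost a + ncost b + ncost l + ncost t + 1 + C
  | Seq p q => static_cost C p + static_cost C q
  | If e p q => 1 + ncost e + static_cost C p + static_cost C q
  | While e p => 1 + ncost e + static_cost C p
  end.

Arguments nscale : simpl never.
Arguments read : simpl never.
Arguments write : simpl never.
Arguments var : simpl never.
Arguments assign : simpl never.
Arguments For : simpl never.
Arguments ndist : simpl never.
Arguments is_zero : simpl never.
Arguments store_table : simpl never.

Section Machine.

Variables (A : pzSemiRingType) (inp : nat -> nat).
Variables (query : seq nat -> nat -> option (A * nat)) (C : nat).

Implicit Types (s : state A) (a b : register) (Q : state A -> Prop).
Implicit Types (ms : seq register).

Definition get s a i := nmem s (32 * i + register_code a).
Definition put s a i x :=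
  State (update (nmem s) (32 * i + register_code a) x) (amem s).
Definition aput s k x := State (nmem s) (update (amem s) k x).
Definition ev s e := neval inp (nmem s) e.

Lemma get_put s a i x b j :
  get (put s a i x) b j = if (b == a) && (j == i) then x else get s b j.
Proof.
rewrite /get /put /= /update -(inj_eq register_code_inj).
have := register_code_lt a; have := register_code_lt b.
by case: (register_code b =P register_code a); case: (j =P i); case: eqP => //=; lia.
Qed.

Lemma get_aput s k x b j : get (aput s k x) b j = get s b j.
Proof. by []. Qed.

Lemma amem_put s a i x : amem (put s a i x) = amem s.
Proof. by []. Qed.

Lemma amem_aput s k x j :
  amem (aput s k x) j = if j == k then x else amem s j.
Proof. by []. Qed.

Definition stateE := (get_put, get_aput, amem_put, amem_aput).

Lemma ev_const s c : ev s (NConst c) = c. Proof. by []. Qed.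
Lemma ev_add s e1 e2 : ev s (NAdd e1 e2) = ev s e1 + ev s e2.
Proof. by []. Qed.
Lemma ev_sub s e1 e2 : ev s (NSub e1 e2) = ev s e1 - ev s e2.
Proof. by []. Qed.
Lemma ev_input s e : ev s (NInput e) = inp (ev s e). Proof. by []. Qed.
Lemma ev_scale s c e : ev s (nscale c e) = c * ev s e.
Proof. by elim: c => //= c IH; rewrite /nscale -/nscale ev_add IH mulSn. Qed.
Lemma ev_read s a i : ev s (read a i) = get s a (ev s i).
Proof.
by rewrite -[LHS]/(nmem s (ev s (address a i))) /address ev_add ev_scale.
Qed.
Lemma ev_var s a : ev s (var a) = get s a 0.
Proof. exact: ev_read. Qed.
Lemma ev_dist s e1 e2 :
  ev s (ndist e1 e2) = (ev s e1 - ev s e2) + (ev s e2 - ev s e1).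
Proof. by []. Qed.
Lemma ev_is_zero s e : ev s (is_zero e) = (ev s e == 0).
Proof. by rewrite /is_zero ev_sub; case: (ev s e). Qed.

Definition evE := (ev_const, ev_var, ev_read, ev_dist, ev_is_zero, ev_add,
  ev_sub, ev_input, ev_scale).

Fixpoint run (c : cmd) s : state A :=
  match c with
  | NStore a e => State (update (nmem s) (ev s a) (ev s e)) (amem s)
  | AStore a e => State (nmem s) (update (amem s) (ev s a) (aeval inp s e))
  | Seq p q => run q (run p s)
  | If e p q => if ev s e != 0 then run p s else run q s
  | _ => s
  end.

Lemma run_write s a i x : run (write a i x) s = put s a (ev s i) (ev s x).
Proof. by rewrite /write /put /= /address ev_add ev_scale. Qed.
Lemma run_assign s a x : run (assign a x) s = put s a 0 (ev s x).
Proof. exact: run_write. Qed.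
Lemma run_astore k x s :
  run (AStore k x) s = aput s (ev s k) (aeval inp s x).
Proof. by []. Qed.
Lemma run_seq p q s : run (p ;; q) s = run q (run p s). Proof. by []. Qed.
Lemma run_if e p q s :
  run (If e p q) s = if ev s e != 0 then run p s else run q s.
Proof. by []. Qed.
Lemma run_skip s : run Skip s = s. Proof. by []. Qed.

Definition runE :=
  (run_write, run_assign, run_astore, run_seq, run_if, run_skip).

Lemma exec_straight_line c s : straight_line c ->
  exists2 t, exec inp query c s (run c s) t & t <= static_cost C c.
Proof.
elim: c s => //=.
- by move=> s _; exists 0 => //; constructor.
- by move=> a e s _; eexists; [apply: ExecNStore|].
- by move=> a e s _; eexists; [apply: ExecAStore|].
- move=> p IHp q IHq s /andP[/IHp runs_p /IHq runs_q].
  have [t1 ex1 le1] := runs_p s; have [t2 ex2 le2] := runs_q (run p s).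
  by exists (t1 + t2); [apply: ExecSeq ex1 ex2 | apply: leq_add].
- move=> e p IHp q IHq s /andP[/IHp runs_p /IHq runs_q].
  have [t1 ex1 le1] := runs_p s; have [t2 ex2 le2] := runs_q s.
  exists (1 + ncost e + (if ev s e != 0 then t1 else t2)).
    by constructor; rewrite -/(ev s e); case: ifP.
  by case: ifP => _; lia.
Qed.

Arguments run : simpl never.

(* The factor [m] accounts for the loops: nested loops of [m1] and [m2] rounds
   cost about [m1 * m2] times the static cost, and the factor of a sequence is
   the maximum of the factors of its members. *)
Definition wp (m : nat) (c : cmd) Q s :=
  exists s' t, [/\ exec inp query c s s' t, t <= static_cost C c * m & Q s'].

Lemma wp_mono m m' c Q Q' s :
  m <= m' -> (forall s', Q s' -> Q' s') -> wp m c Q s -> wp m' c Q' s.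
Proof.
move=> le_m QQ' [s' [t [ex le_t Qs']]]; exists s', t; split=> //.
  by apply: leq_trans le_t _; rewrite leq_mul2l le_m orbT.
exact: QQ'.
Qed.

Lemma wp_post m c Q Q' s :
  (forall s', Q s' -> Q' s') -> wp m c Q s -> wp m c Q' s.
Proof. exact: wp_mono. Qed.

Lemma wp_run m c Q s : straight_line c -> 0 < m -> Q (run c s) -> wp m c Q s.
Proof.
move=> sl_c m_gt0 Qs; have [t ex le_t] := exec_straight_line s sl_c.
by exists (run c s), t; split=> //; apply: leq_trans le_t _; rewrite leq_pmulr.
Qed.

Lemma wp_bind_leq m m1 p q P Q s :
  m1 <= m -> wp m1 p P s -> (forall s', P s' -> wp m q Q s') ->
  wp m (p ;; q) Q s.
Proof.
move=> le_m [s1 [t1 [ex1 le1 Ps1]]] wp_q.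
have [s2 [t2 [ex2 le2 Qs2]]] := wp_q s1 Ps1.
exists s2, (t1 + t2); split=> //; first exact: ExecSeq ex1 ex2.
rewrite /= mulnDl leq_add //; apply: leq_trans le1 _.
by rewrite leq_mul2l le_m orbT.
Qed.

Lemma wp_bind m p q P Q s :
  wp m p P s -> (forall s', P s' -> wp m q Q s') -> wp m (p ;; q) Q s.
Proof. exact: wp_bind_leq. Qed.

Lemma wp_run_seq m p q Q s :
  straight_line p -> 0 < m -> wp m q Q (run p s) -> wp m (p ;; q) Q s.
Proof.
move=> sl_p m_gt0 wp_q; apply: (wp_bind (P := eq (run p s))).
  exact: wp_run.
by move=> _ <-.
Qed.

Lemma wp_assign m a x q Q s :
  0 < m -> wp m q Q (put s a 0 (ev s x)) -> wp m (assign a x ;; q) Q s.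
Proof. by move=> m_gt0 wp_q; apply: wp_run_seq; rewrite // run_assign. Qed.

Lemma wp_query m addr base len tgt Q s x t : 0 < m ->
  ev s len = 1 -> query [:: nmem s (ev s base)] (ev s tgt) = Some (x, t) ->
  t <= C -> Q (aput s (ev s addr) x) -> wp m (Query addr base len tgt) Q s.
Proof.
move=> m_gt0 len1 answer le_t Qs; exists (aput s (ev s addr) x).
eexists; split; last exact: Qs.
  by apply: ExecQuery; rewrite -/(ev s len) len1 /= addn0; apply: answer.
rewrite -/(ev s len) len1; apply: leq_trans (leq_pmulr _ m_gt0).
by rewrite /=; lia.
Qed.

Lemma wp_while r m e body (I : nat -> state A -> Prop) s :
  0 < m -> I 0 s ->
  (forall k s, k < r -> I k s -> ev s e != 0 /\ wp m body (I k.+1) s) ->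
  (forall s, I r s -> ev s e = 0) ->
  wp (m * r.+1) (While e body) (I r) s.
Proof.
move=> m_gt0 I0 step stop.
suff rounds k j s1 : j + k = r -> I j s1 ->
    exists s' t, [/\ exec inp query (While e body) s1 s' t,
      t <= (1 + ncost e) * k.+1 + static_cost C body * m * k & I r s'].
  have [s' [t [ex le_t Is']]] := rounds r 0 s (add0n r) I0.
  exists s', t; split=> //; apply: leq_trans le_t _.
  rewrite [leqRHS]mulnDl; apply: leq_add; first by rewrite leq_mul2l leq_pmull ?orbT.
  by rewrite -mulnA !leq_mul // leqW.
elim: k j s1 => [|k IH] j s1 jk Ij.
  rewrite addn0 in jk; rewrite -jk in stop *.
  exists s1, (1 + ncost e); split=> //; last by lia.
  by apply: ExecWhileDone; apply: stop.
have [|nz [s2 [t1 [ex1 le1 I1]]]] := step j s1 _ Ij; first by lia.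
have [|s3 [t2 [ex2 le2 I2]]] := IH j.+1 s2 _ I1; first by lia.
exists s3, (1 + ncost e + t1 + t2); split=> //; first exact: ExecWhileStep nz ex1 ex2.
by rewrite !mulnS in le2 *; lia.
Qed.

Definition frame ms s0 s :=
  forall a i, a \notin ms -> get s a i = get s0 a i.

Lemma frame_put ms s0 s a i x :
  a \in ms -> frame ms s0 s -> frame ms s0 (put s a i x).
Proof.
move=> a_ms fr b j; rewrite get_put; case: eqP => [-> /negP //|_].
exact: fr.
Qed.

Lemma frame_trans ms ms' s0 s1 s2 :
  frame ms s0 s1 -> frame ms' s1 s2 -> frame (ms ++ ms') s0 s2.
Proof.
move=> fr1 fr2 a i; rewrite mem_cat negb_or => /andP[nms nms'].
by rewrite fr2 // fr1.
Qed.

Lemma frame_sub ms ms' s0 s :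
  frame ms s0 s -> all [in ms'] ms -> frame ms' s0 s.
Proof.
by move=> fr /allP sub a i nms'; apply: fr; apply: contra nms' => /sub.
Qed.

Lemma wp_for r m ms bound body (I : nat -> state A -> Prop) s0 :
  0 < m -> RIndex \in ms ->
  (forall s, frame ms s0 s -> ev s bound = r) ->
  (forall k s x, I k s -> I k (put s RIndex 0 x)) -> I 0 s0 ->
  (forall k s, k < r -> frame ms s0 s -> get s RIndex 0 = k -> I k s ->
     wp m body (fun s' => [/\ frame ms s0 s', get s' RIndex 0 = k & I k.+1 s']) s) ->
  wp (m * r.+1) (For bound body) (fun s => frame ms s0 s /\ I r s) s0.
Proof.
move=> m_gt0 ms_idx bound_r I_idx I0 step; apply: wp_assign; rewrite ?muln_gt0 ?m_gt0 //.
pose J k s := [/\ frame ms s0 s, get s RIndex 0 = k & I k s].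
apply: (@wp_mono (m * r.+1) _ _ (J r)) => // [s' [] //|].
apply: (wp_while m_gt0).
- by split; [apply: frame_put | rewrite get_put | apply: I_idx].
- move=> k s kr [fr idx Ik]; rewrite !evE bound_r // idx -lt0n subn_gt0; split=> //.
  apply: wp_bind (step k s kr fr idx Ik) _ => s' [fr' idx' Ik'].
  apply: wp_run; rewrite // runE !evE idx' addn1; split.
  + exact: frame_put.
  + by rewrite get_put !eqxx.
  + exact: I_idx.
- by move=> s [fr idx _]; rewrite !evE bound_r // idx subnn.
Qed.

Lemma wp_for_run r ms bound body (I : nat -> state A -> Prop) s0 :
  straight_line body -> RIndex \in ms ->
  (forall s, frame ms s0 s -> ev s bound = r) ->
  (forall k s x, I k s -> I k (put s RIndex 0 x)) -> I 0 s0 ->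
  (forall k s, k < r -> frame ms s0 s -> get s RIndex 0 = k -> I k s ->
     [/\ frame ms s0 (run body s), get (run body s) RIndex 0 = k
       & I k.+1 (run body s)]) ->
  wp r.+1 (For bound body) (fun s => frame ms s0 s /\ I r s) s0.
Proof.
move=> sl_body ms_idx bound_r I_idx I0 step; rewrite -[r.+1]mul1n.
by apply: wp_for => // k s kr fr idx Ik; apply: wp_run => //; apply: step.
Qed.

(* [contents k] is what the array [a] holds after [k] rounds. *)
Lemma wp_for_update r a bound body (contents : nat -> nat -> nat) s0 :
  straight_line body -> a != RIndex ->
  (forall s, frame [:: RIndex; a] s0 s -> ev s bound = r) ->
  get s0 a =1 contents 0 ->
  (forall k s, k < r -> frame [:: RIndex; a] s0 s -> get s RIndex 0 = k ->
     get s a =1 contents k ->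
     exists (b : bool) i x,
       run body s = (if b then put s a i x else s) /\
       contents k.+1 =1 if b then update (contents k) i x else contents k) ->
  wp r.+1 (For bound body)
    (fun s => [/\ frame [:: RIndex; a] s0 s, amem s = amem s0
                & get s a =1 contents r]) s0.
Proof.
move=> sl_body a_idx bound_r init step.
pose I k s := amem s = amem s0 /\ get s a =1 contents k.
apply: (@wp_mono r.+1 _ _ (fun s => frame [:: RIndex; a] s0 s /\ I r s)) => //.
  by move=> s [fr []].
apply: wp_for_run; rewrite ?mem_head //.
  by move=> k s y [am get_a]; split=> // j; rewrite get_put (negbTE a_idx) get_a.
move=> k s kr fr idx [am get_a].
have [[] [i [x [-> next]]]] := step k s kr fr idx get_a.
  split; last by split=> // j; rewrite next get_put eqxx /update get_a.
    by apply: frame_put => //; rewrite !inE eqxx orbT.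
  by rewrite get_put eq_sym (negbTE a_idx).
by split=> //; split=> // j; rewrite get_a next.
Qed.

Lemma wp_for_write r a bound i x (contents : nat -> nat -> nat) s0 :
  a != RIndex ->
  (forall s, frame [:: RIndex; a] s0 s -> ev s bound = r) ->
  get s0 a =1 contents 0 ->
  (forall k s, k < r -> frame [:: RIndex; a] s0 s -> get s RIndex 0 = k ->
     get s a =1 contents k ->
     contents k.+1 =1 update (contents k) (ev s i) (ev s x)) ->
  wp r.+1 (For bound (write a i x))
    (fun s => [/\ frame [:: RIndex; a] s0 s, amem s = amem s0
                & get s a =1 contents r]) s0.
Proof.
move=> a_idx bound_r init step; apply: wp_for_update => // k s kr fr idx get_a.
by exists true, (ev s i), (ev s x); rewrite run_write; split=> //; apply: step.
Qed.

Lemma wp_for_write_if r a bound e i x (contents : nat -> nat -> nat) s0 :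
  a != RIndex ->
  (forall s, frame [:: RIndex; a] s0 s -> ev s bound = r) ->
  get s0 a =1 contents 0 ->
  (forall k s, k < r -> frame [:: RIndex; a] s0 s -> get s RIndex 0 = k ->
     get s a =1 contents k ->
     contents k.+1 =1 if ev s e != 0 then update (contents k) (ev s i) (ev s x)
                      else contents k) ->
  wp r.+1 (For bound (If e (write a i x) Skip))
    (fun s => [/\ frame [:: RIndex; a] s0 s, amem s = amem s0
                & get s a =1 contents r]) s0.
Proof.
move=> a_idx bound_r init step; apply: wp_for_update => // k s kr fr idx get_a.
by exists (ev s e != 0), (ev s i), (ev s x); rewrite !runE; split=> //; apply: step.
Qed.

Lemma straight_line_seqs (T : Type) (F : T -> cmd) (l : seq T) :
  (forall x, straight_line (F x)) -> straight_line (seqs (map F l)).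
Proof. by move=> sl_F; elim: l => //= x l ->; rewrite sl_F. Qed.

Lemma run_stores a (x : nat -> nat) j r s :
  let s' := run (seqs [seq write a (NConst k) (NConst (x k)) | k <- iota j r]) s in
  [/\ frame [:: a] s s', amem s' = amem s
    & forall k, get s' a k = if j <= k < j + r then x k else get s a k].
Proof.
elim: r j s => [|r IH] j s /=.
  by split=> // k; rewrite addn0; case: ifP => //; lia.
rewrite run_seq run_write !evE.
have [fr am get_a] := IH j.+1 (put s a j (x j)).
split=> [b i nb||k].
- by rewrite fr // get_put; case: eqP nb => // ->; rewrite mem_head.
- by rewrite am.
- rewrite get_a get_put eqxx /= addSnnS.
  by case: ltngtP => // ->; rewrite /= ifT //; lia.
Qed.

Lemma wp_store_table m a r (x : nat -> nat) s0 : 0 < m ->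
  wp m (store_table a r x)
    (fun s => [/\ frame [:: a] s0 s, amem s = amem s0
      & forall k, k < r -> get s a k = x k]) s0.
Proof.
move=> m_gt0; apply: wp_run => //; first exact: straight_line_seqs.
have [fr am get_a] := run_stores a x 0 r s0; split=> // k kr.
by rewrite get_a /= kr.
Qed.

End Machine.

Arguments get : simpl never.
Arguments put : simpl never.
Arguments aput : simpl never.
Arguments ev : simpl never.
Arguments run : simpl never.

(** * Labels between the parts of a partition *)

Lemma connect_homo (T T' : finType) (e : rel T) (e' : rel T') (f : T -> T') :
  {homo f : x y / e x y >-> e' x y} ->
  {homo f : x y / connect e x y >-> connect e' x y}.
Proof.
move=> homo_f x y /connectP[p ep ->]; apply/connectP; exists (map f p).
  exact: homo_path homo_f ep.
by rewrite last_map.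
Qed.

Lemma option_ext (T : Type) (a b : option T) :
  (forall x, a = Some x <-> b = Some x) -> a = b.
Proof.
case: a => [x|] ab; first by apply/esym/ab.
by case: b ab => // y ab; apply/ab.
Qed.

Definition agree (T : eqType) (x0 x y : T) : T := if x == y then x else x0.

Lemma agree_inj (T T' : eqType) (f : T -> T') (x0 x y : T) :
  injective f -> agree (f x0) (f x) (f y) = f (agree x0 x y).
Proof. by move=> f_inj; rewrite /agree (inj_eq f_inj); case: eqP. Qed.

Definition merge_rows (V T : eqType) (x0 : T) (s t : V) (M : V -> V -> T) i j :=
  if i == s then agree x0 (M s j) (M t j) else M i j.
Definition merge_cols (V T : eqType) (x0 : T) (s t : V) (M : V -> V -> T) i j :=
  if j == s then agree x0 (M i s) (M i t) else M i j.

Section PartLabels.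

(* A partition of [V] is encoded by the idempotent map [rho] that sends each
   vertex to the representative of its part. *)
Variables (V : finType) (L : eqType) (lb : V -> V -> L).

Implicit Types (rho : V -> V) (i j k v w s t : V) (a b : option L).

Definition heterogeneous rho i j :=
  [exists v, exists w, [&& rho v == i, rho w == j & lb v w != lb i j]].

(* [None] is the label e of the contraction. *)
Definition part_label rho i j : option L :=
  if heterogeneous rho i j then None else Some (lb i j).

Definition part_adj rho : rel V := fun i j =>
  [&& rho i == i, rho j == j &
      (part_label rho i j == None) || (part_label rho j i == None)].

Definition merge_rep rho s t v := if rho v == t then s else rho v.

Lemma part_adj_sym rho : symmetric (part_adj rho).
Proof. by move=> i j; rewrite /part_adj andbCA orbC. Qed.

Lemma eq_part_adj rho rho' : rho =1 rho' -> part_adj rho =2 part_adj rho'.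
Proof.
move=> eq_rho i j.
have eq_het k l : heterogeneous rho k l = heterogeneous rho' k l.
  by apply: eq_existsb => v; apply: eq_existsb => w; rewrite !eq_rho.
by rewrite /part_adj /part_label !eq_rho !eq_het.
Qed.

Lemma part_label_id i j : part_label id i j = Some (lb i j).
Proof.
rewrite /part_label ifF //; apply/negbTE/existsPn => v; apply/existsPn => w.
by apply/and3P => -[/eqP -> /eqP ->]; rewrite eqxx.
Qed.

Lemma lb_part_label rho v w x :
  part_label rho (rho v) (rho w) = Some x -> lb v w = x.
Proof.
rewrite /part_label; case: ifPn => // /existsPn/(_ v)/existsPn/(_ w).
by rewrite !eqxx negbK => /eqP -> [].
Qed.

Lemma part_labelP rho i j x : rho i = i -> rho j = j ->
  part_label rho i j = Some x <->
  (forall v w, rho v = i -> rho w = j -> lb v w = x).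
Proof.
move=> ri rj; split=> [lab v w rv rw|lab].
  by apply: (@lb_part_label rho); rewrite rv rw.
rewrite /part_label ifF; first by rewrite (lab i j).
apply/negbTE/existsPn => v; apply/existsPn => w; apply/and3P => -[/eqP rv /eqP rw].
by rewrite (lab v w) // (lab i j) // eqxx.
Qed.

Lemma agree_Some a b x : agree None a b = Some x <-> a = Some x /\ b = Some x.
Proof.
rewrite /agree; case: eqP => [<-|ab]; first by split=> [|[]].
by split=> // -[ax bx]; case: ab; rewrite ax bx.
Qed.

Section Merge.

Variables (rho : V -> V) (s t : V).
Hypothesis rho_idem : forall v, rho (rho v) = rho v.
Hypotheses (rs : rho s = s) (rt : rho t = t) (st_neq : s != t).

Notation rho' := (merge_rep rho s t).

Lemma merge_rep_kept : rho' s = s.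
Proof. by rewrite /merge_rep rs (negbTE st_neq). Qed.

Lemma merge_rep_dropped : rho' t = s.
Proof. by rewrite /merge_rep rt eqxx. Qed.

Lemma merge_rep_idem v : rho' (rho' v) = rho' v.
Proof.
rewrite {2 3}/merge_rep; case: eqP => [_|/eqP nt]; first exact: merge_rep_kept.
by rewrite /merge_rep rho_idem (negbTE nt).
Qed.

Lemma merge_rep_fix i : (rho' i == i) = (rho i == i) && (i != t).
Proof.
rewrite /merge_rep; case: (rho i =P t) => [rit|/eqP nt].
  apply/eqP/andP => [si|[/eqP <-]]; last by rewrite rit eqxx.
  by move: st_neq; rewrite -rit -si rs eqxx.
by case: eqP => //= ri; rewrite -{1}ri nt.
Qed.

Lemma merge_rep_live i : rho' i = i -> rho i = i /\ i != t.
Proof. by move/eqP; rewrite merge_rep_fix => /andP[/eqP]. Qed.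

Lemma merge_rep_other i : rho i = i -> i != t -> rho' i = i.
Proof. by move=> /eqP ri nt; apply/eqP; rewrite merge_rep_fix ri. Qed.

Lemma merge_rep_fibre k i : rho k = k -> rho' i = i ->
  rho' k = i <-> if i == s then k = s \/ k = t else k = i.
Proof.
move=> rk /merge_rep_live[ri nit]; rewrite /merge_rep rk.
have [->|nkt] := eqVneq k t.
  case: eqP => [->|nis]; first by split=> // _; right.
  by split=> [/esym //|ti]; rewrite ti eqxx in nit.
case: eqP => [->|//]; split=> [->|[//|kt]]; first by left.
by rewrite kt eqxx in nkt.
Qed.

Lemma merge_rowsP (M : V -> V -> option L) i j x : rho' i = i ->
  merge_rows None s t M i j = Some x <->
  (forall k, rho k = k -> rho' k = i -> M k j = Some x).
Proof.
move=> ri'; have [ri _] := merge_rep_live ri'; rewrite /merge_rows.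
split=> [lab k rk /(merge_rep_fibre rk ri')|lab].
  by case: ifP lab => [_ /agree_Some[Ms Mt] [->|->]|_ Mi ->].
case: eqP ri' lab => [->|nis] ri' lab; last exact: lab.
by apply/agree_Some; split; apply: lab; rewrite ?merge_rep_kept ?merge_rep_dropped.
Qed.

Lemma merge_colsP (M : V -> V -> option L) i j x : rho' j = j ->
  merge_cols None s t M i j = Some x <->
  (forall k, rho k = k -> rho' k = j -> M i k = Some x).
Proof. exact: (@merge_rowsP (fun j i => M i j)). Qed.

Lemma part_label_merge i j : rho' i = i -> rho' j = j ->
  part_label rho' i j = merge_cols None s t (merge_rows None s t (part_label rho)) i j.
Proof.
move=> ri rj; apply: option_ext => x; rewrite part_labelP // merge_colsP //.
split=> [lab l rl rl'|lab v w rv rw].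
  apply/merge_rowsP => // k rk rk'; apply/part_labelP => // v w rv rw.
  by apply: lab; rewrite -?rk' -?rl' /merge_rep ?rv ?rw ?rk ?rl.
have merge_rho u : rho' (rho u) = rho' u by rewrite /merge_rep rho_idem.
apply: (@lb_part_label rho); have := lab (rho w) (rho_idem w).
by rewrite merge_rho merge_rowsP // => /(_ rw (rho v)); rewrite merge_rho; apply.
Qed.

Lemma part_label_merge_other i j : rho' i = i -> rho' j = j ->
  i != s -> j != s -> part_label rho' i j = part_label rho i j.
Proof.
move=> ri rj /negbTE nis /negbTE njs.
by rewrite part_label_merge // /merge_cols /merge_rows nis njs.
Qed.

Lemma part_label_merge_None i j : rho i = i -> rho j = j ->
  part_label rho i j = None -> part_label rho' (rho' i) (rho' j) = None.
Proof.
move=> ri rj none; case lab: (part_label rho' _ _) => [x|//].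
suff : part_label rho i j = Some x by rewrite none.
apply/part_labelP => // v w rv rw; move/part_labelP: lab.
by apply; rewrite ?merge_rep_idem // /merge_rep ?rv ?ri ?rw ?rj.
Qed.

Lemma part_adj_merge : {homo rho' : i j / part_adj rho i j >-> part_adj rho' i j}.
Proof.
move=> i j /and3P[/eqP ri /eqP rj adj]; rewrite /part_adj !merge_rep_idem !eqxx /=.
by case/orP: adj => /eqP none; rewrite (part_label_merge_None _ _ none) ?eqxx ?orbT.
Qed.

End Merge.

End PartLabels.

(** * Components of the contraction *)

Section Components.

Variables (V : finType) (L : eqType) (lb : V -> V -> L).
Implicit Types (i j c : V) (rho co : V -> V).

Definition component rho i : {set V} := [set j | connect (part_adj lb rho) i j].

Definition in_component rho co c i := (rho i == i) && (co i == c).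

Lemma eq_component rho rho' : rho =1 rho' -> component rho =1 component rho'.
Proof.
move=> eq_rho i; apply/setP => j.
by rewrite !inE (eq_connect (eq_part_adj lb eq_rho)).
Qed.

(* [co] sends the representative of a part to a representative that names its
   e-connected component. *)
Record component_map rho co : Prop := ComponentMap {
  component_live : forall i, rho i = i -> rho (co i) = co i;
  component_idem : forall i, rho i = i -> co (co i) = co i;
  component_adj : forall i j, rho i = i -> rho j = j ->
    part_label lb rho i j = None -> co i = co j;
  component_connect : forall i j, rho i = i -> rho j = j -> co i = co j ->
    connect (part_adj lb rho) i j
}.

Lemma component_map_id : component_map id id.
Proof. by split=> // i j _ _; [rewrite part_label_id | move=> ->; apply: connect0]. Qed.

Section Merge.

Variables (rho co : V -> V) (s t : V).
Hypothesis rho_idem : forall v, rho (rho v) = rho v.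
Hypotheses (rs : rho s = s) (rt : rho t = t) (st_neq : s != t).
Hypothesis co_map : component_map rho co.

Notation rho' := (merge_rep rho s t).

Definition touches i := (rho' i == s) || part_adj lb rho' s i.

Definition marked c := [exists i, [&& rho i == i, co i == c & touches i]].

Definition merging i := (rho i == i) && marked (co i).

Definition merge_component i := if marked (co i) then s else co i.

Lemma touchesE i : rho i = i -> touches i =
  [|| i == s, i == t,
      agree None (part_label lb rho s i) (part_label lb rho t i) == None |
      agree None (part_label lb rho i s) (part_label lb rho i t) == None].
Proof.
move=> ri; have rs' := merge_rep_kept rs st_neq; rewrite /touches /part_adj rs' eqxx.
have [->|nt] := eqVneq i t; first by rewrite merge_rep_dropped ?eqxx ?orbT.
have ri' := merge_rep_other rs st_neq ri nt; rewrite ri' eqxx.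
have [//|ns] := eqVneq i s.
by rewrite !part_label_merge // /merge_cols /merge_rows eqxx (negbTE ns).
Qed.

Lemma touches_marked i : rho i = i -> touches i -> marked (co i).
Proof. by move=> ri ti; apply/existsP; exists i; rewrite ri !eqxx. Qed.

Lemma marked_kept : marked (co s).
Proof. by apply: touches_marked; rewrite // /touches merge_rep_kept ?eqxx. Qed.

Lemma marked_dropped : marked (co t).
Proof. by apply: touches_marked; rewrite // /touches merge_rep_dropped ?eqxx. Qed.

Lemma marked_live c : marked c -> rho c = c /\ co c = c.
Proof.
case/existsP=> i /and3P[/eqP ri /eqP <- _].
by split; [apply: (component_live co_map) | apply: (component_idem co_map)].
Qed.

Lemma merging_kept : merging s.
Proof. by rewrite /merging rs eqxx marked_kept. Qed.

Lemma merging_dropped : merging t.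
Proof. by rewrite /merging rt eqxx marked_dropped. Qed.

Lemma merge_component_kept : merge_component s = s.
Proof. by rewrite /merge_component marked_kept. Qed.

Lemma merge_component_eq_kept i : rho i = i ->
  (merge_component i == s) = marked (co i).
Proof.
rewrite /merge_component; case: ifPn => [|nm ri]; first by rewrite eqxx.
apply/eqP => ci; have cc := component_idem co_map ri.
by move: nm; rewrite -cc ci marked_kept.
Qed.

Lemma merging_connect i : rho' i = i -> merging i ->
  connect (part_adj lb rho') s i.
Proof.
move=> ri' /andP[/eqP ri /existsP[k /and3P[/eqP rk /eqP ck tk]]].
have sk : connect (part_adj lb rho') s (rho' k).
  case/orP: tk => [/eqP -> //|adj]; have /and3P[_ /eqP -> _] := adj.
  exact: connect1.
apply: connect_trans sk _; rewrite -[X in connect _ _ X]ri'.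
apply: connect_homo (part_adj_merge _ _ _) _ _ _ => //.
exact: (component_connect co_map).
Qed.

Lemma merge_component_adj i j : rho' i = i -> rho' j = j ->
  part_label lb rho' i j = None -> merge_component i = merge_component j.
Proof.
move=> ri' rj' none.
have [ri _] := merge_rep_live rs st_neq ri'; have [rj _] := merge_rep_live rs st_neq rj'.
have near_kept k : rho' k = k -> part_adj lb rho' s k ->
    merge_component s = merge_component k.
  move=> rk' adj; have [rk _] := merge_rep_live rs st_neq rk'.
  apply/esym; rewrite merge_component_kept; apply/eqP.
  rewrite merge_component_eq_kept //; apply: touches_marked => //.
  by rewrite /touches adj orbT.
have adj : part_adj lb rho' i j by rewrite /part_adj ri' rj' none !eqxx.
have [eis|nis] := eqVneq i s; first by rewrite eis in adj *; apply: near_kept.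
have [ejs|njs] := eqVneq j s.
  by rewrite ejs part_adj_sym in adj *; apply/esym/near_kept.
rewrite /merge_component (component_adj co_map ri rj) //.
by rewrite -(part_label_merge_other lb rho_idem rs rt st_neq).
Qed.

Lemma component_map_merge : component_map rho' merge_component.
Proof.
have live i : rho' i = i -> rho i = i by case/(merge_rep_live rs st_neq).
split=> [i /live ri|i /live ri|i j|i j ri' rj' eq_co].
- rewrite /merge_component; case: ifPn => [_|nm]; first exact: merge_rep_kept.
  apply: merge_rep_other => //; first exact: (component_live co_map).
  apply: contraNneq nm => cit.
  by rewrite -(component_idem co_map) // cit marked_dropped.
- rewrite {2 3}/merge_component; case: ifPn => [_|nm]; first exact: merge_component_kept.
  by rewrite /merge_component (component_idem co_map) // (negbTE nm).
- exact: merge_component_adj.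
have [ri rj] := (live i ri', live j rj').
have [mi|mi] := boolP (marked (co i)).
  have mj : marked (co j).
    by rewrite -merge_component_eq_kept // -eq_co merge_component_eq_kept.
  apply: (@connect_trans _ _ s).
    rewrite (sym_connect_sym (part_adj_sym lb rho')).
    by apply: merging_connect; rewrite // /merging ri eqxx.
  by apply: merging_connect; rewrite // /merging rj eqxx.
have mj : ~~ marked (co j).
  by rewrite -merge_component_eq_kept // -eq_co merge_component_eq_kept.
rewrite -ri' -rj'; apply: connect_homo (part_adj_merge _ _ _) _ _ _ => //.
by apply: (component_connect co_map) => //; move: eq_co;
  rewrite /merge_component (negbTE mi) (negbTE mj).
Qed.

Lemma card_merging :
  #|[set i | merging i]| <= #|component rho' s|.+1.
Proof.
rewrite (cardsD1 t) -add1n; apply: leq_add; first exact: leq_b1.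
apply: subset_leq_card; apply/subsetP=> i; rewrite !inE => /andP[nt mi].
by apply: merging_connect => //; apply: merge_rep_other => //; case/andP: mi => /eqP.
Qed.

End Merge.

End Components.

(** * Sums over the partial morphisms with a given profile *)

Definition restrict (I : finType) (T : Type) (x0 : T) (D : pred I)
    (f : {ffun I -> T}) : {ffun I -> T} :=
  [ffun i => if D i then f i else x0].

Section PartialMorphisms.

Variables (A : pzSemiRingType) (V U : finType) (L : eqType).
Variables (lb : V -> V -> L) (compat : L -> U -> U -> bool) (q : V -> U -> A).
Hypothesis q_comm : forall v w a b, v != w -> GRing.comm (q v a) (q w b).

Notation pfun := {ffun V -> option U}.
Notation profile := {ffun V -> {set U}}.
Implicit Types (rho : V -> V) (f : pfun) (d : profile) (i j s t v w : V).
Implicit Types (a b : U) (S T : {set U}) (D : pred V).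

Definition weight f : A := (\prod_v oapp (q v) 1 (f v))%R.

Definition partial_morphism f := [forall v, forall w,
  oapp (fun a => oapp (compat (lb v w) a) true (f w)) true (f v)].

Definition image_profile rho f : profile :=
  [ffun i => [set a | [exists v, (rho v == i) && (f v == Some a)]]].

Definition realizes rho d f :=
  [&& partial_morphism f, [forall v, isSome (f v) == (d (rho v) != set0)]
    & image_profile rho f == d].

Definition profile_sum rho d : A := (\sum_(f | realizes rho d f) weight f)%R.

Definition fits (l : option L) S T :=
  oapp (fun x => [forall a in S, forall b in T, compat x a b]) true l.

Definition consistent rho d :=
  [forall i, forall j, fits (part_label lb rho i j) (d i) (d j)].

Lemma partial_morphismP f :
  reflect (forall v w a b, f v = Some a -> f w = Some b -> compat (lb v w) a b)
          (partial_morphism f).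
Proof.
apply: (iffP 'forall_forallP) => [pm v w a b fv fw|pm v w].
  by have := pm v w; rewrite fv fw.
by case fv: (f v) => [a|//]; case fw: (f w) => [b|//]; apply: pm.
Qed.

Lemma image_profileP rho f i a :
  reflect (exists2 v, rho v = i & f v = Some a) (a \in image_profile rho f i).
Proof.
rewrite ffunE inE; apply: (iffP existsP) => [[v /andP[/eqP rv /eqP fv]]|[v rv fv]].
  by exists v.
by exists v; rewrite rv fv !eqxx.
Qed.

Lemma realizesP rho d f :
  reflect [/\ forall v w a b, f v = Some a -> f w = Some b -> compat (lb v w) a b,
              forall v, isSome (f v) = (d (rho v) != set0)
            & image_profile rho f = d]
          (realizes rho d f).
Proof.
apply: (iffP and3P) => [[/partial_morphismP pm /forallP dom /eqP img]|[pm dom img]].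
  by split=> // v; apply/eqP.
by split; [apply/partial_morphismP | apply/forallP => v; rewrite dom | rewrite img].
Qed.

Lemma fitsP l S T :
  reflect (forall x a b, l = Some x -> a \in S -> b \in T -> compat x a b) (fits l S T).
Proof.
case: l => [x|]; last by apply: ReflectT.
apply: (iffP 'forall_in_'forall_in_idP) => /= [h y a b [<-]|h a aS b bT]; last exact: h.
by move=> aS bT; apply: h.
Qed.

Lemma fits_set0l l T : fits l set0 T.
Proof. by apply/fitsP => x a b _; rewrite inE. Qed.

Lemma fits_set0r l S : fits l S set0.
Proof. by apply/fitsP => x a b _ _; rewrite inE. Qed.

Lemma consistentP rho d :
  reflect (forall i j, fits (part_label lb rho i j) (d i) (d j)) (consistent rho d).
Proof. exact: 'forall_forallP. Qed.

Lemma consistent_restrict rho d D :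
  consistent rho d -> consistent rho (restrict set0 D d).
Proof.
move=> /consistentP cons; apply/consistentP => i j; rewrite !ffunE.
by case: (D i) (D j) => -[]; rewrite ?fits_set0l ?fits_set0r.
Qed.

Lemma profile_sum_inconsistent rho d : ~~ consistent rho d -> profile_sum rho d = 0%R.
Proof.
move=> incons; rewrite /profile_sum big_pred0 // => f; apply: contraNF incons.
move=> /realizesP[pm _ <-]; apply/consistentP => i j; apply/fitsP => x a b lab.
case/image_profileP=> v rv fv /image_profileP[w rw fw].
by rewrite -rv -rw in lab; rewrite -(lb_part_label lab); apply: pm.
Qed.

Lemma profile_sum_set0 rho d : (forall i, d i = set0) -> profile_sum rho d = 1%R.
Proof.
move=> d0; rewrite /profile_sum (big_pred1 [ffun=> None]).
  by rewrite /weight big1 // => v _; rewrite ffunE.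
move=> f; apply/realizesP/eqP => [[_ dom _]|->].
  by apply/ffunP=> v; have := dom v; rewrite d0 eqxx ffunE; case: (f v).
split=> [v w a b|v|]; rewrite ?ffunE ?d0 ?eqxx //.
apply/ffunP => i; rewrite d0; apply/setP => a; rewrite inE.
by apply/image_profileP => -[v _]; rewrite ffunE.
Qed.

Section Split.

Variables (rho : V -> V) (D : pred V).

Notation inside f := (restrict None (preim rho D) f).
Notation outside f := (restrict None (preim rho (predC D)) f).

Lemma weight_split f : weight f = (weight (inside f) * weight (outside f))%R.
Proof.
rewrite /weight -prodrM_comm => [|v w _ _].
  apply: eq_bigr => v _; rewrite !ffunE /=.
  by case: (D _); rewrite /= ?mulr1 ?mul1r.
rewrite !ffunE /=; case Dv: (D (rho v)); last exact: commr_sym (commr1 _).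
case Dw: (D (rho w)) => /=; first exact: commr1.
have vw : v != w by apply: contraFneq Dw => <-.
case: (f v) => [a|]; last exact/commr_sym/commr1.
by case: (f w) => [b|]; [apply: q_comm | apply: commr1].
Qed.

Lemma image_profile_restrict f :
  image_profile rho (inside f) = restrict set0 D (image_profile rho f).
Proof.
apply/ffunP => i; apply/setP => a; rewrite [restrict _ _ _ i]ffunE.
apply/image_profileP/idP => [[v rv]|].
  rewrite ffunE /= rv; case: ifP => // _ fv.
  by apply/image_profileP; exists v.
case: ifP => [Di /image_profileP[v rv fv]|_]; last by rewrite inE.
by exists v; rewrite // ffunE /= rv Di.
Qed.

Lemma realizes_restrict d f :
  realizes rho d f -> realizes rho (restrict set0 D d) (inside f).
Proof.
move=> /realizesP[pm dom img]; apply/realizesP; split=> [v w a b|v|].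
- by rewrite !ffunE; case: ifP => // _ fv; case: ifP => // _; apply: pm.
- by rewrite !ffunE /=; case: ifP; rewrite ?eqxx ?dom.
- by rewrite image_profile_restrict img.
Qed.

End Split.

Definition homogeneous_across (I : eqType) rho d (co : V -> I) :=
  forall i j, d i != set0 -> d j != set0 -> co i != co j ->
    part_label lb rho i j != None.

Lemma realizes_split rho d D f :
  homogeneous_across rho d D -> consistent rho d ->
  realizes rho d f =
    realizes rho (restrict set0 D d) (restrict None (preim rho D) f) &&
    realizes rho (restrict set0 (predC D) d) (restrict None (preim rho (predC D)) f).
Proof.
move=> homog /consistentP cons; apply/idP/andP => [real|[]].
  by split; apply: realizes_restrict.
move=> /realizesP[pm1 dom1 img1] /realizesP[pm2 dom2 img2].
have img : image_profile rho f = d.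
  apply/ffunP => i; have := congr1 (fun e : profile => e i) img1.
  have := congr1 (fun e : profile => e i) img2.
  by rewrite !image_profile_restrict !ffunE /=; case: (D i).
have in_d v a : f v = Some a -> a \in d (rho v).
  by move=> fv; rewrite -img; apply/image_profileP; exists v.
apply/realizesP; split=> // [v w a b fv fw|v]; last first.
  by have := dom1 v; have := dom2 v; rewrite !ffunE /=; case: (D _).
have [same|diff] := eqVneq (D (rho v)) (D (rho w)).
  have := pm1 v w a b; have := pm2 v w a b; rewrite !ffunE /= -same fv fw.
  by case: (D _) => /= h1 h2; [apply: h2 | apply: h1].
have ne0 u c : f u = Some c -> d (rho u) != set0.
  by move=> /in_d cd; apply/set0Pn; exists c.
have := homog _ _ (ne0 v a fv) (ne0 w b fw) diff.
case lab: part_label => [x|//] _; rewrite (lb_part_label lab).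
by have /fitsP := cons (rho v) (rho w); apply; rewrite ?lab ?in_d.
Qed.

Lemma profile_sum_split rho d D : homogeneous_across rho d D -> consistent rho d ->
  profile_sum rho d =
  (profile_sum rho (restrict set0 D d) * profile_sum rho (restrict set0 (predC D) d))%R.
Proof.
move=> homog cons; rewrite /profile_sum big_distrlr pair_big /=.
pose cut f := (restrict None (preim rho D) f, restrict None (preim rho (predC D)) f).
pose glue (p : pfun * pfun) := [ffun v => if D (rho v) then p.1 v else p.2 v] : pfun.
have cutK f : glue (cut f) = f.
  by apply/ffunP => v; rewrite !ffunE /=; case: (D _).
rewrite (reindex_onto cut glue) /= => [|[f1 f2] /andP[] /=].
  by apply: eq_big => f; rewrite ?cutK ?eqxx ?andbT -?realizes_split // (weight_split rho D).
move=> /realizesP[_ dom1 _] /realizesP[_ dom2 _].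
congr (_, _); apply/ffunP=> v; rewrite !ffunE /=.
  by have := dom1 v; rewrite ffunE; case: (D _) => //; rewrite eqxx; case: (f1 v).
by have := dom2 v; rewrite ffunE /=; case: (D _) => //=; rewrite eqxx; case: (f2 v).
Qed.

Definition component_part (I : eqType) (co : V -> I) c d : profile :=
  restrict set0 (fun i => co i == c) d.

Lemma profile_sum_prod (I : finType) rho d (co : V -> I) :
  homogeneous_across rho d co -> consistent rho d ->
  profile_sum rho d = (\prod_(c : I) profile_sum rho (component_part co c d))%R.
Proof.
move=> homog cons.
suff prod_seq (r : seq I) : uniq r ->
    profile_sum rho (restrict set0 [pred i | co i \in r] d) =
    (\prod_(c <- r) profile_sum rho (component_part co c d))%R.
  rewrite -prod_seq ?index_enum_uniq //; congr (profile_sum rho _).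
  by apply/ffunP => i; rewrite ffunE /= mem_index_enum.
elim: r => [_|c r IH /andP[/negbTE ncr /IH prod_r]].
  by rewrite big_nil profile_sum_set0 // => i; rewrite ffunE.
rewrite big_cons -prod_r.
rewrite (@profile_sum_split _ _ [pred i | co i == c]) ?consistent_restrict // => [|i j].
  congr (profile_sum rho _ * profile_sum rho _)%R; apply/ffunP => i; rewrite !ffunE /= inE.
    by case: eqP.
  by case: eqP => [->|]; rewrite ?ncr.
rewrite !ffunE; case: ifP => [_ di|_]; last by rewrite eqxx.
case: ifP => [_ dj|_]; last by rewrite eqxx.
by rewrite /= => ne; apply: homog => //; apply: contraNneq ne => ->.
Qed.

Definition single i T : profile := [ffun j => if j == i then T else set0].

Lemma single_supported i d :
  (forall j, (d j != set0) = (j == i)) -> d = single i (d i).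
Proof.
move=> supp; apply/ffunP => j; rewrite ffunE; case: eqP => [->//|/eqP ne].
by apply/eqP; rewrite -[_ == _]negbK supp.
Qed.

Lemma image_profile_id f i : image_profile id f i = [set a | f i == Some a].
Proof.
apply/setP => a; rewrite inE; apply/image_profileP/eqP => [[v <-]//|].
by exists i.
Qed.

Lemma profile_sum_single_set1 i a :
  consistent id (single i [set a]) -> profile_sum id (single i [set a]) = q i a.
Proof.
move=> /consistentP/(_ i i)/fitsP; rewrite part_label_id !ffunE eqxx => loop.
have supp v : (single i [set a] v != set0) = (v == i).
  by rewrite ffunE; have [_|_] := eqVneq v i; rewrite ?eqxx // -card_gt0 cards1.
rewrite /profile_sum (big_pred1 [ffun v => if v == i then Some a else None]) => [|f].
  transitivity (\prod_(v | v == i) q v a)%R; last by rewrite big_pred1_eq.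
  by rewrite [RHS]big_mkcond; apply: eq_bigr => v _; rewrite ffunE; case: eqP.
apply/realizesP/eqP => [[_ dom img]|->].
  apply/ffunP => v; have := dom v; rewrite supp ffunE; case: eqP => [->|_]; last by case: (f v).
  case fi: (f i) => [b|//] _; have := congr1 (fun d : profile => b \in d i) img.
  by rewrite image_profile_id ffunE eqxx !inE fi eqxx => /esym/eqP ->.
split=> [v w b c|v|].
- rewrite !ffunE; case: eqP => // -> [<-]; case: eqP => // -> [<-].
  by apply: loop; rewrite ?inE.
- by rewrite supp ffunE; case: eqP.
apply/ffunP => j; rewrite image_profile_id !ffunE; apply/setP => b.
by rewrite inE; case: (j == i); rewrite !inE // eq_sym.
Qed.

Lemma profile_sum_single_neq_set1 i T :
  T != set0 -> (forall a, T != [set a]) -> profile_sum id (single i T) = 0%R.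
Proof.
move=> T0 Tne; rewrite /profile_sum big_pred0 // => f; apply/negP => /realizesP[_ dom img].
have := dom i; rewrite ffunE eqxx T0; case fi: (f i) => [a|//] _.
case/eqP: (Tne a); have := congr1 (fun d : profile => d i) img.
rewrite image_profile_id ffunE eqxx => <-.
by apply/setP => b; rewrite !inE fi eq_sym.
Qed.

Lemma profile_sum_single_total rho i : (forall v, rho v = i) ->
  (\sum_(T | T != set0) profile_sum rho (single i T) =
   \sum_(f | partial_morphism f && [forall v, isSome (f v)]) weight f)%R.
Proof.
move=> rhoi; have img_other f j : j != i -> image_profile rho f j = set0.
  move=> ji; apply/setP => a; rewrite inE; apply/image_profileP => -[v].
  by rewrite rhoi => ij; rewrite ij eqxx in ji.
rewrite [RHS](partition_big (fun f => image_profile rho f i) (fun T => T != set0)).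
  apply: eq_bigr => T T0; apply: eq_bigl => f.
  apply/realizesP/andP => [[pm dom img]|[/andP[/partial_morphismP pm /forallP dom] /eqP img]].
    split; last by rewrite img ffunE eqxx.
    apply/andP; split; first exact/partial_morphismP.
    by apply/forallP => v; rewrite dom rhoi ffunE eqxx.
  split=> // [v|]; first by rewrite dom rhoi ffunE eqxx.
  by apply/ffunP => j; rewrite [RHS]ffunE; case: eqP => [->//|/eqP/img_other].
move=> f /andP[_ /forallP/(_ i)]; case fi: (f i) => [a|//] _.
by apply/set0Pn; exists a; apply/image_profileP; exists i.
Qed.

Section Merge.

Variables (rho : V -> V) (s t : V).
Hypotheses (rs : rho s = s) (rt : rho t = t) (st_neq : s != t).

Notation rho' := (merge_rep rho s t).

Definition merge_profile d : profile :=
  [ffun i => if i == s then d s :|: d t else if i == t then set0 else d i].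

Lemma image_profile_merge f :
  image_profile rho' f = merge_profile (image_profile rho f).
Proof.
apply/ffunP => i; apply/setP => a; rewrite [merge_profile _ i]ffunE.
apply/image_profileP/idP => [[v rv fv]|].
  have : a \in image_profile rho f (rho v) by apply/image_profileP; exists v.
  move: rv; rewrite /merge_rep; case: eqP => [-> <- av|nt <- av].
    by rewrite eqxx inE av orbT.
  by case: eqP av => [->|_]; [rewrite inE => -> | case: eqP].
have [->|nis] := eqVneq i s.
  case/setUP => /image_profileP[v rv fv]; exists v; rewrite // /merge_rep rv ?eqxx //.
  by rewrite (negbTE st_neq).
have [_|nit] := eqVneq i t; first by rewrite inE.
by case/image_profileP => v rv fv; exists v; rewrite // /merge_rep rv (negbTE nit).
Qed.

Lemma profile_sum_merge d' : d' s != set0 ->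
  profile_sum rho' d' =
  (\sum_(d | [&& merge_profile d == d', d s != set0 & d t != set0]) profile_sum rho d)%R.
Proof.
move=> d's; pose splits d := [&& merge_profile d == d', d s != set0 & d t != set0].
have nonempty f v : isSome (f v) -> image_profile rho f (rho v) != set0.
  by case fv: (f v) => [a|//] _; apply/set0Pn; exists a; apply/image_profileP; exists v.
rewrite /profile_sum (partition_big (image_profile rho) splits) => [|f].
  apply: eq_bigr => d /and3P[/eqP merge_d ds dt]; apply: eq_bigl => f.
  have same_dom v : (d' (rho' v) != set0) = (d (rho v) != set0).
    rewrite /merge_rep; case: (rho v =P t) => [->|/eqP nt]; first by rewrite d's dt.
    rewrite -merge_d ffunE (negbTE nt); have [->|//] := eqVneq (rho v) s.
    by rewrite setU_eq0 negb_and ds.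
  apply/andP/realizesP => [[/realizesP[pm dom _] /eqP img]|[pm dom img]].
    by split=> // v; rewrite dom same_dom.
  split; last exact/eqP; apply/realizesP; split=> // [v|].
    by rewrite dom same_dom.
  by rewrite image_profile_merge img.
case/realizesP=> _ dom img; apply/and3P; split.
- by rewrite -image_profile_merge img.
- by rewrite -rs nonempty // dom merge_rep_kept.
- by rewrite -rt nonempty // dom merge_rep_dropped.
Qed.

Lemma profile_sum_unmerged d' :
  d' s = set0 -> d' t = set0 -> profile_sum rho' d' = profile_sum rho d'.
Proof.
move=> d's d't; have same_dom v : d' (rho' v) = d' (rho v).
  by rewrite /merge_rep; case: eqP => [->|//]; rewrite d's d't.
have merge_d' : merge_profile d' = d'.
  apply/ffunP => i; rewrite ffunE d's d't setU0.
  by case: eqP => [->|_] //; case: eqP => [->|].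
apply: eq_bigl => f; apply/realizesP/realizesP => -[pm dom img].
  split=> // [v|]; first by rewrite dom same_dom.
  apply/ffunP => i; have img_s : image_profile rho f s = set0 /\ image_profile rho f t = set0.
    have := congr1 (fun d : profile => d s) img.
    rewrite image_profile_merge ffunE eqxx d's => /eqP; rewrite setU_eq0.
    by case/andP=> /eqP-> /eqP->.
  have := congr1 (fun d : profile => d i) img; rewrite image_profile_merge ffunE.
  by have [->|_] := eqVneq i s; [|have [->|_] := eqVneq i t];
    rewrite ?img_s.1 ?img_s.2 ?d's ?d't.
by split=> // [v|]; [rewrite dom same_dom | rewrite image_profile_merge img].
Qed.

End Merge.

(** * The profiles of a merged component *)

Definition supported (P : pred V) d := [forall i, (d i != set0) == P i].

Lemma supportedP (P : pred V) d :
  reflect (forall i, (d i != set0) = P i) (supported P d).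
Proof. exact: 'forall_eqP. Qed.

Section MergeComponent.

Variables (rho co : V -> V) (s t : V).
Hypothesis rho_idem : forall v, rho (rho v) = rho v.
Hypotheses (rs : rho s = s) (rt : rho t = t) (st_neq : s != t).
Hypothesis co_map : component_map lb rho co.

Notation rho' := (merge_rep rho s t).
Notation merging := (merging lb rho co s t).
Notation marked := (marked lb rho co s t).
Notation merge_component := (merge_component lb rho co s t).
Notation pl := (part_label lb rho).

(* Only the pairs that involve a merged part are tested: the label of any other
   pair survives the merge, so a violation will be detected later. *)
Definition admissible d := [forall i,
  [&& fits (pl s i) (d s) (d i), fits (pl t i) (d t) (d i),
      fits (pl i s) (d i) (d s) & fits (pl i t) (d i) (d t)]].

Lemma consistent_admissible d : consistent rho d -> admissible d.
Proof. by move=> /consistentP cons; apply/forallP => i; rewrite !cons. Qed.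

Lemma admissible_consistent d : supported merging d -> admissible d ->
  consistent rho' (merge_profile s t d) -> consistent rho d.
Proof.
move=> /supportedP supp /forallP adm /consistentP cons; apply/consistentP => i j.
have /and4P[s_i t_i i_s i_t] := adm i; have /and4P[s_j t_j j_s j_t] := adm j.
have [->//|nis] := eqVneq i s; have [->//|njs] := eqVneq j s.
have [->//|nit] := eqVneq i t; have [->//|njt] := eqVneq j t.
have live k : k != t -> d k != set0 -> rho' k = k.
  by move=> nkt; rewrite supp => /andP[/eqP rk _]; apply: merge_rep_other.
have [->|/(live i nit) ri] := eqVneq (d i) set0; first exact: fits_set0l.
have [->|/(live j njt) rj] := eqVneq (d j) set0; first exact: fits_set0r.
have := cons i j; rewrite !ffunE (negbTE nis) (negbTE njs) (negbTE nit) (negbTE njt).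
by rewrite part_label_merge_other.
Qed.

Lemma profile_sum_merging d : supported merging d -> consistent rho d ->
  profile_sum rho d = (\prod_(c | marked c) profile_sum rho (component_part co c d))%R.
Proof.
move=> /supportedP supp cons; rewrite (profile_sum_prod (co := co)) // => [|i j].
  rewrite [RHS]big_mkcond; apply: eq_bigr => c _; case: ifPn => // nm.
  apply: profile_sum_set0 => i; rewrite ffunE; case: eqP => // ci.
  by apply/eqP; apply: contraNT nm; rewrite supp /merging ci => /andP[].
rewrite !supp => /andP[/eqP ri _] /andP[/eqP rj _]; apply: contraNneq.
by move/(component_adj co_map ri rj) ->.
Qed.

Lemma component_part_supported c d : supported merging d -> marked c ->
  supported (in_component rho co c) (component_part co c d).
Proof.
move=> /supportedP supp mc; apply/supportedP => i; rewrite ffunE /in_component.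
have [ci|_] := eqVneq (co i) c; last by rewrite eqxx andbF.
by rewrite supp /merging ci mc.
Qed.

Lemma profile_sum_merged_component d' :
  supported (in_component rho' merge_component s) d' ->
  profile_sum rho' d' = (\sum_(d | supported merging d)
                    if merge_profile s t d == d' then profile_sum rho d else 0)%R.
Proof.
rewrite /in_component => /supportedP supp; have d's : d' s != set0.
  by rewrite supp merge_rep_kept // merge_component_kept // !eqxx.
rewrite profile_sum_merge // -big_mkcondr; apply: eq_bigl => d; rewrite [RHS]andbC.
case: eqP => //= merge_d; apply/andP/supportedP => [[ds dt] i|supp_d]; last first.
  by rewrite !supp_d merging_kept ?merging_dropped.
have [->|nis] := eqVneq i s; first by rewrite ds merging_kept.
have [->|nit] := eqVneq i t; first by rewrite dt merging_dropped.
have -> : d i = d' i by rewrite -merge_d ffunE (negbTE nis) (negbTE nit).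
rewrite supp merge_rep_fix // nit andbT /merging.
by case: eqP => // ri; rewrite merge_component_eq_kept.
Qed.

Lemma unmerged_component d' c : c != s -> merge_component c = c ->
  supported (in_component rho' merge_component c) d' ->
  consistent rho' d' ->
  [/\ consistent rho d', supported (in_component rho co c) d'
    & profile_sum rho' d' = profile_sum rho d'].
Proof.
rewrite /in_component => ncs cc /supportedP supp /consistentP cons.
have d's : d' s = set0.
  apply/eqP; rewrite -[_ == _]negbK supp merge_component_kept //.
  by rewrite [s == c]eq_sym (negbTE ncs) andbF.
have d't : d' t = set0.
  by apply/eqP; rewrite -[_ == _]negbK supp merge_rep_fix // eqxx !andbF.
split; last exact: profile_sum_unmerged.
  apply/consistentP => i j.
  have live k : d' k != set0 -> rho' k = k /\ k != s.
    by move=> dk; split; [by move: dk; rewrite supp => /andP[/eqP] |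
      by apply: contraNneq dk => ->; rewrite d's].
  have [->|/live[ri nis]] := eqVneq (d' i) set0; first exact: fits_set0l.
  have [->|/live[rj njs]] := eqVneq (d' j) set0; first exact: fits_set0r.
  by rewrite -(part_label_merge_other lb rho_idem rs rt st_neq).
apply/supportedP => i; rewrite supp merge_rep_fix // /merge_component.
case: (rho i =P i) => //= ri; case: ifPn => [mi|nm]; last first.
  by rewrite (_ : i != t) //; apply: contraNneq nm => ->; rewrite marked_dropped.
rewrite [s == c]eq_sym (negbTE ncs) andbF; apply/esym/eqP => ci.
move: cc; rewrite /merge_component -ci (component_idem co_map) // mi => sc.
by rewrite -ci -sc eqxx in ncs.
Qed.

End MergeComponent.

End PartialMorphisms.

(** * Enumeration and numbering of profiles *)

Lemma card_set_type (T : finType) : #|{set T}| = 2 ^ #|T|.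
Proof. by rewrite -[LHS]cardsT -powersetT card_powerset cardsT. Qed.

Section PointedNumbering.

Variables (T : finType) (x0 : T).
Implicit Types x : T.

Definition pointed_enum := x0 :: rem x0 (enum T).
Definition pointed_rank x : nat := index x pointed_enum.
Definition pointed_nth (k : nat) : T := nth x0 pointed_enum k.

Lemma pointed_enum_uniq : uniq pointed_enum.
Proof. by rewrite /= mem_rem_uniq ?rem_uniq ?enum_uniq // !inE eqxx. Qed.

Lemma mem_pointed_enum x : x \in pointed_enum.
Proof. by rewrite inE mem_rem_uniq ?enum_uniq // !inE mem_enum andbT; case: eqP. Qed.

Lemma size_pointed_enum : size pointed_enum = #|T|.
Proof. by rewrite /= size_rem ?mem_enum // -cardE prednK //; apply/card_gt0P; exists x0. Qed.

Lemma pointed_rank_lt x : pointed_rank x < #|T|.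
Proof. by rewrite -size_pointed_enum index_mem mem_pointed_enum. Qed.

Lemma pointed_rankK : cancel pointed_rank pointed_nth.
Proof. by move=> x; apply: nth_index; apply: mem_pointed_enum. Qed.

Lemma pointed_nthK k : k < #|T| -> pointed_rank (pointed_nth k) = k.
Proof. by move=> kT; rewrite /pointed_rank index_uniq ?pointed_enum_uniq ?size_pointed_enum. Qed.

Lemma pointed_rank0 : pointed_rank x0 = 0.
Proof. by rewrite /pointed_rank /= eqxx. Qed.

Lemma pointed_rank_eq0 x : (pointed_rank x == 0) = (x == x0).
Proof. by rewrite -pointed_rank0 (inj_eq (can_inj pointed_rankK)). Qed.

End PointedNumbering.

Lemma dvdnS_mod d m : 0 < d -> (d %| m.+1) = ((m %% d).+1 == d).
Proof.
move=> d_gt0; rewrite {1}(divn_eq m d) -addnS dvdn_addr ?dvdn_mull //.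
apply/idP/eqP => [/dvdn_leq le_d|->]; last exact: dvdnn.
by apply/eqP; rewrite eqn_leq ltn_pmod // le_d.
Qed.

Section Odometer.

Variables (M : nat) (on : pred nat).
Hypothesis M_gt0 : 0 < M.

Definition wheels i := count on (iota 0 i).

(* The state after [r] ticks of an odometer that has a wheel, showing digits
   from [1] to [M], at each position in [on]; lower positions turn faster. *)
Definition digit r i := if on i then (r %/ M ^ wheels i %% M).+1 else 0.

Lemma wheelsS i : wheels i.+1 = wheels i + on i.
Proof. by rewrite /wheels -{1}[i.+1]addn1 iotaD count_cat /= addn0. Qed.

Lemma digit0 i : digit 0 i = on i.
Proof. by rewrite /digit div0n mod0n; case: ifP. Qed.

Lemma digit_eq0 r i : (digit r i == 0) = ~~ on i.
Proof. by rewrite /digit; case: ifP. Qed.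

Lemma digit_le r i : digit r i <= M.
Proof. by rewrite /digit; case: ifP => // _; rewrite ltn_mod. Qed.

Lemma expM_gt0 i : 0 < M ^ i.
Proof. by rewrite expn_gt0 M_gt0. Qed.

Lemma digitS r i : digit r.+1 i =
  if (M ^ wheels i %| r.+1) && on i then if digit r i < M then (digit r i).+1 else 1
  else digit r i.
Proof.
rewrite /digit; case: ifP => [_|]; last by rewrite andbF.
rewrite andbT divnS ?expM_gt0 //; case: (_ %| _) => //.
rewrite add1n modnS dvdnS_mod //; have := ltn_pmod (r %/ M ^ wheels i) M_gt0.
by case: (ltngtP _.+1 M).
Qed.

Lemma carryS r i : (M ^ wheels i.+1 %| r.+1) =
  (M ^ wheels i %| r.+1) && (on i ==> (digit r i == M)).
Proof.
rewrite wheelsS /digit; case: ifP => _ /=; last by rewrite addn0 andbT.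
rewrite addn1 expnS -dvdnS_mod //; case: (boolP (M ^ wheels i %| r.+1)) => [dvd|].
  by rewrite -dvdn_divRL // divnS ?expM_gt0 // dvd add1n.
by apply: contraNF => /(dvdn_trans (dvdn_mull _ (dvdnn _))).
Qed.

Lemma digit_inj n r r' : r < M ^ wheels n -> r' < M ^ wheels n ->
  (forall i, i < n -> digit r i = digit r' i) -> r = r'.
Proof.
move=> rn rn' same; rewrite -(modn_small rn) -(modn_small rn').
elim: n {rn rn'} same => [|n IH] same; first by rewrite !modn1.
have mod_eq := IH (fun i lt_i => same i (ltnW lt_i)).
rewrite wheelsS addnC; have := same n (ltnSn n); rewrite /digit.
case: (on n) => [[div_eq]|_]; last exact: mod_eq.
have mod_split x c : x %% (M * c) = x %/ c %% M * c + x %% c.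
  by rewrite {1}(divn_eq (x %% (M * c)) c) -modn_divl modn_dvdm ?dvdn_mull.
by rewrite expnD expn1 !mod_split div_eq mod_eq.
Qed.

Variables (T : finType) (x0 : T).
Hypothesis cardT : #|T| = M.+1.

Definition dials n r : {ffun 'I_n -> T} := [ffun i : 'I_n => pointed_nth x0 (digit r i)].

Lemma rank_dials n r i : pointed_rank x0 (dials n r i) = digit r i.
Proof. by rewrite ffunE pointed_nthK // cardT ltnS digit_le. Qed.

Lemma dials_neq0 n r i : (dials n r i != x0) = on i.
Proof. by rewrite -pointed_rank_eq0 rank_dials digit_eq0 negbK. Qed.

Lemma dials_inj n : injective (fun r : 'I_(M ^ wheels n) => dials n r).
Proof.
move=> r r' eq_d; apply/val_inj/(@digit_inj n); rewrite ?ltn_ord // => i lt_i.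
by rewrite -(rank_dials r (Ordinal lt_i)) eq_d rank_dials.
Qed.

Lemma dials_image n :
  [set dials n r | r : 'I_(M ^ wheels n)] =
  [set d : {ffun 'I_n -> T} | [forall i, (d i != x0) == on i]].
Proof.
apply/eqP; rewrite eqEcard; apply/andP; split.
  apply/subsetP => _ /imsetP[r _ ->]; rewrite inE; apply/forallP => i.
  by rewrite dials_neq0.
rewrite (card_imset _ (@dials_inj n)).
pose choices (i : 'I_n) := [pred x : T | (x != x0) == on i].
rewrite (_ : #|[set d : {ffun _ -> _} | _]| = #|(family choices : pred _)|); last first.
  by apply: eq_card => d; rewrite inE.
rewrite card_family card_ord foldrE big_map -[enum _]/(enum 'I_n) big_enum /=.
have -> : M ^ wheels n = \prod_(i < n) M ^ on i.
  elim: (n) => [|k IH]; first by rewrite big_ord0.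
  by rewrite big_ord_recr /= -IH -expnD wheelsS.
apply: leq_prod => i _; case: (on i).
  by rewrite (eq_card (B := predC1 x0)) ?cardC1 ?cardT // => x; apply: eqb_id.
rewrite (eq_card (B := pred1 x0)) ?card1 // => x.
by rewrite -topredE /= eqbF_neg negbK.
Qed.

Lemma big_dials (A : nmodType) n (F : {ffun 'I_n -> T} -> A) :
  (\sum_(r < M ^ wheels n) F (dials n r) =
   \sum_(d : {ffun 'I_n -> T} | [forall i, (d i != x0) == on i]) F d)%R.
Proof.
transitivity (\sum_(d in [set dials n r | r : 'I_(M ^ wheels n)]) F d)%R; last first.
  by rewrite dials_image; apply: eq_bigl => d; rewrite inE.
by rewrite big_imset //=; apply: in2W; apply: dials_inj.
Qed.

End Odometer.

Section Numerals.

Variable N : nat.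

Definition numeral n (d : 'I_n -> nat) := \sum_(i < n) d i * N ^ i.

Lemma numeral_recl n (d : 'I_n.+1 -> nat) :
  numeral d = d ord0 + N * numeral (fun i => d (lift ord0 i)).
Proof.
rewrite /numeral big_ord_recl expn0 muln1 big_distrr; congr (_ + _).
by apply: eq_bigr => i _; rewrite expnS mulnCA.
Qed.

Lemma numeral_lt n (d : 'I_n -> nat) : (forall i, d i < N) -> numeral d < N ^ n.
Proof.
elim: n d => [|n IH] d dN; first by rewrite /numeral big_ord0.
rewrite numeral_recl expnS; have := IH (fun i => d (lift ord0 i)) (fun i => dN _).
move=> /(leq_mul (leqnn N)); apply: leq_trans.
by rewrite mulnS -addSn leq_add2r.
Qed.

Lemma numeral_inj n (d d' : 'I_n -> nat) :
  (forall i, d i < N) -> (forall i, d' i < N) -> numeral d = numeral d' -> d =1 d'.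
Proof.
elim: n d d' => [|n IH] d d' dN dN' eq_num i; first by case: i.
have N_gt0 : 0 < N by apply: leq_ltn_trans (dN ord0).
move: eq_num; rewrite !numeral_recl ![_ + N * _]addnC ![N * _]mulnC => eq_num.
have := congr1 (modn^~ N) eq_num; rewrite !modnMDl !modn_small // => eq0.
have := congr1 (divn^~ N) eq_num.
rewrite !divnMDl // !divn_small // !addn0 => /IH eq_lift.
by case: (unliftP ord0 i) => [j|] ->; [apply: eq_lift | apply: eq0].
Qed.

End Numerals.

Lemma matrix_index_inj n (i j k l : 'I_n) :
  (i * n + j == k * n + l) = (i == k) && (j == l).
Proof.
apply/eqP/andP => [eq_index|[/eqP -> /eqP ->] //].
have n_gt0 : 0 < n by apply: leq_ltn_trans (ltn_ord i).
have := congr1 (divn^~ n) eq_index; have := congr1 (modn^~ n) eq_index.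
rewrite !modnMDl !divnMDl // !modn_small // !divn_small // !addn0.
by move=> /val_inj -> /val_inj ->.
Qed.

Section Offsets.

Variables (U : finType) (n : nat).

Notation profile := {ffun 'I_n -> {set U}}.
Implicit Types (d : profile) (i s t : 'I_n).

Notation set_rank := (pointed_rank (set0 : {set U})).
Notation N := #|{set U}|.

Definition offset d := numeral N (fun i => set_rank (d i)).

Lemma offset_lt d : offset d < N ^ n.
Proof. by apply: numeral_lt => i; apply: pointed_rank_lt. Qed.

Lemma offset_inj : injective offset.
Proof.
move=> d d' eq_off; apply/ffunP => i; apply: (can_inj (pointed_rankK set0)).
by apply: (numeral_inj _ _ eq_off) => j; apply: pointed_rank_lt.
Qed.

Lemma offset_single i (T : {set U}) : offset (single i T) = set_rank T * N ^ i.
Proof.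
rewrite /offset /numeral (bigD1 i) //= ffunE eqxx big1 ?addn0 // => j /negbTE ne.
by rewrite ffunE ne pointed_rank0.
Qed.

Lemma offset_support d : offset d = \sum_(i < n | d i != set0) set_rank (d i) * N ^ i.
Proof.
rewrite /offset /numeral [RHS]big_mkcond; apply: eq_bigr => i _.
by case: eqP => // ->; rewrite pointed_rank0.
Qed.

Lemma offset_component_part (I : eqType) (co : 'I_n -> I) c d :
  offset (component_part co c d) =
  \sum_(i < n | (d i != set0) && (co i == c)) set_rank (d i) * N ^ i.
Proof.
rewrite offset_support big_mkcond [RHS]big_mkcond; apply: eq_bigr => i _.
by rewrite ffunE; case: (co i == c); rewrite ?eqxx ?andbT ?andbF.
Qed.

Lemma leq_offset s t d : s != t ->
  set_rank (d s) * N ^ s + set_rank (d t) * N ^ t <= offset d.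
Proof.
move=> st_neq; rewrite /offset /numeral (bigD1 s) //= leq_add2l (bigD1 t) 1?eq_sym //=.
exact: leq_addr.
Qed.

Lemma offset_merge s t d : s != t ->
  offset (merge_profile s t d) =
  offset d - set_rank (d s) * N ^ s - set_rank (d t) * N ^ t
    + set_rank (d s :|: d t) * N ^ s.
Proof.
move=> st_neq; rewrite /offset /numeral [in RHS](bigD1 s) //= addKn.
rewrite [in RHS](bigD1 t) 1?eq_sym //= addKn.
rewrite (bigD1 s) //= [X in _ + X](bigD1 t) 1?eq_sym //=.
rewrite !ffunE eqxx [t == s]eq_sym (negbTE st_neq) eqxx pointed_rank0 mul0n add0n addnC.
congr (_ + _); apply: eq_bigr => i /andP[/negbTE nis /negbTE nit].
by rewrite ffunE nis nit.
Qed.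

End Offsets.

(** * The program *)

Section Program.

Variables (L U : finType) (compat : L -> U -> U -> bool).

Notation N := #|{set U}|.
Notation set_rank := (pointed_rank (set0 : {set U})).
Notation set_of := (pointed_nth (set0 : {set U})).

Definition label_code (l : option L) : nat :=
  if l is Some x then (enum_rank x).+1 else 0.
Definition label_decode (k : nat) : option L := [pick x | (enum_rank x).+1 == k].

Definition clash_code (k : nat) : nat :=
  ~~ fits compat (label_decode (k %/ N %/ N)) (set_of (k %/ N %% N)) (set_of (k %% N)).
Definition union_code (k : nat) : nat :=
  set_rank (set_of (k %/ N) :|: set_of (k %% N)).

Definition zero : nexp := NConst 0.
Definition one : nexp := NConst 1.
Definition idx : nexp := var RIndex.
Definition kept : nexp := var RKept.
Definition dropped : nexp := var RDropped.
Definition label_index (i j : nexp) : nexp := NAdd (read RRow i) j.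
Definition label (i j : nexp) : nexp := read RLabel (label_index i j).
(* Numbers cannot be multiplied, hence the table of the products [x * N ^ i]. *)
Definition place (i x : nexp) : nexp := read RPlace (NAdd (nscale N i) x).
Definition clash (l x y : nexp) : nexp :=
  read RClash (NAdd (nscale N (NAdd (nscale N l) x)) y).
Definition union (x y : nexp) : nexp := read RUnion (NAdd (nscale N x) y).
Definition for_all (body : cmd) : cmd := For (var RSize) body.

Definition init_constants : cmd :=
  store_table RClash (#|L|.+1 * N * N) clash_code ;;
  store_table RUnion (N * N) union_code ;;
  store_table RPlace N id.
Definition init_places : cmd :=
  For (nscale N (var RSize))
    (write RPlace (NAdd (NConst N) idx) (nscale N (read RPlace idx))).
Definition init_rows : cmd :=
  for_all (write RRow (NAdd idx one) (NAdd (read RRow idx) (var RSize))).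
Definition init_labels : cmd :=
  For (read RRow (var RSize))
    (write RLabel idx (NAdd (NInput (NAdd one idx)) one)).
Definition query_image (a : U) : cmd :=
  Query (NAdd (var RBlock) (place idx (NConst (set_rank [set a]))))
    (NConst (register_code RIndex)) one (NConst (enum_rank a)).
Definition query_images : cmd := seqs [seq query_image a | a <- enum U].
Definition init_singletons : cmd :=
  for_all (write RLive idx one) ;; for_all (write RComp idx idx) ;;
  for_all (write RTable idx (var RBlock)) ;; for_all query_images.
Definition init_tables : cmd :=
  assign RSize (NInput zero) ;; init_constants ;; init_places ;; init_rows ;;
  assign RBlock (place (var RSize) one).
Definition init_graph : cmd :=
  init_labels ;; init_singletons ;;
  assign RTape (NAdd one (NAdd (read RRow (var RSize)) (var RSize))) ;;
  assign RFree (NAdd (var RBlock) (var RBlock)).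
Definition init : cmd := init_tables ;; init_graph.

Definition select_merge : cmd :=
  for_all (If (NSub (read RLive idx)
                    (is_zero (ndist (NInput (NAdd (var RTape) idx)) idx)))
              (assign RDropped idx) Skip) ;;
  assign RKept (NInput (NAdd (var RTape) dropped)).
Definition mismatch (x y : nexp) : nexp := NAdd (ndist x y) (is_zero x).
Definition touches_merge : nexp :=
  NAdd (NAdd (is_zero (ndist idx kept)) (is_zero (ndist idx dropped)))
       (NAdd (mismatch (label kept idx) (label dropped idx))
             (mismatch (label idx kept) (label idx dropped))).
Definition mark_components : cmd :=
  for_all (write RMark idx zero) ;;
  for_all (If (NSub (read RLive idx) (is_zero touches_merge))
              (write RMark (read RComp idx) one) Skip).
Definition start_profiles : cmd :=
  for_all (write RDigit idx
             (NSub (NAdd (read RLive idx) (read RMark (read RComp idx))) one)).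

Definition check_profile : cmd :=
  assign RBad zero ;;
  for_all (If (read RDigit idx)
    (assign RBad (NAdd (var RBad)
      (NAdd (NAdd (clash (label kept idx) (read RDigit kept) (read RDigit idx))
                  (clash (label dropped idx) (read RDigit dropped) (read RDigit idx)))
            (NAdd (clash (label idx kept) (read RDigit idx) (read RDigit kept))
                  (clash (label idx dropped) (read RDigit idx) (read RDigit dropped))))))
    Skip).
Definition locate_components : cmd :=
  for_all (write RAcc idx (read RTable idx)) ;;
  for_all (If (read RDigit idx)
    (write RAcc (read RComp idx)
       (NAdd (read RAcc (read RComp idx)) (place idx (read RDigit idx)))) Skip).
Definition multiply_components : cmd :=
  AStore one AOne ;;
  for_all (If (read RMark idx)
    (AStore one (AMul (ACell one) (ACell (read RAcc idx)))) Skip).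
Definition multiply_tables : cmd := locate_components ;; multiply_components.
Definition locate_target : cmd :=
  assign RTarget (var RFree) ;;
  for_all (If (read RDigit idx)
    (assign RTarget (NAdd (var RTarget) (place idx (read RDigit idx)))) Skip) ;;
  assign RTarget
    (NAdd (NSub (NSub (var RTarget) (place kept (read RDigit kept)))
                (place dropped (read RDigit dropped)))
          (place kept (union (read RDigit kept) (read RDigit dropped)))).
Definition add_product : cmd :=
  If (var RBad) Skip
     (AStore (var RTarget) (AAdd (ACell (var RTarget)) (ACell one))).
Definition record_product : cmd := locate_target ;; add_product.
Definition turn_wheel : cmd :=
  If (var RCarry) (If (read RDigit idx)
    (If (NSub (NConst N.-1) (read RDigit idx))
       (write RDigit idx (NAdd (read RDigit idx) one) ;; assign RCarry zero)
       (write RDigit idx one)) Skip) Skip.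
Definition next_profile : cmd :=
  assign RCarry one ;; for_all turn_wheel ;;
  assign RRunning (is_zero (var RCarry)).
Definition process_profile : cmd :=
  check_profile ;; multiply_tables ;; record_product ;; next_profile.
Definition process_profiles : cmd :=
  assign RRunning one ;; While (var RRunning) process_profile.

Definition merge_labels (i j : nexp) : cmd :=
  for_all (If (mismatch (read RLabel i) (read RLabel j)) (write RLabel i zero) Skip).
Definition merge_components : cmd :=
  for_all (If (read RMark (read RComp idx)) (write RComp idx kept) Skip).
Definition advance : cmd :=
  write RLive dropped zero ;; write RTable kept (var RFree) ;;
  assign RFree (NAdd (var RFree) (var RBlock)) ;;
  assign RTape (NAdd (var RTape) (var RSize)) ;;
  assign RStage (NAdd (var RStage) one).
Definition contract : cmd :=
  merge_labels (label_index kept idx) (label_index dropped idx) ;;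
  merge_labels (label_index idx kept) (label_index idx dropped) ;;
  merge_components ;; advance.

Definition stage : cmd :=
  select_merge ;; mark_components ;; start_profiles ;; process_profiles ;; contract.

Definition sum_tables : cmd :=
  seqs [seq If (clash (label zero zero) (NConst (set_rank T)) (NConst (set_rank T)))
              Skip
              (AStore zero (AAdd (ACell zero)
                 (ACell (NAdd (read RTable (read RComp zero)) (NConst (set_rank T))))))
       | T <- enum [pred T : {set U} | T != set0]].

Definition sum_morphisms : cmd :=
  init ;; While (NSub (NSub (var RSize) one) (var RStage)) stage ;; sum_tables.

Lemma label_codeK : cancel label_code label_decode.
Proof.
move=> [x|]; rewrite /label_decode; case: pickP => [y /= /eqP|] //=.
  by case=> /val_inj/enum_rank_inj ->.
by move/(_ x); rewrite eqxx.
Qed.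

Lemma label_code_le l : label_code l <= #|L|.
Proof. by case: l => //= x; apply: ltn_ord. Qed.

Lemma label_code_eq0 l : (label_code l == 0) = (l == None).
Proof. by case: l. Qed.

Lemma divn_index x y : y < N -> (N * x + y) %/ N = x.
Proof. by move=> yN; rewrite mulnC divnMDl ?divn_small ?addn0 //; case: N yN. Qed.

Lemma modn_index x y : y < N -> (N * x + y) %% N = y.
Proof. by move=> yN; rewrite mulnC modnMDl modn_small. Qed.

Lemma index_lt x y m : x < m -> y < N -> N * x + y < m * N.
Proof.
move=> xm yN; apply: (@leq_trans (x.+1 * N)); last by rewrite leq_mul2r xm orbT.
by rewrite mulSnr mulnC ltn_add2l.
Qed.

Lemma clash_codeE l (S T : {set U}) :
  clash_code (N * (N * label_code l + set_rank S) + set_rank T) = ~~ fits compat l S T.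
Proof.
by rewrite /clash_code !divn_index ?modn_index ?pointed_rank_lt // label_codeK !pointed_rankK.
Qed.

Lemma union_codeE (S T : {set U}) :
  union_code (N * set_rank S + set_rank T) = set_rank (S :|: T).
Proof. by rewrite /union_code divn_index ?modn_index ?pointed_rank_lt // !pointed_rankK. Qed.

(** * Loops over the vertices *)

Section VertexLoops.

Variables (A : pzSemiRingType) (inp : nat -> nat).
Variables (query : seq nat -> nat -> option (A * nat)) (C n : nat).

Notation wp := (@wp A inp query C).
Notation ev := (@ev A inp).
Implicit Types (st : state A) (i j : 'I_n) (a : register).

Lemma exists_ltS (P : pred 'I_n) i :
  [exists j : 'I_n, (j < i.+1) && P j] = P i || [exists j : 'I_n, (j < i) && P j].
Proof.
apply/existsP/orP => [[j /andP[]]|[Pi|/existsP[j /andP[lt_j Pj]]]].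
- rewrite ltnS leq_eqVlt => /orP[/eqP/val_inj -> //|lt_j Pj]; first by left.
  by right; apply/existsP; exists j; rewrite lt_j.
- by exists i; rewrite ltnSn.
- by exists j; rewrite ltnW.
Qed.

Lemma sum_ltS (P : pred 'I_n) (F : 'I_n -> nat) i :
  \sum_(j < n | (j < i.+1) && P j) F j =
  \sum_(j < n | (j < i) && P j) F j + (if P i then F i else 0).
Proof.
rewrite big_mkcond [in RHS]big_mkcond (bigD1 i) //= ltnSn [in RHS](bigD1 i) //= ltnn.
rewrite add0n addnC; congr (_ + _); apply: eq_bigr => j /negbTE ne.
by rewrite ltnS leq_eqVlt val_eqE ne.
Qed.

Lemma ev_size ms st0 st : RSize \notin ms -> get st0 RSize 0 = n ->
  frame ms st0 st -> ev st (var RSize) = n.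
Proof. by move=> ms_size size0 fr; rewrite ev_var fr. Qed.

Lemma wp_fill r a bound x (v : nat -> nat) st0 :
  a != RIndex ->
  (forall st, frame [:: RIndex; a] st0 st -> ev st bound = r) ->
  (forall k st, k < r -> frame [:: RIndex; a] st0 st -> get st RIndex 0 = k ->
     ev st x = v k) ->
  wp r.+1 (For bound (write a idx x))
    (fun st => [/\ frame [:: RIndex; a] st0 st, amem st = amem st0
                 & forall k, k < r -> get st a k = v k]) st0.
Proof.
move=> a_idx bound_r ev_x.
pose contents k c := if c < k then v c else get st0 a c.
apply: wp_post; last first.
  apply: (@wp_for_write _ _ _ _ _ _ _ _ _ contents) => // k st lt_k fr ind _ c.
  rewrite (ev_x k) // evE ind /update /contents ltnS leq_eqVlt.
  by case: eqP => [->|].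
by move=> st [fr am get_a]; split=> // k lt_k; rewrite get_a /contents lt_k.
Qed.

Lemma wp_flag a e p x (pos : 'I_n -> nat) (on : pred 'I_n) v st0 :
  a != RIndex -> a != RSize -> get st0 RSize 0 = n ->
  (forall i st, frame [:: RIndex; a] st0 st -> get st RIndex 0 = i ->
     (forall c, get st a c = if [exists j : 'I_n, (j < i) && ((c == pos j) && on j)]
                             then v else get st0 a c) ->
     [/\ ev st p = pos i, (ev st e != 0) = on i & on i -> ev st x = v]) ->
  wp n.+1 (for_all (If e (write a p x) Skip))
    (fun st => [/\ frame [:: RIndex; a] st0 st, amem st = amem st0
      & forall c, get st a c = if [exists j, (c == pos j) && on j] then v
                               else get st0 a c]) st0.
Proof.
move=> a_idx a_size size0 ev_i.
pose contents k c := if [exists j : 'I_n, (j < k) && ((c == pos j) && on j)] then v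
                     else get st0 a c.
apply: wp_post; last first.
  apply: (@wp_for_write_if _ _ _ _ _ _ _ _ _ _ contents) => // [st fr|c|k st lt_k fr ind get_a c].
  - by apply: ev_size fr => //; rewrite !inE /= eq_sym.
  - by rewrite /contents; case: ifP => // /existsP[].
  have [-> -> ev_x] := ev_i (Ordinal lt_k) st fr ind get_a.
  rewrite /contents (exists_ltS _ (Ordinal lt_k)) /=.
  case: (on (Ordinal lt_k)) ev_x => [/(_ isT) ev_x|_]; last by rewrite andbF.
  by rewrite /update andbT ev_x; case: eqP.
move=> st [fr am get_a]; split=> // c; rewrite get_a /contents.
by congr (if _ then _ else _); apply: eq_existsb => j; rewrite ltn_ord.
Qed.

Lemma wp_add_cells a e p x (pos : 'I_n -> nat) (on : pred 'I_n) (v : 'I_n -> nat) st0 :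
  a != RIndex -> a != RSize -> get st0 RSize 0 = n ->
  (forall i st, frame [:: RIndex; a] st0 st -> get st RIndex 0 = i ->
     (ev st e != 0) = on i /\ (on i -> ev st p = pos i /\ ev st x = v i)) ->
  wp n.+1 (for_all (If e (write a p (NAdd (read a p) x)) Skip))
    (fun st => [/\ frame [:: RIndex; a] st0 st, amem st = amem st0
      & forall c, get st a c = get st0 a c + \sum_(i < n | on i && (pos i == c)) v i]) st0.
Proof.
move=> a_idx a_size size0 ev_i.
pose contents k c :=
  get st0 a c + \sum_(i < n | (i < k) && (on i && (pos i == c))) v i.
apply: wp_post; last first.
  apply: (@wp_for_write_if _ _ _ _ _ _ _ _ _ _ contents) => // [st fr|c|k st lt_k fr ind get_a c].
  - by apply: ev_size fr => //; rewrite !inE /= eq_sym.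
  - by rewrite /contents big_pred0 ?addn0.
  have [-> ev_on] := ev_i (Ordinal lt_k) st fr ind.
  rewrite /contents (sum_ltS _ _ (Ordinal lt_k)) addnA /=.
  case: (on (Ordinal lt_k)) ev_on => [[] // ev_p ev_x|_]; last by rewrite addn0.
  rewrite !evE ev_p ev_x get_a /update eq_sym.
  by case: eqP => [->|_]; rewrite ?addn0.
move=> st [fr am get_a]; split=> // c; rewrite get_a /contents; congr (_ + _).
by apply: eq_bigl => i; rewrite ltn_ord.
Qed.

End VertexLoops.

End Program.

(** * Correctness of a stage *)

Section Correctness.

Variables (L U : finType) (compat : L -> U -> U -> bool).
Variables (A : pzSemiRingType) (inp : nat -> nat).
Variables (query : seq nat -> nat -> option (A * nat)) (C n : nat).
Variables (lb : 'I_n -> 'I_n -> L) (q : 'I_n -> U -> A).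
Hypothesis q_comm : forall i j a b, i != j -> GRing.comm (q i a) (q j b).
Hypothesis U_gt0 : 0 < #|U|.

Notation V := 'I_n.
Notation profile := {ffun V -> {set U}}.
Notation N := #|{set U}|.
Notation set_rank := (pointed_rank (set0 : {set U})).
Notation profile_sum := (profile_sum lb compat q).
Notation consistent := (consistent lb compat).
Notation wp := (@wp A inp query C).
Notation ev := (@ev A inp).
Implicit Types (st : state A) (i j c s t : V) (rho co : V -> V) (tb : V -> nat).
Implicit Types (S T : {set U}) (d : profile) (ms : seq register).

Lemma card_sets_gt1 : 1 < N.
Proof. by rewrite card_set_type -{1}(expn0 2) ltn_exp2l. Qed.

Lemma card_sets_gt0 : 0 < N.
Proof. exact: ltnW card_sets_gt1. Qed.

Record static st : Prop := Static {
  static_size : get st RSize 0 = n;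
  static_row : forall i, get st RRow i = i * n;
  static_place : forall i T, get st RPlace (N * i + set_rank T) = set_rank T * N ^ i;
  static_block : get st RBlock 0 = N ^ n;
  static_clash : forall l S T,
    get st RClash (N * (N * label_code l + set_rank S) + set_rank T) = ~~ fits compat l S T;
  static_union : forall S T,
    get st RUnion (N * set_rank S + set_rank T) = set_rank (S :|: T)
}.

(* The memory describes the contraction of the graph along [rho]; the table of
   the component named [c] starts at [tb c], and the semiring memory is free
   from [base] on. *)
Record contracted rho co tb base st : Prop := Contracted {
  contracted_static : static st;
  contracted_free : get st RFree 0 = base;
  contracted_live : forall i, get st RLive i = (rho i == i);
  contracted_label : forall i j, rho i = i -> rho j = j ->
    get st RLabel (i * n + j) = label_code (part_label lb rho i j);
  contracted_comp : forall i, get st RComp i = co i;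
  contracted_table : forall i, get st RTable i = tb i
}.

Record selected rho co s t st : Prop := Selected {
  selected_kept : get st RKept 0 = s;
  selected_dropped : get st RDropped 0 = t;
  selected_mark : forall i, get st RMark i = marked lb rho co s t i
}.

Definition shows d st := forall i, get st RDigit i = set_rank (d i).

Definition static_registers := [:: RSize; RRow; RPlace; RBlock; RClash; RUnion].
Definition contracted_registers :=
  [:: RFree; RLive; RLabel; RComp; RTable] ++ static_registers.
Definition selected_registers := [:: RKept; RDropped; RMark].

Lemma static_frame ms st0 st : frame ms st0 st ->
  all (fun a => a \notin ms) static_registers -> static st0 -> static st.
Proof.
move=> fr /allP out [size0 row place block clash union].
by split=> *; rewrite fr ?out.
Qed.

Lemma contracted_frame ms rho co tb base st0 st :
  frame ms st0 st -> all (fun a => a \notin ms) contracted_registers ->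
  contracted rho co tb base st0 -> contracted rho co tb base st.
Proof.
rewrite all_cat => fr /andP[/allP out out_static] [sta free live lab comp table].
split=> [||i|i j ri rj|i|i]; first (exact: static_frame fr _ sta);
  by rewrite fr ?out // lab.
Qed.

Lemma selected_frame ms rho co s t st0 st :
  frame ms st0 st -> all (fun a => a \notin ms) selected_registers ->
  selected rho co s t st0 -> selected rho co s t st.
Proof. by move=> fr /allP out [*]; split=> *; rewrite fr ?out. Qed.

Lemma shows_frame ms d st0 st :
  frame ms st0 st -> RDigit \notin ms -> shows d st0 -> shows d st.
Proof. by move=> fr out sh i; rewrite fr. Qed.

Section Evaluation.

Variable st : state A.
Hypothesis sta : static st.
Implicit Types e : nexp.

Lemma ev_place e1 e2 i T : ev st e1 = i -> ev st e2 = set_rank T ->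
  ev st (place U e1 e2) = set_rank T * N ^ i.
Proof. by move=> e1i e2T; rewrite !evE e1i e2T static_place. Qed.

Lemma ev_clash e1 e2 e3 l S T :
  ev st e1 = label_code l -> ev st e2 = set_rank S -> ev st e3 = set_rank T ->
  ev st (clash U e1 e2 e3) = ~~ fits compat l S T.
Proof. by move=> e1l e2S e3T; rewrite !evE e1l e2S e3T static_clash. Qed.

Lemma ev_union e1 e2 S T : ev st e1 = set_rank S -> ev st e2 = set_rank T ->
  ev st (union U e1 e2) = set_rank (S :|: T).
Proof. by move=> e1S e2T; rewrite !evE e1S e2T static_union. Qed.

End Evaluation.

Lemma ev_label st rho co tb base e1 e2 i j : contracted rho co tb base st ->
  rho i = i -> rho j = j -> ev st e1 = i -> ev st e2 = j ->
  ev st (label e1 e2) = label_code (part_label lb rho i j).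
Proof.
move=> con ri rj e1i e2j; rewrite !evE e1i e2j static_row; last by case: con.
exact: contracted_label con _ _ _ _.
Qed.

Lemma label_code_inj : injective (@label_code L).
Proof. exact: can_inj (@label_codeK L). Qed.

Lemma ev_dist_eq0 st e1 e2 : (ev st (ndist e1 e2) == 0) = (ev st e1 == ev st e2).
Proof. by rewrite ev_dist addn_eq0 !subn_eq0 -eqn_leq. Qed.

Lemma ev_mismatch st e1 e2 :
  (ev st (mismatch e1 e2) != 0) = (agree 0 (ev st e1) (ev st e2) == 0).
Proof.
rewrite ev_add addn_eq0 ev_dist_eq0 ev_is_zero eqb0 /agree.
by case: eqP => //= _; rewrite negbK.
Qed.

Lemma agree_label_code (a b : option L) :
  agree 0 (label_code a) (label_code b) = label_code (agree None a b).
Proof. by rewrite -agree_inj //; apply: label_code_inj. Qed.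

Lemma ev_touches_merge st rho co tb base s t i :
  (forall v, rho (rho v) = rho v) -> rho s = s -> rho t = t -> s != t ->
  contracted rho co tb base st -> get st RKept 0 = s ->
  get st RDropped 0 = t -> get st RIndex 0 = i -> rho i = i ->
  (ev st touches_merge != 0) = touches lb rho s t i.
Proof.
move=> rho_idem rs rt st_neq con get_kept get_dropped ind ri.
have [ev_i ev_s ev_t] : [/\ ev st idx = i, ev st kept = s & ev st dropped = t].
  by rewrite !ev_var.
rewrite touchesE // [ev st touches_merge]ev_add.
rewrite [ev st (NAdd (is_zero _) _)]ev_add [ev st (NAdd (mismatch _ _) _)]ev_add.
have sum_neq0 w x y z : (w + x + (y + z) != 0) = [|| w != 0, x != 0, y != 0 | z != 0].
  by rewrite !addn_eq0 !negb_and -orbA.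
rewrite sum_neq0 !ev_mismatch.
rewrite (ev_label con rs ri ev_s ev_i) (ev_label con rt ri ev_t ev_i) agree_label_code.
rewrite (ev_label con ri rs ev_i ev_s) (ev_label con ri rt ev_i ev_t) agree_label_code.
rewrite !label_code_eq0 !ev_is_zero !eqb0 !negbK.
by rewrite !ev_dist_eq0 ev_i ev_s ev_t !val_eqE.
Qed.

Lemma wp_select_merge rho co tb base s t st0 :
  contracted rho co tb base st0 -> rho t = t -> s != t ->
  (forall i, inp (get st0 RTape 0 + i) = merge_rep rho s t i) ->
  wp n.+1 select_merge (fun st => [/\ frame [:: RIndex; RDropped; RKept] st0 st,
    amem st = amem st0, get st RKept 0 = s & get st RDropped 0 = t]) st0.
Proof.
move=> con rt st_neq tape; apply: wp_bind.
  apply: (@wp_flag A inp query C n RDropped _ _ _ (fun _ => 0) (pred1 t) t) => //.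
    exact: static_size (contracted_static con).
  move=> i st fr ind _; rewrite !evE ind (fr RTape) // (fr RLive) // tape.
  rewrite (contracted_live con) /merge_rep; split=> // [|/eqP -> //].
  rewrite /=; have [->|nit] := eqVneq i t.
    by move: st_neq; rewrite rt !eqxx -val_eqE /=; lia.
  case: (rho i =P i) => [->|_]; last by rewrite sub0n.
  by rewrite (negbTE nit) subnn.
move=> st [fr am drop]; have drop0 : get st RDropped 0 = t.
  by rewrite drop; case: ifP => // /existsP[]; exists t; rewrite /= !eqxx.
apply: wp_run => //; rewrite run_assign !evE (fr RTape) // drop0 tape.
rewrite /merge_rep rt eqxx; split=> //.
by apply: frame_put => //; apply: frame_sub fr _.
Qed.

Lemma wp_mark_components rho co tb base s t st0 :
  (forall v, rho (rho v) = rho v) ->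
  contracted rho co tb base st0 -> rho s = s -> rho t = t -> s != t ->
  get st0 RKept 0 = s -> get st0 RDropped 0 = t ->
  wp n.+1 mark_components (fun st => [/\ frame [:: RIndex; RMark] st0 st,
    amem st = amem st0 & selected rho co s t st]) st0.
Proof.
move=> rho_idem con rs rt st_neq get_kept get_dropped; apply: wp_bind.
  apply: (@wp_fill A inp query C n RMark _ _ (fun _ => 0)) => // st.
  by apply: ev_size => //; apply: static_size (contracted_static con).
move=> st1 [fr1 am1 mark1]; have con1 := contracted_frame fr1 isT con.
apply: wp_post; last first.
  apply: (@wp_flag A inp query C n RMark _ _ _ co
    (fun i => (rho i == i) && touches lb rho s t i) 1) => //.
    exact: static_size (contracted_static con1).
  move=> i st fr ind _; have con' := contracted_frame fr isT con1.
  split; [by rewrite !evE ind (contracted_comp con') | | by []].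
  rewrite ev_sub ev_is_zero ev_read ev_var ind (contracted_live con').
  case: (rho i =P i) => //= ri.
  have get_s : get st RKept 0 = s by rewrite fr // fr1.
  have get_t : get st RDropped 0 = t by rewrite fr // fr1.
  rewrite -(ev_touches_merge rho_idem rs rt st_neq con' get_s get_t ind ri).
  by case: (ev st touches_merge).
move=> st [fr am mark]; split=> //.
- by apply: frame_sub (frame_trans fr1 fr) _.
- by rewrite am.
split=> [||c]; [by rewrite fr // fr1 | by rewrite fr // fr1 |].
rewrite mark mark1 // /marked.
rewrite (eq_existsb (P2 := fun i => [&& rho i == i, co i == c & touches lb rho s t i])).
  by case: existsP.
by move=> i /=; rewrite val_eqE andbCA [c == _]eq_sym.
Qed.

Lemma wp_start_profiles rho co tb base s t st0 :
  contracted rho co tb base st0 -> selected rho co s t st0 ->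
  wp n.+1 start_profiles (fun st => [/\ frame [:: RIndex; RDigit] st0 st,
    amem st = amem st0 & forall i, get st RDigit i = merging lb rho co s t i]) st0.
Proof.
move=> con sel; pose start k := get st0 RLive k + get st0 RMark (get st0 RComp k) - 1.
apply: wp_post; last first.
  apply: (@wp_fill A inp query C n RDigit _ _ start) => // [st|k st lt_k fr ind].
    by apply: ev_size => //; apply: static_size (contracted_static con).
  by rewrite !evE ind !fr.
move=> st [fr am digits]; split=> // i.
rewrite digits // /start (contracted_live con) (contracted_comp con) (selected_mark sel).
by rewrite /merging; case: (rho i == i); case: marked.
Qed.

Lemma ord_gt0 i : 0 < n.
Proof. exact: leq_ltn_trans (ltn_ord i). Qed.

Lemma block_gt1 : 0 < n -> 1 < N ^ n.
Proof. by move=> n_gt0; rewrite -{1}(expn0 N) ltn_exp2l ?card_sets_gt1. Qed.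

(* Address [0] holds the output and address [1] the current product. *)
Definition tables_below rho co tb base := forall c, rho c = c -> co c = c ->
  N ^ n <= tb c /\ tb c + N ^ n <= base.

(* Inconsistent profiles have a zero sum, but no correct entry is required for
   them: an entry may have been filled without testing all labels. *)
Definition tables_correct rho co tb st := forall c d, rho c = c -> co c = c ->
  supported (in_component rho co c) d -> consistent rho d ->
  amem st (tb c + offset d) = profile_sum rho d.

Definition block_frame base st0 st := forall x, x != 1 ->
  ~~ (base <= x < base + N ^ n) -> amem st x = amem st0 x.

Section MergeStep.

Variables (rho co : V -> V) (tb : V -> nat) (base : nat) (s t : V).
Hypothesis rho_idem : forall v, rho (rho v) = rho v.
Hypotheses (rs : rho s = s) (rt : rho t = t) (st_neq : s != t).
Hypothesis co_map : component_map lb rho co.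

Notation contracted := (contracted rho co tb base).
Notation selected := (selected rho co s t).
Notation merging := (merging lb rho co s t).

Lemma shows_neq0 d st i e : shows d st -> ev st e = i ->
  (ev st (read RDigit e) != 0) = (d i != set0).
Proof. by move=> sh ei; rewrite ev_read ei sh pointed_rank_eq0. Qed.

Lemma wp_check_profile d st0 :
  contracted st0 -> selected st0 -> shows d st0 -> supported merging d ->
  wp n.+1 (check_profile U) (fun st => [/\ frame [:: RIndex; RBad] st0 st,
    amem st = amem st0 & (get st RBad 0 == 0) = admissible lb compat rho s t d]) st0.
Proof.
move=> con sel sh /supportedP supp; apply: wp_assign => //; set st1 := put _ _ _ _.
have fr1 : frame [:: RBad] st0 st1 by apply: frame_put.
pose pl := part_label lb rho.
pose clashes i := (~~ fits compat (pl s i) (d s) (d i) + ~~ fits compat (pl t i) (d t) (d i)) +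
  (~~ fits compat (pl i s) (d i) (d s) + ~~ fits compat (pl i t) (d i) (d t)).
apply: wp_post; last first.
  apply: (@wp_add_cells A inp query C n RBad _ _ _ (fun _ => 0)
    (fun i => d i != set0) clashes) => //.
    by rewrite fr1 //; apply: static_size (contracted_static con).
  move=> i st fr2 ind; have fr := frame_trans fr1 fr2.
  have con' := contracted_frame fr isT con; have sel' := selected_frame fr isT sel.
  have sh' := shows_frame fr isT sh.
  have [ev_i ev_s ev_t] : [/\ ev st idx = i, ev st kept = s & ev st dropped = t].
    by rewrite !ev_var (selected_kept sel') (selected_dropped sel').
  rewrite (shows_neq0 sh' ev_i); split=> // di; split=> //.
  have ri : rho i = i by move: di; rewrite supp => /andP[/eqP].
  have digit e j : ev st e = j -> ev st (read RDigit e) = set_rank (d j).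
    by move=> ej; rewrite ev_read ej sh'.
  rewrite !ev_add /clashes; congr (_ + _ + (_ + _));
    by apply: (ev_clash (contracted_static con') (ev_label con' _ _ _ _)
      (digit _ _ _) (digit _ _ _)).
move=> st [fr am bad]; split=> //.
- by apply: frame_sub (frame_trans fr1 fr) _.
rewrite bad get_put /= add0n sum_nat_eq0; apply/forallP/forallP => [no_clash i|adm i].
  have [->|di] := eqVneq (d i) set0; first by rewrite !fits_set0l !fits_set0r.
  have := no_clash i; rewrite di /= !addn_eq0 !eqb0 !negbK -!andbA; exact.
apply/implyP => _; rewrite !addn_eq0 !eqb0 !negbK -!andbA; exact: adm.
Qed.

Lemma ev_place_digit d st e i : static st -> shows d st -> ev st e = i ->
  ev st (place U e (read RDigit e)) = set_rank (d i) * N ^ i.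
Proof. by move=> sta sh ei; apply: ev_place; rewrite // ev_read ei. Qed.

Lemma wp_locate_components d st0 : contracted st0 -> shows d st0 ->
  wp n.+1 (locate_components U) (fun st => [/\ frame [:: RIndex; RAcc] st0 st,
    amem st = amem st0
    & forall c, get st RAcc c = tb c + offset (component_part co c d)]) st0.
Proof.
move=> con sh; have size0 := static_size (contracted_static con).
apply: wp_bind.
  apply: (@wp_fill A inp query C n RAcc _ _ (get st0 RTable)) => // [st|k st _ fr ind].
    exact: ev_size.
  by rewrite !evE ind fr.
move=> st1 [fr1 am1 acc1]; apply: wp_post; last first.
  apply: (@wp_add_cells A inp query C n RAcc _ _ _ (fun i => co i) (fun i => d i != set0)
    (fun i => set_rank (d i) * N ^ i)) => // [|i st fr2 ind]; first by rewrite fr1.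
  have fr := frame_trans fr1 fr2.
  have con' := contracted_frame fr isT con; have sh' := shows_frame fr isT sh.
  have ev_i : ev st idx = i by rewrite ev_var.
  rewrite (shows_neq0 sh' ev_i); split=> // _.
  by rewrite ev_read ev_i (contracted_comp con') (ev_place_digit (contracted_static con') sh' ev_i).
move=> st [fr2 am2 acc2]; split=> [||c]; last 1 first.
- by rewrite acc2 acc1 // (contracted_table con) offset_component_part.
- by apply: frame_sub (frame_trans fr1 fr2) _.
- by rewrite am2.
Qed.

Lemma wp_multiply_components st0 :
  contracted st0 -> selected st0 ->
  (forall c, marked lb rho co s t c -> get st0 RAcc c != 1) ->
  wp n.+1 multiply_components (fun st => [/\ frame [:: RIndex] st0 st,
    forall x, x != 1 -> amem st x = amem st0 x
    & amem st 1 = (\prod_(c | marked lb rho co s t c) amem st0 (get st0 RAcc c))%R]) st0.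
Proof.
move=> con sel acc_neq1; apply: wp_run_seq => //; rewrite run_astore ev_const.
set st1 := aput _ _ _; have get1 a k : get st1 a k = get st0 a k by [].
pose I k st := (forall x, x != 1 -> amem st x = amem st0 x) /\ amem st 1 =
  (\prod_(0 <= c < k | get st0 RMark c != 0) amem st0 (get st0 RAcc c))%R.
apply: wp_post; last first.
  apply: (@wp_for_run _ _ _ _ n [:: RIndex] _ _ I) => // [st fr||k st lt_k fr ind [am prod]].
  - by apply: ev_size fr => //; apply: static_size (contracted_static con).
  - by split=> [x /negbTE nx|]; rewrite amem_aput ?nx // eqxx big_geq.
  rewrite run_if ev_read ev_var ind (fr RMark) // get1.
  have prodS : (\prod_(0 <= c < k.+1 | get st0 RMark c != 0) amem st0 (get st0 RAcc c) =
      amem st 1%N * if get st0 RMark k != 0 then amem st0 (get st0 RAcc k) else 1)%R.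
    by rewrite prod big_mkcond big_nat_recr //= -big_mkcond.
  case: ifP prodS => [mark_k prodS|_]; last by rewrite mulr1; split.
  rewrite run_astore ev_const; split=> //; split=> [x nx|].
    by rewrite amem_aput (negbTE nx) am.
  rewrite amem_aput eqxx prodS -[LHS]/(amem st 1 * amem st (ev st (read RAcc idx)))%R.
  rewrite ev_read ev_var ind (fr RAcc) // get1 [amem st (get _ _ _)]am //.
  apply: (acc_neq1 (Ordinal lt_k)); move: mark_k.
  by have /= -> := selected_mark sel (Ordinal lt_k); rewrite eqb0 negbK.
move=> st [fr [am prod]]; split=> //.
rewrite prod big_mkord; apply: eq_bigl => c.
by rewrite (selected_mark sel) eqb0 negbK.
Qed.

Hypothesis tb_below : tables_below rho co tb base.

Lemma base_gt1 : 1 < base.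
Proof.
have [lo hi] := tb_below (component_live co_map rs) (component_idem co_map rs).
exact: leq_trans (block_gt1 (ord_gt0 s)) (leq_trans lo (leq_trans (leq_addr _ _) hi)).
Qed.

Lemma table_entry c d : rho c = c -> co c = c -> 1 < tb c + offset d < base.
Proof.
move=> rc cc; have [lo hi] := tb_below rc cc.
rewrite (leq_trans (block_gt1 (ord_gt0 c)) (leq_trans lo (leq_addr _ _))) (leq_trans _ hi) //.
by rewrite ltn_add2l offset_lt.
Qed.

Lemma tables_correct_frame st0 st :
  block_frame base st0 st -> tables_correct rho co tb st0 -> tables_correct rho co tb st.
Proof.
move=> bl tab c d rc cc supp cons; have /andP[gt1 lt_base] := table_entry d rc cc.
rewrite bl ?tab //; first by rewrite gtn_eqF.
by rewrite negb_and -ltnNge lt_base.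
Qed.

Lemma wp_multiply_tables d st0 :
  contracted st0 -> selected st0 -> shows d st0 -> supported merging d ->
  tables_correct rho co tb st0 ->
  wp n.+1 (multiply_tables U) (fun st => [/\ frame [:: RIndex; RAcc] st0 st,
    forall x, x != 1 -> amem st x = amem st0 x
    & consistent rho d -> amem st 1 = profile_sum rho d]) st0.
Proof.
move=> con sel sh supp tab; apply: wp_bind (wp_locate_components con sh) _.
move=> st1 [fr1 am1 acc1].
have con1 := contracted_frame fr1 isT con; have sel1 := selected_frame fr1 isT sel.
have entry c : marked lb rho co s t c -> 1 < get st1 RAcc c < base.
  by move=> /(marked_live co_map)[rc cc]; rewrite acc1 table_entry.
have acc_neq1 c : marked lb rho co s t c -> get st1 RAcc c != 1.
  by move=> /entry; lia.
apply: wp_post (wp_multiply_components con1 sel1 acc_neq1).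
move=> st [fr am prod]; split=> [|x nx|cons].
- by apply: frame_sub (frame_trans fr1 fr) _.
- by rewrite am // am1.
rewrite prod (profile_sum_merging q_comm co_map supp cons); apply: eq_bigr => c mc.
have [rc cc] := marked_live co_map mc; rewrite acc1 am1 tab //.
  exact: component_part_supported supp mc.
exact: consistent_restrict.
Qed.

Lemma wp_locate_target d st0 : contracted st0 -> selected st0 -> shows d st0 ->
  wp n.+1 (locate_target U) (fun st => [/\ frame [:: RIndex; RTarget] st0 st,
    amem st = amem st0 & get st RTarget 0 = base + offset (merge_profile s t d)]) st0.
Proof.
move=> con sel sh; apply: wp_assign => //; set st1 := put _ _ _ _.
have fr1 : frame [:: RTarget] st0 st1 by apply: frame_put.
apply: wp_bind.
  apply: (@wp_add_cells A inp query C n RTarget _ _ _ (fun _ => 0)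
    (fun i => d i != set0) (fun i => set_rank (d i) * N ^ i)) => // [|i st fr2 ind].
    by rewrite fr1 //; apply: static_size (contracted_static con).
  have fr := frame_trans fr1 fr2.
  have sta' := contracted_static (contracted_frame fr isT con).
  have sh' := shows_frame fr isT sh; have ev_i : ev st idx = i by rewrite ev_var.
  by rewrite (shows_neq0 sh' ev_i) (ev_place_digit sta' sh' ev_i).
move=> st2 [fr2 am2 target2]; have fr := frame_trans fr1 fr2.
have sta' := contracted_static (contracted_frame fr isT con).
have sel' := selected_frame fr isT sel; have sh' := shows_frame fr isT sh.
have ev_s : ev st2 kept = s by rewrite ev_var (selected_kept sel').
have ev_t : ev st2 dropped = t by rewrite ev_var (selected_dropped sel').
have ev_st : ev st2 (union U (read RDigit kept) (read RDigit dropped)) =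
    set_rank (d s :|: d t).
  by apply: (ev_union sta'); rewrite ev_read ?ev_s ?ev_t.
apply: wp_run; rewrite // run_assign; split.
- by apply: frame_put => //; apply: frame_sub fr _.
- by rewrite amem_put am2.
rewrite get_put !eqxx ev_add !ev_sub (ev_place_digit sta' sh' ev_s) (ev_place_digit sta' sh' ev_t).
rewrite (ev_place sta' ev_s ev_st) ev_var target2 get_put /= ev_var.
rewrite (contracted_free con) offset_merge //.
rewrite (eq_bigl (fun i => d i != set0)) -?offset_support => [|i]; last by rewrite andbT.
by have := leq_offset d st_neq; lia.
Qed.

Lemma wp_record_product d st0 : contracted st0 -> selected st0 -> shows d st0 ->
  wp n.+1 (record_product U) (fun st => frame [:: RIndex; RTarget] st0 st /\
    forall x, amem st x =
      if (get st0 RBad 0 == 0) && (x == base + offset (merge_profile s t d))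
      then (amem st0 x + amem st0 1)%R else amem st0 x) st0.
Proof.
move=> con sel sh; apply: wp_bind (wp_locate_target con sel sh) _.
move=> st [fr am target]; apply: wp_run; rewrite // run_if run_skip run_astore.
rewrite ev_var fr //; case: eqP => _; split=> // x; last by rewrite am.
rewrite andTb amem_aput ev_var target am; case: eqP => // ->.
by rewrite -[LHS]/(amem st (ev st (var RTarget)) + amem st 1)%R ev_var target am.
Qed.

Lemma run_turn_wheel (on : pred nat) r k st :
  get st RIndex 0 = k -> get st RCarry 0 = (N.-1 ^ wheels on k %| r.+1) ->
  get st RDigit k = digit N.-1 on r k ->
  let st' := run inp (turn_wheel U) st in
  [/\ frame [:: RCarry; RDigit] st st', amem st' = amem st,
      get st' RCarry 0 = (N.-1 ^ wheels on k.+1 %| r.+1)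
    & forall m, get st' RDigit m =
        if m == k then digit N.-1 on r.+1 k else get st RDigit m].
Proof.
move=> ind carry dig /=; have M_gt0 : 0 < N.-1 by rewrite -subn1 subn_gt0 card_sets_gt1.
have := digitS on M_gt0 r k; have := carryS on M_gt0 r k.
have kept : digit N.-1 on r.+1 k = digit N.-1 on r k -> forall m,
    get st RDigit m = if m == k then digit N.-1 on r.+1 k else get st RDigit m.
  by move=> same m; case: eqP => // ->; rewrite dig same.
rewrite !run_if !ev_var carry eqb0 negbK ev_read ev_var ind dig digit_eq0.
case: (_ %| _) carry => /= carry carry' dig'; last by split; rewrite ?carry' //; apply: kept.
case: (on k) carry' dig' => /= carry' dig'; last by split; rewrite ?carry' //; apply: kept.
rewrite ev_sub ev_const ev_read ev_var ind dig -lt0n subn_gt0.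
case: ifP dig' => lt_M ->; rewrite !runE !evE ind ?dig.
  split=> [|||m]; rewrite ?stateE //=.
  - by do 2![apply: frame_put => //].
  - by rewrite carry' ltn_eqF.
  - by rewrite addn1.
split=> [|||m]; rewrite ?stateE //=.
- exact: frame_put.
by rewrite carry carry' eqn_leq digit_le // leqNgt lt_M.
Qed.

Lemma wp_next_profile (on : pred nat) r st0 :
  get st0 RSize 0 = n -> (forall i, get st0 RDigit i = digit N.-1 on r i) ->
  wp n.+1 (next_profile U) (fun st => [/\
    frame [:: RIndex; RCarry; RDigit; RRunning] st0 st, amem st = amem st0,
    get st RRunning 0 = ~~ (N.-1 ^ wheels on n %| r.+1)
    & forall i, get st RDigit i = digit N.-1 on r.+1 i]) st0.
Proof.
move=> size0 digits0; apply: wp_assign => //; set st1 := put _ _ _ _.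
have fr1 : frame [:: RCarry] st0 st1 by apply: frame_put.
pose I k st := [/\ amem st = amem st0, get st RCarry 0 = (N.-1 ^ wheels on k %| r.+1)
  & forall i, get st RDigit i = digit N.-1 on (if i < k then r.+1 else r) i].
apply: wp_bind.
  apply: (@wp_for_run _ _ _ _ n [:: RIndex; RCarry; RDigit] _ _ I) => //
    [st fr|k st x [am carry digits]||k st lt_k fr ind [am carry digits]].
  - by apply: ev_size fr => //; rewrite fr1.
  - by split=> // i; rewrite get_put digits.
  - by split; rewrite ?get_put ?dvd1n // => i; rewrite get_put digits0.
  have dig_k : get st RDigit k = digit N.-1 on r k.
    by have /= := digits (Ordinal lt_k); rewrite ltnn.
  have [fr' am' carry' digits'] := run_turn_wheel ind carry dig_k.
  split; [by apply: frame_sub (frame_trans fr fr') _ | by rewrite fr' |].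
  split=> [|//|i]; first by rewrite am'.
  rewrite digits' digits ltnS [i <= k]leq_eqVlt.
  by case: (eqVneq (i : nat) k) => [->|].
move=> st [fr [am carry digits]]; apply: wp_run; rewrite // run_assign !evE.
split=> [|||i]; rewrite ?stateE //=.
- by apply: frame_put => //; apply: frame_sub (frame_trans fr1 fr) _.
- by rewrite carry eqb0.
- by rewrite digits ltn_ord.
Qed.

Definition merging_at (k : nat) : bool := oapp merging false (insub k).
Definition merging_profile r : profile := dials N.-1 merging_at set0 n r.
Definition merging_count := N.-1 ^ wheels merging_at n.

Notation rho' := (merge_rep rho s t).
Notation merge_component := (merge_component lb rho co s t).

Lemma pred_card_sets_gt0 : 0 < N.-1.
Proof. by rewrite -subn1 subn_gt0 card_sets_gt1. Qed.

Lemma card_setsE : N = N.-1.+1.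
Proof. by rewrite prednK ?card_sets_gt0. Qed.

Lemma merging_atE i : merging_at i = merging i.
Proof. by rewrite /merging_at valK. Qed.

Lemma wheels_merging : wheels merging_at n = #|[set i | merging i]|.
Proof.
rewrite /wheels -sum1_count -val_enum_ord big_map big_enum_cond /= cardsE -sum1_card.
by apply: eq_bigl => i; rewrite merging_atE.
Qed.

Lemma shows_merging_profile r st : shows (merging_profile r) st <->
  forall i, get st RDigit i = digit N.-1 merging_at r i.
Proof.
by split=> sh i; rewrite sh (rank_dials _ pred_card_sets_gt0 _ card_setsE).
Qed.

Lemma merging_profile_supported r : supported merging (merging_profile r).
Proof.
apply/supportedP => i.
by rewrite (dials_neq0 _ pred_card_sets_gt0 _ card_setsE) merging_atE.
Qed.

Definition profile_registers :=
  [:: RIndex; RBad; RAcc; RTarget; RCarry; RDigit; RRunning].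

Lemma wp_process_profile r st0 :
  contracted st0 -> selected st0 -> shows (merging_profile r) st0 ->
  tables_correct rho co tb st0 ->
  wp n.+1 (process_profile U) (fun st => [/\ frame profile_registers st0 st,
    get st RRunning 0 = ~~ (merging_count %| r.+1), shows (merging_profile r.+1) st,
    block_frame base st0 st
    & forall d', consistent rho' d' -> amem st (base + offset d') =
        (amem st0 (base + offset d') +
         if merge_profile s t (merging_profile r) == d'
         then profile_sum rho (merging_profile r) else 0)%R]) st0.
Proof.
set d := merging_profile r; move=> con0 sel0 sh0 tab0.
have supp : supported merging d by apply: merging_profile_supported.
apply: wp_bind (wp_check_profile con0 sel0 sh0 supp) _ => st1 [fr1 am1 bad1].
have con1 := contracted_frame fr1 isT con0; have sel1 := selected_frame fr1 isT sel0.
have sh1 := shows_frame fr1 isT sh0.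
have tab1 : tables_correct rho co tb st1 by apply: tables_correct_frame tab0 => x _ _; rewrite am1.
apply: wp_bind (wp_multiply_tables con1 sel1 sh1 supp tab1) _ => st2 [fr2 am2 prod2].
have con2 := contracted_frame fr2 isT con1; have sel2 := selected_frame fr2 isT sel1.
have sh2 := shows_frame fr2 isT sh1.
apply: wp_bind (wp_record_product con2 sel2 sh2) _ => st3 [fr3 am3].
have sh3 := shows_frame fr3 isT sh2; have fr03 := frame_trans (frame_trans fr1 fr2) fr3.
have size3 : get st3 RSize 0 = n by rewrite fr03 //; apply: static_size (contracted_static con0).
have digits3 : forall i, get st3 RDigit i = digit N.-1 merging_at r i.
  exact/shows_merging_profile.
apply: wp_post (wp_next_profile size3 digits3) => st [fr am running digits].
have lt_target := offset_lt (merge_profile s t d); have base1 := base_gt1.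
split=> [|//|||d' cons'].
- by apply: frame_sub (frame_trans fr03 fr) _.
- exact/shows_merging_profile.
- move=> x nx out; rewrite am am3 ifF ?am2 ?am1 //.
  by apply: contraNF out => /andP[_ /eqP ->]; rewrite leq_addr ltn_add2l.
rewrite am am3 fr2 // bad1 eqn_add2l (inj_eq (@offset_inj U n)) [d' == _]eq_sym.
rewrite [amem st2 (base + _)]am2 ?am1; last by lia.
case: eqP => [merge_d|_]; last by rewrite andbF addr0.
rewrite andbT; case: ifPn => [adm|not_adm].
  rewrite prod2 //; apply: (admissible_consistent rho_idem rs rt st_neq supp adm).
  by rewrite merge_d.
rewrite profile_sum_inconsistent ?addr0 //; apply: contra not_adm; exact: consistent_admissible.
Qed.

Lemma wp_process_profiles st0 :
  contracted st0 -> selected st0 -> (forall i, get st0 RDigit i = merging i) ->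
  tables_correct rho co tb st0 -> (forall x, base <= x -> amem st0 x = 0%R) ->
  wp (n.+1 * merging_count.+1) (process_profiles U) (fun st =>
    [/\ frame profile_registers st0 st, block_frame base st0 st
      & forall d', consistent rho' d' ->
        supported (in_component rho' merge_component s) d' ->
        amem st (base + offset d') = profile_sum rho' d']) st0.
Proof.
move=> con0 sel0 digits0 tab0 fresh; have count_gt0 : 0 < merging_count.
  by rewrite expn_gt0 pred_card_sets_gt0.
apply: wp_assign => //; set st1 := put _ _ _ _.
pose summand d' k := (if merge_profile s t (merging_profile k) == d'
                      then profile_sum rho (merging_profile k) else 0)%R.
pose I r st := [/\ frame profile_registers st0 st, get st RRunning 0 = (r < merging_count),
  shows (merging_profile r) st, block_frame base st0 st
  & forall d', consistent rho' d' ->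
      amem st (base + offset d') = (\sum_(0 <= k < r) summand d' k)%R].
apply: wp_post; last first.
  apply: (@wp_while _ _ _ _ merging_count n.+1 _ _ I) => //.
  - split=> // [|||d' _].
    + exact: frame_put.
    + by rewrite get_put count_gt0.
    + by apply/shows_merging_profile => i; rewrite get_put digits0 digit0 merging_atE.
    + by rewrite amem_put big_geq // fresh // leq_addr.
  - move=> r st lt_r [fr running sh bl sums]; rewrite ev_var running lt_r; split=> //.
    have con := contracted_frame fr isT con0; have sel := selected_frame fr isT sel0.
    have tab := tables_correct_frame bl tab0.
    apply: wp_post (wp_process_profile con sel sh tab).
    move=> st' [fr' running' sh' bl' sums']; split=> [||//||d' cons'].
    + by apply: frame_sub (frame_trans fr fr') _.
    + rewrite running' ltn_neqAle lt_r andbT; congr (nat_of_bool (~~ _)).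
      apply/idP/eqP => [/dvdn_leq -/(_ isT)|<-//].
      by rewrite leq_eqVlt ltnNge lt_r orbF => /eqP.
    + by move=> x nx out; rewrite bl' // bl.
    + by rewrite sums' // sums // big_nat_recr.
  - by move=> st [_ running _ _ _]; rewrite ev_var running ltnn.
move=> st [fr _ _ bl sums]; split=> // d' cons' supp'.
rewrite sums // (profile_sum_merged_component _ _ rs rt st_neq co_map supp') big_mkord.
rewrite (big_dials _ pred_card_sets_gt0 set0 card_setsE
  (fun d => if merge_profile s t d == d' then profile_sum rho d else 0)%R).
by apply: eq_bigl => d; apply: eq_forallb => i; rewrite merging_atE.
Qed.

Definition merge_table i := if i == s then base else tb i.

Lemma merge_component_other c : c != s -> merge_component c = c -> co c = c.
Proof.
by rewrite /merge_component => ncs; case: ifP => // _ sc; rewrite sc eqxx in ncs.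
Qed.

Lemma tables_correct_merge st0 st :
  tables_correct rho co tb st0 -> block_frame base st0 st ->
  (forall d', consistent rho' d' ->
     supported (in_component rho' merge_component s) d' ->
     amem st (base + offset d') = profile_sum rho' d') ->
  tables_correct rho' merge_component merge_table st.
Proof.
move=> tab bl new c d rc' cc' supp cons; rewrite /merge_table.
have [cs|ncs] := eqVneq c s; first by rewrite cs in supp; apply: new.
have [rc _] := merge_rep_live rs st_neq rc'; have cc := merge_component_other ncs cc'.
have [cons' supp' ->] := unmerged_component q rho_idem rs rt st_neq co_map ncs cc' supp cons.
by rewrite (tables_correct_frame bl tab).
Qed.

End MergeStep.

Definition labels st i j := get st RLabel (i * n + j).

Lemma wp_merge_labels e1 e2 (x y : V -> nat) st0 :
  get st0 RSize 0 = n -> injective x -> (forall i j, x i != y j) ->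
  (forall st i, frame [:: RIndex; RLabel] st0 st -> get st RIndex 0 = i ->
     ev st e1 = x i /\ ev st e2 = y i) ->
  wp n.+1 (merge_labels e1 e2) (fun st => [/\ frame [:: RIndex; RLabel] st0 st,
    amem st = amem st0,
    forall i, get st RLabel (x i) = agree 0 (get st0 RLabel (x i)) (get st0 RLabel (y i))
    & forall m, (forall i, m != x i) -> get st RLabel m = get st0 RLabel m]) st0.
Proof.
move=> size0 x_inj xy ev12.
pose clear i := agree 0 (get st0 RLabel (x i)) (get st0 RLabel (y i)) == 0.
apply: wp_post; last first.
  apply: (@wp_flag A inp query C n RLabel _ _ _ x clear 0) => // i st fr ind lab.
  have [e1i e2i] := ev12 st i fr ind; split=> //.
  rewrite ev_mismatch !ev_read e1i e2i !lab ifF ?ifF //.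
    by apply/existsP => -[j /and3P[_ /eqP yx _]]; have := xy j i; rewrite yx eqxx.
  apply/existsP => -[j /and3P[lt_j /eqP/x_inj ij _]].
  by rewrite ij ltnn in lt_j.
move=> st [fr am lab]; split=> // [i|m out]; rewrite lab; last first.
  by rewrite ifF //; apply/existsP => -[i /andP[/eqP mx _]]; have := out i; rewrite mx eqxx.
case: existsP => [[j /andP[/eqP/x_inj -> /eqP clear_j]]|keep]; first by rewrite clear_j.
have : ~~ clear i by apply/negP => clear_i; apply: keep; exists i; rewrite eqxx.
by rewrite /clear /agree; case: (get st0 RLabel (x i) =P get st0 RLabel (y i)).
Qed.

Lemma wp_merge_label_rows s t st0 : static st0 -> s != t ->
  get st0 RKept 0 = s -> get st0 RDropped 0 = t ->
  wp n.+1 (merge_labels (label_index kept idx) (label_index dropped idx))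
    (fun st => [/\ frame [:: RIndex; RLabel] st0 st, amem st = amem st0
      & forall i j, labels st i j = merge_rows 0 s t (labels st0) i j]) st0.
Proof.
move=> sta st_neq get_s get_t; apply: wp_post; last first.
  apply: (@wp_merge_labels _ _ (fun j => s * n + j) (fun j => t * n + j)).
  - exact: static_size sta.
  - by move=> j k /eqP; rewrite matrix_index_inj => /andP[_ /eqP].
  - by move=> j k; rewrite matrix_index_inj negb_and st_neq.
  - move=> st j fr ind; have sta' := static_frame fr isT sta.
    by rewrite !evE ind (fr RKept) // (fr RDropped) // get_s get_t !(static_row sta').
move=> st [fr am lab out]; split=> // i j; rewrite /merge_rows /labels.
by case: eqP => [->|/eqP nis] //; apply: out => k; rewrite matrix_index_inj negb_and nis.
Qed.

Lemma wp_merge_label_cols s t st0 : static st0 -> s != t ->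
  get st0 RKept 0 = s -> get st0 RDropped 0 = t ->
  wp n.+1 (merge_labels (label_index idx kept) (label_index idx dropped))
    (fun st => [/\ frame [:: RIndex; RLabel] st0 st, amem st = amem st0
      & forall i j, labels st i j = merge_cols 0 s t (labels st0) i j]) st0.
Proof.
move=> sta st_neq get_s get_t; apply: wp_post; last first.
  apply: (@wp_merge_labels _ _ (fun i => i * n + s) (fun i => i * n + t)).
  - exact: static_size sta.
  - by move=> i k /eqP; rewrite matrix_index_inj => /andP[/eqP].
  - by move=> i k; rewrite matrix_index_inj negb_and st_neq orbT.
  - move=> st i fr ind; have sta' := static_frame fr isT sta.
    by rewrite !evE ind (fr RKept) // (fr RDropped) // get_s get_t !(static_row sta').
move=> st [fr am lab out]; split=> // i j; rewrite /merge_cols /labels.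
by case: eqP => [->|/eqP njs] //; apply: out => k; rewrite matrix_index_inj negb_and njs orbT.
Qed.

Lemma wp_merge_components rho co s t st0 :
  get st0 RSize 0 = n -> (forall i, get st0 RComp i = co i) ->
  selected rho co s t st0 ->
  wp n.+1 merge_components (fun st => [/\ frame [:: RIndex; RComp] st0 st,
    amem st = amem st0
    & forall i, get st RComp i = merge_component lb rho co s t i]) st0.
Proof.
move=> size0 comp0 sel; apply: wp_post; last first.
  apply: (@wp_flag A inp query C n RComp _ _ _ (fun i => i)
    (fun i => marked lb rho co s t (co i)) s) => // i st fr ind comp.
  have sel' := selected_frame fr isT sel.
  rewrite !evE ind comp ifF; last first.
    by apply/existsP => -[j /and3P[lt_j /eqP/val_inj ij _]]; rewrite ij ltnn in lt_j.
  by rewrite comp0 (selected_mark sel') (selected_kept sel') eqb0 negbK.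
move=> st [fr am comp]; split=> // i; rewrite comp /merge_component comp0.
case: existsP => [[j /andP[/eqP/val_inj -> ->]] //|none].
by case: ifP => // mi; case: none; exists i; rewrite eqxx.
Qed.

Lemma labels_merge rho co tb base s t st i j :
  (forall v, rho (rho v) = rho v) -> rho s = s -> rho t = t -> s != t ->
  contracted rho co tb base st ->
  merge_rep rho s t i = i -> merge_rep rho s t j = j ->
  merge_cols 0 s t (merge_rows 0 s t (labels st)) i j =
  label_code (part_label lb (merge_rep rho s t) i j).
Proof.
move=> rho_idem rs rt st_neq con ri' rj'; rewrite part_label_merge // /merge_cols /merge_rows.
have [ri _] := merge_rep_live rs st_neq ri'; have [rj _] := merge_rep_live rs st_neq rj'.
by case: (i == s); case: (j == s); rewrite /labels !(contracted_label con) // !agree_label_code.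
Qed.

Lemma wp_contract rho co tb base s t st0 :
  (forall v, rho (rho v) = rho v) -> rho s = s -> rho t = t -> s != t ->
  contracted rho co tb base st0 -> selected rho co s t st0 ->
  wp n.+1 contract (fun st => [/\ amem st = amem st0,
    get st RTape 0 = get st0 RTape 0 + n, get st RStage 0 = get st0 RStage 0 + 1
    & contracted (merge_rep rho s t) (merge_component lb rho co s t)
        (merge_table tb base s) (base + N ^ n) st]) st0.
Proof.
move=> rho_idem rs rt st_neq con sel; have sta := contracted_static con.
have [get_s get_t _] := sel.
apply: wp_bind (wp_merge_label_rows sta st_neq get_s get_t) _.
move=> st1 [fr1 am1 lab1]; have sta1 := static_frame fr1 isT sta.
have [get_s1 get_t1 _] := selected_frame fr1 isT sel.
apply: wp_bind (wp_merge_label_cols sta1 st_neq get_s1 get_t1) _.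
move=> st2 [fr2 am2 lab2]; have fr02 := frame_trans fr1 fr2.
have sel2 := selected_frame fr02 isT sel.
have size2 : get st2 RSize 0 = n by rewrite fr02 // (static_size sta).
have comp2 i : get st2 RComp i = co i by rewrite fr02 // (contracted_comp con).
apply: wp_bind (wp_merge_components size2 comp2 sel2) _.
move=> st3 [fr3 am3 comp3]; have fr03 := frame_trans fr02 fr3.
have [get_s3 get_t3 _] := selected_frame fr03 isT sel.
apply: wp_run; rewrite // /advance !runE !evE !stateE /= get_s3 get_t3.
rewrite !(fr03 RFree, fr03 RBlock, fr03 RTape, fr03 RSize, fr03 RStage) //.
rewrite (contracted_free con) (static_block sta) (static_size sta).
set st4 := put _ _ _ _.
have fr4 : frame [:: RLive; RTable; RFree; RTape; RStage] st3 st4.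
  by do 5![apply: frame_put => //].
split=> //; first by rewrite -[LHS]/(amem st3) am3 am2.
split=> [||i|i j ri rj|i|i].
- by apply: static_frame (frame_trans fr03 fr4) _ sta.
- by rewrite /st4 !stateE.
- rewrite /st4 !stateE /= fr03 // (contracted_live con) merge_rep_fix // val_eqE.
  by case: (i == t); rewrite ?andbF ?andbT.
- rewrite -(labels_merge rho_idem rs rt st_neq con) // fr4 // fr3 // -/(labels st2 i j) lab2.
  by rewrite /merge_cols /merge_rows !lab1.
- by rewrite fr4.
- by rewrite /st4 !stateE /= fr03 // (contracted_table con) val_eqE.
Qed.

Lemma tables_below_merge rho co tb base s t :
  rho s = s -> s != t -> component_map lb rho co ->
  tables_below rho co tb base ->
  tables_below (merge_rep rho s t) (merge_component lb rho co s t)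
    (merge_table tb base s) (base + N ^ n).
Proof.
move=> rs st_neq co_map below c rc' cc'; rewrite /merge_table.
have [rc _] := merge_rep_live rs st_neq rc'; case: eqP => [_|/eqP ncs].
  have := below _ (component_live co_map rs) (component_idem co_map rs); lia.
have := below c rc (merge_component_other ncs cc'); lia.
Qed.

Record stage_invariant k rho co tb base st : Prop := StageInvariant {
  invariant_contracted : contracted rho co tb base st;
  invariant_idem : forall v, rho (rho v) = rho v;
  invariant_components : component_map lb rho co;
  invariant_below : tables_below rho co tb base;
  invariant_correct : tables_correct rho co tb st;
  invariant_output : amem st 0 = 0%R;
  invariant_fresh : forall x, base <= x -> amem st x = 0%R;
  invariant_tape : get st RTape 0 = 1 + n * n + n * k.+1;
  invariant_stage : get st RStage 0 = k
}.

Lemma wp_stage k rho co tb base s t w st0 :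
  stage_invariant k rho co tb base st0 -> rho s = s -> rho t = t -> s != t ->
  (forall i, inp (1 + n * n + n * k.+1 + i) = merge_rep rho s t i) ->
  #|component lb (merge_rep rho s t) s| <= w ->
  wp (n.+1 * (N.-1 ^ w.+1).+1) (stage U) (fun st => exists co' tb' base',
    stage_invariant k.+1 (merge_rep rho s t) co' tb' base' st) st0.
Proof.
move=> [con0 rho_idem co_map below tab0 out0 fresh0 tape0 stage0] rs rt st_neq tape card_w.
have le_m : n.+1 <= n.+1 * (N.-1 ^ w.+1).+1 by rewrite leq_pmulr.
have count_le : n.+1 * (merging_count rho co s t).+1 <= n.+1 * (N.-1 ^ w.+1).+1.
  rewrite leq_mul2l /= ltnS leq_pexp2l ?pred_card_sets_gt0 // wheels_merging.
  by apply: leq_trans (card_merging rho_idem rs st_neq co_map) _; rewrite ltnS.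
apply: (wp_bind_leq le_m) (wp_select_merge con0 rt st_neq _) _ => [|st1 [fr1 am1 get_s1 get_t1]].
  by move=> i; rewrite tape0 tape.
have con1 := contracted_frame fr1 isT con0.
apply: (wp_bind_leq le_m) (wp_mark_components rho_idem con1 rs rt st_neq get_s1 get_t1) _.
move=> st2 [fr2 am2 sel2]; have con2 := contracted_frame fr2 isT con1.
apply: (wp_bind_leq le_m) (wp_start_profiles con2 sel2) _ => st3 [fr3 am3 digits3].
have con3 := contracted_frame fr3 isT con2; have sel3 := selected_frame fr3 isT sel2.
have am03 : amem st3 = amem st0 by rewrite am3 am2 am1.
have tab3 : tables_correct rho co tb st3.
  by apply: (tables_correct_frame below _ tab0) => x _ _; rewrite am03.
apply: (wp_bind_leq count_le)
  (wp_process_profiles rho_idem rs rt st_neq co_map below con3 sel3 digits3 tab3 _) _.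
  by rewrite am03.
move=> st4 [fr4 bl4 tab4]; have con4 := contracted_frame fr4 isT con3.
have sel4 := selected_frame fr4 isT sel3.
apply: (wp_mono le_m) (wp_contract rho_idem rs rt st_neq con4 sel4).
move=> st [am5 tape5 stage5 con5].
exists (merge_component lb rho co s t), (merge_table tb base s), (base + N ^ n).
have fr04 := frame_trans (frame_trans (frame_trans fr1 fr2) fr3) fr4.
have base1 := base_gt1 rs co_map below.
split=> //.
- exact: merge_rep_idem.
- exact: component_map_merge.
- exact: tables_below_merge.
- move=> c d; rewrite am5; apply: tables_correct_merge bl4 tab4 c d => //.
- by rewrite am5 bl4 ?am03 //; lia.
- by move=> x le_x; rewrite am5 bl4 ?am03 ?fresh0 //; lia.
- by rewrite tape5 fr04 // tape0; lia.
- by rewrite stage5 fr04 // stage0 addn1.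
Qed.

End Correctness.

(** * Initialisation *)

Section Initialisation.

Variables (L U : finType) (compat : L -> U -> U -> bool).
Variables (A : pzSemiRingType) (inp : nat -> nat).
Variables (query : seq nat -> nat -> option (A * nat)) (C n : nat).
Variables (lb : 'I_n -> 'I_n -> L) (q : 'I_n -> U -> A).
Hypothesis U_gt0 : 0 < #|U|.
Hypothesis inp_size : inp 0 = n.
Hypothesis inp_label : forall i j : 'I_n, inp (1 + (i * n + j)) = enum_rank (lb i j).
Hypothesis query_weight : forall (i : 'I_n) a,
  exists2 t, query [:: nat_of_ord i] (enum_rank a) = Some (q i a, t) & t <= C.

Notation N := #|{set U}|.
Notation set_rank := (pointed_rank (set0 : {set U})).
Notation wp := (@wp A inp query C).
Notation ev := (@ev A inp).
Implicit Types (st : state A) (i j c : 'I_n) (a b : U) (S T : {set U}).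

Lemma wp_init_constants m st0 : 0 < m ->
  wp m (init_constants compat) (fun st => [/\ frame [:: RClash; RUnion; RPlace] st0 st,
    amem st = amem st0,
    forall l S T, get st RClash (N * (N * label_code l + set_rank S) + set_rank T) =
      ~~ fits compat l S T,
    forall S T, get st RUnion (N * set_rank S + set_rank T) = set_rank (S :|: T)
    & forall k, k < N -> get st RPlace k = k]) st0.
Proof.
move=> m_gt0; apply: (wp_bind (wp_store_table _ _ _ _ _ _ _ m_gt0)).
move=> st1 [fr1 am1 clash1].
apply: (wp_bind (wp_store_table _ _ _ _ _ _ _ m_gt0)) => st2 [fr2 am2 union2].
apply: wp_post (wp_store_table _ _ _ _ _ _ _ m_gt0) => st [fr am place].
split=> // [||l S T|S T].
- by apply: frame_sub (frame_trans (frame_trans fr1 fr2) fr) _.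
- by rewrite am am2.
- rewrite fr // fr2 // clash1 ?clash_codeE //.
  by rewrite !index_lt ?pointed_rank_lt // ltnS label_code_le.
- by rewrite fr // union2 ?union_codeE // index_lt ?pointed_rank_lt.
Qed.

Lemma wp_init_places st0 : get st0 RSize 0 = n ->
  (forall k, k < N -> get st0 RPlace k = k) ->
  wp (N * n).+1 (init_places U) (fun st => [/\ frame [:: RIndex; RPlace] st0 st,
    amem st = amem st0
    & forall k T, k <= n -> get st RPlace (N * k + set_rank T) = set_rank T * N ^ k]) st0.
Proof.
move=> size0 place0; have N_gt0 := card_sets_gt0 U_gt0.
pose contents k m := if m < N + k then (m %% N) * N ^ (m %/ N) else get st0 RPlace m.
apply: wp_post; last first.
  apply: (@wp_for_write _ _ _ _ _ _ _ _ _ contents) => // [st fr|m|k st lt_k fr ind pl m].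
  - by rewrite !evE fr // size0.
  - rewrite /contents addn0; case: ifP => // lt_m.
    by rewrite modn_small // divn_small // muln1 place0.
  rewrite !evE ind pl /update /contents addnS ltnS leq_eqVlt.
  case: eqP => //= ->; have -> : k < N + k by rewrite -{1}[k]add0n ltn_add2r.
  by rewrite modnDl divnDl // divnn N_gt0 add1n expnS mulnCA.
move=> st [fr am pl]; split=> // k T le_k; rewrite pl /contents.
have lt_T := pointed_rank_lt set0 T.
rewrite modn_index // divn_index // ifT // [N + _]addnC.
by rewrite -addnS leq_add // leq_mul2l le_k orbT.
Qed.

Lemma wp_init_rows st0 : get st0 RSize 0 = n -> get st0 RRow 0 = 0 ->
  wp n.+1 init_rows (fun st => [/\ frame [:: RIndex; RRow] st0 st, amem st = amem st0
    & forall k, k <= n -> get st RRow k = k * n]) st0.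
Proof.
move=> size0 row0; pose contents k m := if m <= k then m * n else get st0 RRow m.
apply: wp_post; last first.
  apply: (@wp_for_write _ _ _ _ _ _ _ _ _ contents) => // [st fr|m|k st _ fr ind row m].
  - exact: ev_size fr.
  - by rewrite /contents; case: m.
  rewrite !evE ind row fr // size0 /update /contents leqnn addn1 [m <= _]leq_eqVlt ltnS.
  by case: eqP => [->|//]; rewrite mulSnr.
by move=> st [fr am row]; split=> // k le_k; rewrite row /contents le_k.
Qed.

Lemma wp_init_tables st0 : (forall (a : register) k, get st0 a k = 0) ->
  wp (N * n.+1) (init_tables compat) (fun st => [/\ static compat n st,
    frame (RIndex :: static_registers) st0 st, amem st = amem st0
    & get st RRow n = n * n]) st0.
Proof.
move=> get0; have N_gt1 := card_sets_gt1 U_gt0.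
have rank_one : set_rank (pointed_nth set0 1) = 1 by rewrite pointed_nthK.
have le_places : (N * n).+1 <= N * n.+1 by rewrite mulnS; lia.
have le_rows : n.+1 <= N * n.+1 by rewrite leq_pmull // ltnW.
have m_gt0 : 0 < N * n.+1 by rewrite muln_gt0 ltnW.
apply: wp_assign => //; set st1 := put _ _ _ _; have size1 : get st1 RSize 0 = n.
  by rewrite get_put.
apply: wp_bind (wp_init_constants _ m_gt0) _.
move=> st2 [fr2 am2 clash2 union2 place2].
apply: (wp_bind_leq le_places) (wp_init_places _ place2) _; first by rewrite fr2.
move=> st3 [fr3 am3 place3]; have fr23 := frame_trans fr2 fr3.
have size3 : get st3 RSize 0 = n by rewrite fr23.
have row3 : get st3 RRow 0 = 0 by rewrite fr23 // get_put get0.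
apply: (wp_bind_leq le_rows) (wp_init_rows size3 row3) _ => st4 [fr4 am4 row4].
apply: wp_run; rewrite // run_assign; have fr14 := frame_trans fr23 fr4.
have fr1 : frame [:: RSize] st0 st1 by apply: frame_put.
split=> [|||]; last 1 first.
- by rewrite get_put row4.
- split=> *; rewrite get_put ?evE /=.
  + by rewrite fr14.
  + by rewrite row4 // ltnW.
  + by rewrite fr4 // place3 // ltnW.
  + by rewrite !fr4 // size3 -[X in _ + X]rank_one place3 // rank_one mul1n.
  + by rewrite fr4 // fr3.
  + by rewrite fr4 // fr3.
- by apply: frame_put => //; apply: frame_sub (frame_trans fr1 fr14) _.
- by rewrite amem_put am4 am3 am2.
Qed.

Definition query_cell i a := N ^ n + offset (single i [set a]).

Lemma query_cell_lt i a : query_cell i a < N ^ n + N ^ n.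
Proof. by rewrite ltn_add2l offset_lt. Qed.

Lemma single_set1_inj i j a b : single i [set a] = single j [set b] -> i = j /\ a = b.
Proof.
move=> eq_single; have := congr1 (fun d : {ffun 'I_n -> {set U}} => d i) eq_single.
rewrite !ffunE eqxx; case: eqP => [-> /set1_inj //|_ /setP/(_ a)].
by rewrite !inE eqxx.
Qed.

Lemma query_cell_inj i j a b : query_cell i a = query_cell j b -> i = j /\ a = b.
Proof. by move=> /addnI/offset_inj/single_set1_inj. Qed.

Lemma wp_query_images i st0 : static compat n st0 -> get st0 RIndex 0 = i ->
  wp 1 (query_images U) (fun st => [/\ get st =2 get st0,
    forall a, amem st (query_cell i a) = q i a
    & forall x, (forall a, x != query_cell i a) -> amem st x = amem st0 x]) st0.
Proof.
move=> sta ind; rewrite /query_images.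
suff step (r : seq U) st1 : get st1 =2 get st0 ->
    wp 1 (seqs [seq query_image a | a <- r])
      (fun st => [/\ get st =2 get st0,
        forall a, a \in r \/ amem st1 (query_cell i a) = q i a ->
          amem st (query_cell i a) = q i a
        & forall x, (forall a, x != query_cell i a) -> amem st x = amem st1 x]) st1.
  apply: wp_post (step (enum U) st0 (fun _ _ => erefl)) => st [get_st weights same].
  by split=> // a; apply: weights; left; rewrite mem_enum.
elim: r st1 => [|a r IH] st1 get1; first by apply: wp_run => //; split=> // a [].
have sta1 : static compat n st1.
  by apply: (@static_frame _ _ _ _ _ [::] st0) => // *; rewrite get1.
have [t answer le_t] := query_weight i a.
apply: (wp_bind (P := eq (aput st1 (query_cell i a) (q i a)))).
  apply: (wp_query _ _ _ le_t) => //.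
    by rewrite -[nmem _ _]/(get st1 RIndex 0) get1 ind; apply: answer.
  rewrite ev_add ev_var (static_block sta1) (ev_place sta1 (i := i) (T := [set a])) ?ev_const //.
    by rewrite -offset_single.
  by rewrite ev_var get1.
move=> _ <-; apply: wp_post (IH (aput st1 _ _) get1).
move=> st [get_st weights same]; split=> // [b|x out].
  rewrite inE => -[/orP[/eqP ->|br]|wb]; apply: weights; rewrite amem_aput.
  - by right; rewrite eqxx.
  - by left.
  by right; case: eqP => // /query_cell_inj[_ ->].
by rewrite same // amem_aput (negbTE (out a)).
Qed.

Lemma wp_query_loop st0 : static compat n st0 ->
  wp n.+1 (for_all (query_images U)) (fun st => [/\ frame [:: RIndex] st0 st,
    forall i a, amem st (query_cell i a) = q i a
    & forall x, (forall i a, x != query_cell i a) -> amem st x = amem st0 x]) st0.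
Proof.
move=> sta; pose I k st :=
  (forall i a, i < k -> amem st (query_cell i a) = q i a) /\
  (forall x, (forall i a, i < k -> x != query_cell i a) -> amem st x = amem st0 x).
apply: wp_post; last first.
  rewrite -[n.+1]mul1n; apply: (@wp_for _ _ _ _ n 1 [:: RIndex] _ _ I) => //.
  - by move=> st fr; apply: ev_size fr => //; apply: static_size sta.
  move=> k st lt_k fr ind [weights same]; pose i := Ordinal lt_k.
  apply: wp_post (@wp_query_images i st (static_frame fr isT sta) ind).
  move=> st' [get_st' weights' same']; split=> [a j out||]; rewrite ?get_st' //; first exact: fr.
  split=> [j a|x out]; last first.
    rewrite same' ?same // => [j a lt_j|a]; apply: out => //=; exact: ltnW.
  rewrite ltnS leq_eqVlt => /orP[/eqP/(@val_inj _ _ _ j i) -> //|lt_j].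
  rewrite same' ?weights // => b; apply/eqP => /query_cell_inj[ji _].
  by rewrite ji ltnn in lt_j.
move=> st [fr [weights same]]; split=> // [i a|x out]; first exact: weights.
by apply: same.
Qed.

Lemma wp_init_labels st0 : static compat n st0 -> get st0 RRow n = n * n ->
  wp (n * n).+1 init_labels (fun st => [/\ frame [:: RIndex; RLabel] st0 st,
    amem st = amem st0
    & forall i j, get st RLabel (i * n + j) = label_code (Some (lb i j))]) st0.
Proof.
move=> sta row_n; apply: wp_post; last first.
  apply: (@wp_fill A inp query C (n * n) RLabel _ _ (fun k => inp (1 + k) + 1)) => //.
  - by move=> st fr; rewrite !evE !fr // (static_size sta).
  - by move=> k st _ fr ind; rewrite !evE ind.
move=> st [fr am lab]; split=> // i j; rewrite lab ?inp_label ?addn1 //.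
apply: (@leq_trans (i.+1 * n)); first by rewrite mulSnr ltn_add2l.
by rewrite leq_mul2r ltn_ord orbT.
Qed.

Lemma wp_init_singletons st0 : static compat n st0 ->
  wp n.+1 (init_singletons U) (fun st => [/\
    frame [:: RIndex; RLive; RComp; RTable] st0 st,
    forall i, [/\ get st RLive i = 1, get st RComp i = i & get st RTable i = N ^ n],
    forall i a, amem st (query_cell i a) = q i a
    & forall x, (forall i a, x != query_cell i a) -> amem st x = amem st0 x]) st0.
Proof.
move=> sta0.
apply: wp_bind (@wp_fill A inp query C n RLive _ _ (fun _ => 1) st0 _ _ _) _ => //.
  by move=> st; apply: ev_size => //; apply: static_size sta0.
move=> st1 [fr1 am1 live1]; have sta1 := static_frame fr1 isT sta0.
apply: wp_bind (@wp_fill A inp query C n RComp _ _ id st1 _ _ _) _ => //.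
  by move=> st; apply: ev_size => //; apply: static_size sta1.
move=> st2 [fr2 am2 comp2]; have sta2 := static_frame fr2 isT sta1.
apply: wp_bind (@wp_fill A inp query C n RTable _ _ (fun _ => N ^ n) st2 _ _ _) _ => //.
- by move=> st; apply: ev_size => //; apply: static_size sta2.
- by move=> k st _ fr _; rewrite ev_var fr // (static_block sta2).
move=> st3 [fr3 am3 table3]; have sta3 := static_frame fr3 isT sta2.
apply: wp_post (wp_query_loop sta3) => st [fr weights same].
split=> // [|i|x /same -> //].
- by apply: frame_sub (frame_trans (frame_trans (frame_trans fr1 fr2) fr3) fr) _.
- by split; rewrite fr ?table3 // fr3 ?comp2 // fr2 ?live1.
- by rewrite am3 am2 am1.
Qed.

Lemma tables_correct_id st : (forall i a, amem st (query_cell i a) = q i a) ->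
  (forall x, (forall i a, x != query_cell i a) -> amem st x = 0%R) ->
  tables_correct compat lb q id id (fun _ => N ^ n) st.
Proof.
move=> weights fresh c d _ _ /supportedP supp cons.
have dE : d = single c (d c).
  by apply: single_supported => j; rewrite supp /in_component eqxx.
have dc : d c != set0 by rewrite supp /in_component !eqxx.
case: (pickP (fun a => d c == [set a])) => [a /eqP da|not1].
  by rewrite dE da in cons *; rewrite profile_sum_single_set1 // -weights.
rewrite [in RHS]dE profile_sum_single_neq_set1 // => [|a]; last by rewrite not1.
apply: fresh => j a; apply/eqP => /addnI/offset_inj d_single.
have /andP[_ /eqP jc] : (j == j) && (j == c).
  by rewrite -[_ && _](supp j) d_single ffunE eqxx -card_gt0 cards1.
by have := not1 a; rewrite d_single jc ffunE !eqxx.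
Qed.

Lemma wp_init_graph st0 : 0 < n -> static compat n st0 -> get st0 RRow n = n * n ->
  get st0 RStage 0 = 0 -> (forall x, amem st0 x = 0%R) ->
  wp (n.+1 * n.+1) (init_graph U)
    (stage_invariant compat lb q 0 id id (fun _ => N ^ n) (N ^ n + N ^ n)) st0.
Proof.
move=> n_gt0 sta0 row0 stage0 fresh0.
have le_labels : (n * n).+1 <= n.+1 * n.+1 by lia.
have le_loop : n.+1 <= n.+1 * n.+1 by rewrite leq_pmulr.
apply: (wp_bind_leq le_labels) (wp_init_labels sta0 row0) _ => st1 [fr1 am1 lab1].
have sta1 := static_frame fr1 isT sta0.
apply: (wp_bind_leq le_loop) (wp_init_singletons sta1) _ => st2 [fr2 data2 weights2 same2].
have fr02 := frame_trans fr1 fr2; have sta2 := static_frame fr2 isT sta1.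
have fresh2 x : (forall i a, x != query_cell i a) -> amem st2 x = 0%R.
  by move=> out; rewrite same2 // am1.
apply: wp_run; rewrite // !runE; set st := put _ _ _ _.
have fr : frame [:: RTape; RFree] st2 st by do 2![apply: frame_put => //].
have am : amem st = amem st2 by [].
split.
- split.
  + exact: static_frame fr isT sta2.
  + by rewrite /st get_put !evE !get_put /= (static_block sta2).
  + by move=> i; rewrite fr //; case: (data2 i) => -> _ _; rewrite eqxx.
  + by move=> i j _ _; rewrite fr // fr2 // lab1 part_label_id.
  + by move=> i; rewrite fr //; case: (data2 i).
  + by move=> i; rewrite fr //; case: (data2 i).
- by [].
- exact: component_map_id.
- by move=> c _ _.
- apply: tables_correct_id => [i a|x out]; rewrite am ?weights2 ?fresh2 //.
- rewrite am fresh2 // => i a; rewrite ltn_eqF //.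
  exact: leq_trans (ltnW (block_gt1 U_gt0 n_gt0)) (leq_addr _ _).
- by move=> x le_x; rewrite am fresh2 // => i a; rewrite gtn_eqF // (leq_trans (query_cell_lt i a)).
- by rewrite /st !stateE /= !evE (static_size sta2) fr02 // row0 muln1; lia.
- by rewrite fr // fr02.
Qed.

Lemma wp_init : 0 < n ->
  wp (N * (n.+1 * n.+1)) (init compat)
    (stage_invariant compat lb q 0 id id (fun _ => N ^ n) (N ^ n + N ^ n)) (init_state A).
Proof.
move=> n_gt0; have le_tables : N * n.+1 <= N * (n.+1 * n.+1).
  by rewrite leq_mul2l leq_pmulr ?orbT.
apply: (wp_bind_leq le_tables) (wp_init_tables _) _ => // st [sta fr am row].
apply: (wp_mono _) (wp_init_graph n_gt0 sta row _ _) => //.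
- by rewrite leq_pmull ?card_sets_gt0.
- by rewrite fr.
- by move=> x; rewrite am.
Qed.

End Initialisation.

(** * Strong pre-morphisms as sums of products *)

Section StrongPreMorphism.

Variables (A : pzSemiRingType) (B : Type) (Omega : weighting A B).
Hypothesis Omega_strong : strong_pre_morphism Omega.
Hypothesis Omega_cor : corestriction_independent Omega.
Variables (X Y : finType) (G : elgraph X) (H : elgraph Y) (R : {set X * Y}).
Variable (W : {ffun vert G * vert H -> B}).

Notation V := (vert G).
Notation U := (vert H).
Notation n := #|V|.
Implicit Types (f : V -> U) (S : {set V}) (v w : V) (i j : 'I_n) (a b : U).

Definition fn_of f S : fn S [set: U] := [ffun x => exist _ (f (val x)) (in_setT _)].

Definition total_fn (g : fn [set: V] [set: U]) v : U := val (g (exist _ v (in_setT v))).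

Definition Omega_fn S f : A := Omega W [set fn_of f S].

Definition vertex_weight v a : A := Omega W [set const_fn [set v] a].

Definition index_weight i : U -> A := vertex_weight (enum_val i).
Definition index_label i j : X := lab (enum_val i) (enum_val j).
Definition allowed (x : X) a b := (x, lab a b) \in R.

Lemma fn_of_total_fn g : fn_of (total_fn g) [set: V] = g.
Proof.
apply/ffunP => x; apply: val_inj; rewrite ffunE /=; congr (val (g _)).
exact: val_inj.
Qed.

Lemma total_fn_of f : total_fn (fn_of f [set: V]) =1 f.
Proof. by move=> v; rewrite /total_fn ffunE. Qed.

Lemma Omega_fnU S1 S2 f : [disjoint S1 & S2] ->
  Omega_fn (S1 :|: S2) f = (Omega_fn S1 f * Omega_fn S2 f)%R.
Proof.
move=> dis; have in_TT x : f x \in [set: U] :|: [set: U] by rewrite setUid inE.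
pose g : fn (S1 :|: S2) ([set: U] :|: [set: U]) :=
  [ffun x => exist _ (f (val x)) (in_TT _)].
rewrite /Omega_fn (@Omega_cor X Y G H W _ _ _ (fn_of f (S1 :|: S2)) g); last 2 first.
- by rewrite subsetT.
- by move=> x; rewrite !ffunE.
rewrite -(proj2 Omega_strong) //; congr (Omega W _); apply/setP => h; rewrite !inE.
apply/eqP/exists_inP => [->|[_ /set1P-> /exists_inP[_ /set1P->]]].
  exists (fn_of f S1); rewrite ?set11 //; apply/exists_inP.
  exists (fn_of f S2); rewrite ?set11 //; apply/andP.
  by split; apply/'forall_forallP => x y; apply/implyP => /eqP e; rewrite !ffunE /= e.
case/andP=> /forallP h1 /forallP h2; apply/ffunP => x; apply: val_inj.
rewrite ffunE /=; case/setUP: (valP x) => xS.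
  by have /forallP/(_ (exist _ (val x) xS)) := h1 x; rewrite eqxx ffunE => /eqP.
by have /forallP/(_ (exist _ (val x) xS)) := h2 x; rewrite eqxx ffunE => /eqP.
Qed.

Lemma Omega_fn1 v f : Omega_fn [set v] f = vertex_weight v (f v).
Proof.
apply: Omega_cor; first exact: subsetT.
by move=> x; rewrite !ffunE /=; have /set1P -> := valP x.
Qed.

Lemma vertex_weight_comm v w a b :
  v != w -> GRing.comm (vertex_weight v a) (vertex_weight w b).
Proof.
move=> vw; pose f x := if x == v then a else b.
have fv : f v = a by rewrite /f eqxx.
have fw : f w = b by rewrite /f eq_sym (negbTE vw).
rewrite /GRing.comm -fv -fw -!Omega_fn1 -!Omega_fnU 1?setUC //.
  by rewrite disjoints1 inE eq_sym.
by rewrite disjoints1 inE.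
Qed.

Lemma index_weight_comm i j a b :
  i != j -> GRing.comm (index_weight i a) (index_weight j b).
Proof. by move=> ij; apply: vertex_weight_comm; rewrite (inj_eq enum_val_inj). Qed.

Lemma Omega_fn_prod v (r : seq V) f : uniq (v :: r) ->
  Omega_fn [set x in v :: r] f = (\prod_(w <- v :: r) vertex_weight w (f w))%R.
Proof.
elim: r v => [|w r IH] v uniq_r.
  by rewrite big_seq1 -Omega_fn1; congr Omega_fn; apply/setP => x; rewrite !inE.
have /andP[vr uniq_wr] := uniq_r; rewrite big_cons -IH // -Omega_fn1 -Omega_fnU.
  by congr Omega_fn; apply/setP => x; rewrite !inE.
by rewrite disjoints1 inE.
Qed.

Lemma Omega_fn_total f : 0 < n ->
  Omega_fn [set: V] f = (\prod_(i < n) index_weight i (f (enum_val i)))%R.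
Proof.
move=> n_gt0; have uniq_r : uniq [seq enum_val i | i <- enum 'I_n].
  by rewrite map_inj_uniq ?enum_uniq //; apply: enum_val_inj.
have mem_r v : v \in [seq enum_val i | i <- enum 'I_n].
  by apply/mapP; exists (enum_rank v); rewrite ?mem_enum ?enum_rankK.
transitivity (\prod_(v <- [seq enum_val i | i <- enum 'I_n]) vertex_weight v (f v))%R;
  last by rewrite big_map enumT.
case: [seq _ | _ <- _] uniq_r mem_r => [_ no_v|v r uniq_r mem_r].
  by have /card_gt0P[v _] := n_gt0; have := no_v v.
rewrite -Omega_fn_prod //; congr Omega_fn.
by apply/setP => x; rewrite [RHS]inE mem_r inE.
Qed.

Lemma Omega_sum S (T : {set U}) (F : {set fn S T}) :
  Omega W F = (\sum_(g in F) Omega W [set g])%R.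
Proof.
have [pm _] := Omega_strong; have [k] := ubnP #|F|; elim: k F => // k IH F ltF.
have [->|/set0Pn[g gF]] := eqVneq F set0; first by rewrite (pre_morphism_empty pm) big_set0.
rewrite -{1}(setD1K gF) (pre_morphism_union pm) ?disjoints1 ?inE ?eqxx //.
rewrite [X in (_ + X)%R]IH; last by move: ltF; rewrite (cardsD1 g) gF add1n.
by rewrite [RHS](big_setD1 g).
Qed.

Definition index_fn (g : fn [set: V] [set: U]) : {ffun 'I_n -> option U} :=
  [ffun i => Some (total_fn g (enum_val i))].

Lemma index_fn_inj : injective index_fn.
Proof.
move=> g g' eq_g; rewrite -(fn_of_total_fn g) -(fn_of_total_fn g').
apply/ffunP => x; apply: val_inj; rewrite !ffunE /=.
have := congr1 (fun f : {ffun _} => f (enum_rank (val x))) eq_g.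
by rewrite !ffunE enum_rankK => -[].
Qed.

Lemma index_fn_morphisms : 0 < n -> index_fn @: morphisms R G H =
  [set f | partial_morphism index_label allowed f && [forall i, isSome (f i)]].
Proof.
move=> n_gt0; apply/setP => f; rewrite inE; apply/imsetP/andP.
  case=> g; rewrite inE => /'forall_forallP g_morph ->; split; last first.
    by apply/forallP => i; rewrite ffunE.
  apply/partial_morphismP => i j a b; rewrite !ffunE => -[<-] [<-].
  exact: g_morph.
case=> /partial_morphismP f_morph /forallP f_total.
have [a0 _] : exists a0, f (Ordinal n_gt0) = Some a0.
  by have := f_total (Ordinal n_gt0); case: (f _) => // a; exists a.
pose F v := odflt a0 (f (enum_rank v)).
have fE i : f i = Some (F (enum_val i)).
  by rewrite /F enum_valK; have := f_total i; case: (f i).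
exists (fn_of F [set: V]); last by apply/ffunP => i; rewrite ffunE total_fn_of.
rewrite inE; apply/'forall_forallP => u v; rewrite -/(total_fn _ u) -/(total_fn _ v) !total_fn_of.
have := f_morph (enum_rank u) (enum_rank v) _ _ (fE _) (fE _).
by rewrite /allowed /index_label !enum_rankK.
Qed.

Lemma Omega_morphisms : 0 < n -> Omega W (morphisms R G H) =
  (\sum_(f | partial_morphism index_label allowed f && [forall i, isSome (f i)])
     weight index_weight f)%R.
Proof.
move=> n_gt0; rewrite Omega_sum.
transitivity (\sum_(f in index_fn @: morphisms R G H) weight index_weight f)%R.
  rewrite big_imset /=; last by apply: in2W; apply: index_fn_inj.
  apply: eq_bigr => g _; rewrite -{1}(fn_of_total_fn g) -/(Omega_fn _ _) Omega_fn_total //.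
  by apply: eq_bigr => i _; rewrite ffunE.
by rewrite index_fn_morphisms //; apply: eq_bigl => f; rewrite inE.
Qed.

End StrongPreMorphism.

(** * Contraction sequences *)

Definition merges_to n (rho rho' : 'I_n -> 'I_n) :=
  exists s t : 'I_n,
    [/\ rho s = s, rho t = t, s < t & rho' =1 merge_rep rho s t].

Lemma merges_to_total n (reps : nat -> 'I_n -> 'I_n) (i0 : 'I_n) :
  reps 0 =1 id -> (forall k, k < n.-1 -> merges_to (reps k) (reps k.+1)) ->
  i0 = 0 :> nat -> forall v, reps n.-1 v = i0.
Proof.
move=> reps0 repsS i00.
have inv k : k <= n.-1 -> [/\ reps k i0 = i0, forall v, reps k (reps k v) = reps k v
    & #|[set i | reps k i == i]| = n - k].
  elim: k => [_|k IH lt_k].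
    split=> [|v|]; rewrite ?reps0 // subn0 -[RHS]card_ord -cardsT.
    by apply: eq_card => i; rewrite !inE reps0 eqxx.
  have [rep0 idem card] := IH (ltnW lt_k); have [s [t [rs rt lt_st eq_rep]]] := repsS k lt_k.
  have st_neq : s != t by rewrite -val_eqE /= ltn_neqAle in lt_st *; case/andP: lt_st.
  split=> [|v|].
  - rewrite eq_rep /merge_rep rep0; case: eqP => // e.
    by rewrite -e i00 in lt_st.
  - by rewrite !eq_rep merge_rep_idem.
  have -> : [set i | reps k.+1 i == i] = [set i | reps k i == i] :\ t.
    by apply/setP => i; rewrite !inE eq_rep merge_rep_fix // andbC.
  by have := cardsD1 t [set i | reps k i == i]; rewrite inE rt eqxx card; lia.
have [rep0 idem card] := inv _ (leqnn _).
have /cards1P[x fixed] : #|[set i | reps n.-1 i == i]| == 1.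
  by rewrite card; have := ltn_ord i0; lia.
have fixed_eq v : reps n.-1 v = v -> v = x.
  by move=> e; apply/set1P; rewrite -fixed inE e.
by move=> v; rewrite (fixed_eq _ (idem v)) [RHS]fixed_eq.
Qed.

Section Partitions.

Variable V : finType.
Notation n := #|V|.
Implicit Types (P Q : {set {set V}}) (S T : {set V}) (v : V) (i j : 'I_n).

Definition min_index S := find [in S] (enum V).

Lemma min_index_lt S : S != set0 -> min_index S < n.
Proof.
case/set0Pn => v vS; rewrite /min_index cardE -has_find; apply/hasP.
by exists v; rewrite ?mem_enum.
Qed.

Lemma min_index_in S i : i = min_index S :> nat -> enum_val i \in S.
Proof.
move=> e; have vS : has [in S] (enum V) by rewrite has_find -cardE -[find _ _]e.
by have := nth_find (enum_val i) vS; rewrite -[find _ _]e -enum_val_nth.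
Qed.

Lemma min_index1 i : min_index [set enum_val i] = i.
Proof.
have ne0 : [set enum_val i] != set0 by rewrite -card_gt0 cards1.
have /set1P/enum_val_inj := min_index_in (i := Ordinal (min_index_lt ne0)) erefl.
by move/(congr1 val).
Qed.

Lemma min_indexU S T : min_index (S :|: T) = minn (min_index S) (min_index T).
Proof.
rewrite /min_index; elim: (enum V) => //= v r ->; rewrite inE.
by case: (v \in S) (v \in T) => -[]; rewrite ?minnSS ?min0n ?minn0.
Qed.

Lemma partition_singletons : partition (singletons V) [set: V].
Proof.
have [] // := @indexed_partition _ _ predT (fun v : V => [set v]) => [v w _ _|v _|].
- by rewrite disjoints1 inE eq_sym.
- by rewrite -card_gt0 cards1.
move=> + _; congr partition; apply/setP => v; rewrite inE.
by apply/bigcupP; exists [set v]; rewrite ?set11 ?imset_f.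
Qed.

Section MergeBlocks.

Variables (P : {set {set V}}) (D S T : {set V}).
Hypotheses (part_P : partition P D) (SP : S \in P) (TP : T \in P) (ST : S != T).

Notation Q := ((S :|: T) |: (P :\ S :\ T)).

Lemma partition_merge : partition Q D.
Proof.
have T_in : T \in P :\ S by rewrite !inE eq_sym ST.
have part_rest := partitionD1 (partitionD1 part_P SP) T_in.
have disj : [disjoint S :|: T & D :\: S :\: T].
  by apply/pred0P => v; rewrite /= !inE; case: (v \in S); case: (v \in T).
have D_split : S :|: T :|: (D :\: S :\: T) = D.
  by rewrite setDDl -[RHS](setID D (S :|: T)) (setIidPr _) // subUset !(partitionS part_P).
rewrite -[in partition _ _]D_split; apply: partitionU1 => //.
by rewrite setU_eq0 negb_and (partition_neq0 part_P SP).
Qed.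

Lemma pblock_merge v : v \in D ->
  pblock Q v = if v \in S :|: T then S :|: T else pblock P v.
Proof.
move=> vD; have trivQ := partition_trivIset partition_merge.
case: ifPn => [vST|]; first by rewrite (def_pblock trivQ _ vST) // !inE eqxx.
have vP : v \in cover P by rewrite (cover_partition part_P).
rewrite inE negb_or => /andP[vS vT]; apply: def_pblock => //; last by rewrite mem_pblock.
rewrite !inE pblock_mem // andbT; apply/orP; right; apply/andP.
by split; [apply: contraNneq vT => <- | apply: contraNneq vS => <-]; rewrite mem_pblock.
Qed.

End MergeBlocks.

Definition rep P i : 'I_n := insubd i (part_number P (enum_val i)).

Section Representatives.

Variable P : {set {set V}}.
Hypothesis part_P : partition P [set: V].

Let in_cover v : v \in cover P.
Proof. by rewrite (cover_partition part_P) inE. Qed.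

Let trivP : trivIset P.
Proof. exact: partition_trivIset part_P. Qed.

Lemma val_rep i : rep P i = min_index (pblock P (enum_val i)) :> nat.
Proof.
rewrite /rep val_insubd ifT //; apply: min_index_lt; apply/set0Pn.
by exists (enum_val i); rewrite mem_pblock.
Qed.

Lemma rep_in i : enum_val (rep P i) \in pblock P (enum_val i).
Proof. exact: min_index_in (val_rep i). Qed.

Lemma eq_rep i j : (rep P i == rep P j) = (enum_val j \in pblock P (enum_val i)).
Proof.
rewrite -eq_pblock //; apply/eqP/eqP => [e|e]; last by apply/val_inj; rewrite /= !val_rep e.
by rewrite -(same_pblock trivP (rep_in i)) -(same_pblock trivP (rep_in j)) e.
Qed.

Lemma rep_of_block S i : S \in P -> i = min_index S :> nat ->
  rep P i = i /\ forall j, (rep P j == i) = (enum_val j \in S).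
Proof.
move=> SP iS; have S_block : pblock P (enum_val i) = S.
  by apply: def_pblock => //; apply: min_index_in.
have ri : rep P i = i by apply/val_inj; rewrite /= val_rep S_block.
by split=> // j; rewrite -{1}ri eq_sym eq_rep S_block.
Qed.

End Representatives.

Lemma rep_singletons i : rep (singletons V) i = i.
Proof.
have i_in : [set enum_val i] \in singletons V by apply: imset_f.
by case: (rep_of_block partition_singletons i_in (esym (min_index1 i))).
Qed.

Lemma rep_merge P S T : partition P [set: V] -> S \in P -> T \in P ->
  min_index S < min_index T ->
  merges_to (rep P) (rep ((S :|: T) |: (P :\ S :\ T))).
Proof.
move=> part_P SP TP lt_ST.
have ST : S != T by apply: contraTneq lt_ST => ->; rewrite ltnn.
have part_Q := partition_merge part_P SP TP ST.
pose s := Ordinal (min_index_lt (partition_neq0 part_P SP)).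
pose t := Ordinal (min_index_lt (partition_neq0 part_P TP)).
have [rs block_s] := rep_of_block part_P SP (i := s) erefl.
have [rt block_t] := rep_of_block part_P TP (i := t) erefl.
exists s, t; split=> // i; apply: val_inj; rewrite /= val_rep // (pblock_merge part_P) //.
rewrite /merge_rep block_t inE; case: (boolP (enum_val i \in T)) => [_|nT].
  by rewrite orbT min_indexU (minn_idPl (ltnW lt_ST)).
rewrite orbF -block_s; case: eqP => [->|_]; last by rewrite val_rep.
by rewrite min_indexU (minn_idPl (ltnW lt_ST)).
Qed.

Lemma merge_step_rep P Q : partition P [set: V] -> merge_step P Q ->
  partition Q [set: V] /\ merges_to (rep P) (rep Q).
Proof.
move=> part_P /exists_inP[S SP /exists_inP[T TP /andP[ST /eqP ->]]].
split; first exact: partition_merge.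
case: (ltngtP (min_index S) (min_index T)) => [lt_ST|lt_TS|eq_ST].
- exact: rep_merge.
- rewrite [S :|: T]setUC (_ : P :\ S :\ T = P :\ T :\ S); first exact: rep_merge.
  by apply/setP => B; rewrite !inE andbCA.
have lt_S := min_index_lt (partition_neq0 part_P SP).
have in_S := min_index_in (i := Ordinal lt_S) erefl.
have in_T := min_index_in (i := Ordinal lt_S) eq_ST.
have trivP := partition_trivIset part_P; case/eqP: ST.
by rewrite -(def_pblock trivP SP in_S) (def_pblock trivP TP in_T).
Qed.

End Partitions.

Section Contraction.

Variables (X : finType) (G : elgraph X) (Q : {set {set vert G}}).
Hypothesis part_Q : partition Q [set: vert G].

Notation n := #|vert G|.
Notation lb := (@index_label X G).
Implicit Types i j k : 'I_n.

Lemma block_subproof i : pblock Q (enum_val i) \in Q.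
Proof. by rewrite pblock_mem ?(cover_partition part_Q) ?inE. Qed.

Definition block i : vert (contraction G Q) :=
  exist (fun S => S \in Q) _ (block_subproof i).

Lemma lab_block i j : rep Q i = i -> rep Q j = j ->
  part_label lb (rep Q) i j = None -> lab (block i) (block j) = None.
Proof.
move=> ri rj none; rewrite /=; case: pickP => // x /forall_inP same.
suff : part_label lb (rep Q) i j = Some x by rewrite none.
apply/part_labelP => // v w rv rw.
have /same/forall_inP same_v : enum_val v \in pblock Q (enum_val i).
  by rewrite -eq_rep // ri rv.
by apply/eqP/same_v; rewrite -eq_rep // rj rw.
Qed.

Lemma e_adj_block :
  {homo block : i j / part_adj lb (rep Q) i j >-> @e_adj _ (contraction G Q) i j}.
Proof.
move=> i j /and3P[/eqP ri /eqP rj adj]; rewrite /e_adj.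
by case/orP: adj => /eqP none; rewrite (lab_block _ _ none) ?eqxx ?orbT.
Qed.

Lemma card_component_rep i : rep Q i = i ->
  #|component lb (rep Q) i| <= max_component (contraction G Q).
Proof.
move=> ri; have live j : connect (part_adj lb (rep Q)) i j -> rep Q j = j.
  case/connectP=> p; elim/last_ind: p j => [|p k _] j; first by move=> _ ->.
  by rewrite rcons_path last_rcons => /andP[_ /and3P[_ /eqP rk _]] ->.
have block_inj : {in component lb (rep Q) i &, injective block}.
  move=> j k; rewrite !inE => /live rj /live rk /(congr1 val) /= eq_block.
  rewrite -rj -rk; apply/eqP; rewrite eq_rep // eq_block.
  by rewrite mem_pblock ?(cover_partition part_Q) ?inE.
rewrite -(card_in_imset block_inj); apply: leq_trans (leq_bigmax (block i)).
apply/subset_leq_card/subsetP => _ /imsetP[j + ->]; rewrite !inE.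
exact: connect_homo e_adj_block _ _.
Qed.

End Contraction.

Lemma nth_allpairs (S T W : Type) (f : S -> T -> W) x0 y0 z0 s t i j :
  i < size s -> j < size t ->
  nth z0 [seq f x y | x <- s, y <- t] (i * size t + j) = f (nth x0 s i) (nth y0 t j).
Proof.
elim: s i => //= x s IH [|i] lt_i lt_j; rewrite nth_cat size_map.
  by rewrite mul0n add0n lt_j (nth_map y0).
rewrite mulSn -addnA ltnNge leq_addr /= addnC addnK.
by rewrite -IH // addnC.
Qed.

Section OptimalSequence.

Variables (X : finType) (G : elgraph X) (P : partition_seq G).
Hypothesis P_optimal : optimal_contraction_seq P.

Notation n := #|vert G|.
Implicit Types i j : 'I_n.

Definition seq_rep k : 'I_n -> 'I_n := rep (nth set0 P k).

Lemma nth_merge_step k : k < n.-1 -> merge_step (nth set0 P k) (nth set0 P k.+1).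
Proof.
move=> lt_k; have [/andP[_ sorted_P] _] := P_optimal.
by move/(sortedP set0): sorted_P; apply; rewrite size_tuple; lia.
Qed.

Lemma nth0_singletons : nth set0 P 0 = singletons (vert G).
Proof. by have [/andP[/eqP <- _] _] := P_optimal; rewrite nth0. Qed.

Lemma nth_partition k : k <= n.-1 -> partition (nth set0 P k) [set: vert G].
Proof.
elim: k => [_|k IH lt_k]; first by rewrite nth0_singletons partition_singletons.
by case: (merge_step_rep (IH (ltnW lt_k)) (nth_merge_step lt_k)).
Qed.

Lemma seq_rep0 : seq_rep 0 =1 id.
Proof. by move=> i; rewrite /seq_rep nth0_singletons rep_singletons. Qed.

Lemma seq_repS k : k < n.-1 -> merges_to (seq_rep k) (seq_rep k.+1).
Proof.
move=> lt_k.
by case: (merge_step_rep (nth_partition (ltnW lt_k)) (nth_merge_step lt_k)).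
Qed.

Lemma card_component_seq_rep k i : k < n.-1 -> seq_rep k.+1 i = i ->
  #|component (@index_label X G) (seq_rep k.+1) i| <= ctww G.
Proof.
move=> lt_k ri; apply: leq_trans (card_component_rep (nth_partition lt_k) ri) _.
have [_ <-] := P_optimal; apply: (@leq_bigmax_seq _ _ xpredT) => //.
by rewrite -nth_behead; apply: mem_nth; rewrite size_behead size_tuple; lia.
Qed.

Lemma nth_tape_size : nth 0 (input_tape P) 0 = n.
Proof. by []. Qed.

Lemma nth_tape_label i j :
  nth 0 (input_tape P) (1 + (i * n + j)) = enum_rank (index_label i j).
Proof.
have v0 := enum_val i; have size_V : size (enum (vert G)) = n by rewrite cardE.
rewrite /input_tape add1n /= nth_cat size_allpairs size_V ifT; last first.
  apply: leq_trans (_ : i.+1 * n <= _); first by rewrite mulSnr ltn_add2l.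
  by rewrite leq_mul2r ltn_ord orbT.
have := @nth_allpairs _ _ _ (fun u v : vert G => nat_of_ord (enum_rank (lab u v)))
  v0 v0 0 (enum (vert G)) (enum (vert G)) i j.
by rewrite !size_V => -> //; rewrite -!enum_val_nth.
Qed.

Lemma nth_tape_rep k i : k < n.-1 ->
  nth 0 (input_tape P) (1 + n * n + n * k.+1 + i) = seq_rep k.+1 i.
Proof.
move=> lt_k; have v0 := enum_val i; have size_V : size (enum (vert G)) = n by rewrite cardE.
rewrite /seq_rep val_rep ?nth_partition //.
rewrite /input_tape -!addnA add1n /= nth_cat size_allpairs size_V ltnNge leq_addr /= addKn.
have := @nth_allpairs _ _ _ (fun Q v => part_number Q v) set0 v0 0 P (enum (vert G)) k.+1 i.
rewrite !size_V size_tuple mulnC => -> //; last by lia.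
by rewrite -enum_val_nth.
Qed.

End OptimalSequence.

(** * The whole computation *)

Section Computation.

Variables (L U : finType) (compat : L -> U -> U -> bool).
Variables (A : pzSemiRingType) (inp : nat -> nat).
Variables (query : seq nat -> nat -> option (A * nat)) (C n : nat).
Variables (lb : 'I_n -> 'I_n -> L) (q : 'I_n -> U -> A).
Hypothesis q_comm : forall i j a b, i != j -> GRing.comm (q i a) (q j b).
Hypothesis U_gt0 : 0 < #|U|.

Notation N := #|{set U}|.
Notation set_rank := (pointed_rank (set0 : {set U})).
Notation wp := (@wp A inp query C).
Notation ev := (@ev A inp).
Notation run := (@run A inp).
Implicit Types (st : state A) (i : 'I_n) (T : {set U}).

Lemma run_sum_cells (T : eqType) (e x : T -> nexp) (r : seq T) st :
  (forall y, y \in r -> ev st (x y) != 0) ->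
  amem (run (seqs [seq If (e y) Skip
                     (AStore (NConst 0) (AAdd (ACell (NConst 0)) (ACell (x y)))) | y <- r]) st) 0 =
  (amem st 0%N + \sum_(y <- r | ev st (e y) == 0%N) amem st (ev st (x y)))%R.
Proof.
elim: r st => [|y r IH] st x_neq0; first by rewrite big_nil addr0.
have x_neq0' z : z \in r -> ev st (x z) != 0.
  by move=> zr; apply: x_neq0; rewrite inE zr orbT.
rewrite /= run_seq run_if big_cons; case: eqP => _ /=; last by rewrite run_skip IH.
rewrite run_astore IH // amem_aput /= -addrA; congr (_ + (_ + _))%R.
rewrite big_seq_cond [RHS]big_seq_cond; apply: eq_bigr => z /andP[/x_neq0' neq0 _].
by rewrite /update ifN.
Qed.

Lemma consistent_single rho i T :
  consistent lb compat rho (single i T) = fits compat (part_label lb rho i i) T T.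
Proof.
apply/consistentP/idP => [/(_ i i)|fit j k]; first by rewrite ffunE eqxx.
rewrite !ffunE; case: eqP => [->|_]; last exact: fits_set0l.
by case: eqP => [->|_]; rewrite ?fits_set0r.
Qed.

Lemma wp_sum_tables m rho co tb base i0 st : 0 < m ->
  i0 = 0 :> nat -> (forall v, rho v = i0) ->
  contracted compat lb rho co tb base st -> component_map lb rho co ->
  @tables_below U n rho co tb base -> tables_correct compat lb q rho co tb st ->
  amem st 0 = 0%R ->
  wp m (sum_tables U) (fun st' => amem st' 0 =
    (\sum_(f | partial_morphism lb compat f && [forall v, isSome (f v)]) weight q f)%R) st.
Proof.
move=> m_gt0 i00 rho_i0 con co_map below correct out0.
have sta := contracted_static con; have ri0 := rho_i0 i0.
have co_i0 : co i0 = i0 by rewrite -(component_live co_map ri0).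
have ev0 : ev st (NConst 0) = i0 by rewrite ev_const i00.
pose cell T := NAdd (read RTable (read RComp (NConst 0))) (NConst (set_rank T)).
pose test T := clash U (label (NConst 0) (NConst 0)) (NConst (set_rank T)) (NConst (set_rank T)).
have ev_cell T : ev st (cell T) = tb i0 + offset (single i0 T).
  rewrite ev_add !ev_read ev0 (contracted_comp con) co_i0 (contracted_table con) ev_const.
  by rewrite offset_single i00 muln1.
have ev_test T : ev st (test T) = ~~ consistent lb compat rho (single i0 T).
  by rewrite consistent_single (ev_clash sta (ev_label con ri0 ri0 ev0 ev0) (S := T) (T := T)).
apply: wp_run => //; first by apply: straight_line_seqs.
rewrite (@run_sum_cells _ test cell) => [|T _]; last first.
  by rewrite ev_cell -lt0n; have /andP[/ltnW] := table_entry U_gt0 below (single i0 T) ri0 co_i0.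
rewrite out0 add0r -(profile_sum_single_total lb compat q rho_i0) big_enum_cond big_mkcondr /=.
apply: eq_bigr => T T0; rewrite ev_test ev_cell eqb0 negbK; case: ifPn => [cons|incons].
  rewrite correct //; apply/supportedP => i; rewrite ffunE /in_component rho_i0.
  by rewrite [i0 == i]eq_sym; have [->|_] := eqVneq i i0; rewrite ?co_i0 ?eqxx.
by rewrite profile_sum_inconsistent.
Qed.
Hypothesis inp_size : inp 0 = n.
Hypothesis inp_label : forall i j : 'I_n, inp (1 + (i * n + j)) = enum_rank (lb i j).
Hypothesis query_weight : forall (i : 'I_n) a,
  exists2 t, query [:: nat_of_ord i] (enum_rank a) = Some (q i a, t) & t <= C.

Variables (reps : nat -> 'I_n -> 'I_n) (w : nat).
Hypothesis reps0 : reps 0 =1 id.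
Hypothesis repsS : forall k, k < n.-1 -> merges_to (reps k) (reps k.+1).
Hypothesis inp_reps : forall k i, k < n.-1 ->
  inp (1 + n * n + n * k.+1 + i) = reps k.+1 i.
Hypothesis card_component_reps : forall k i, k < n.-1 -> reps k.+1 i = i ->
  #|component lb (reps k.+1) i| <= w.

Definition stage_reached k st := exists rho co tb base,
  rho =1 reps k /\ stage_invariant compat lb q k rho co tb base st.

Lemma wp_stage_reached k st : k < n.-1 -> stage_reached k st ->
  wp (n.+1 * (N.-1 ^ w.+1).+1) (stage U) (stage_reached k.+1) st.
Proof.
move=> lt_k [rho [co [tb [base [rhoE inv]]]]].
have [s [t [rs rt lt_st eq_reps]]] := repsS lt_k.
have st_neq : s != t by rewrite -val_eqE /= ltn_eqF.
have rho'E : merge_rep rho s t =1 reps k.+1 by move=> v; rewrite eq_reps /merge_rep rhoE.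
have card_w : #|component lb (merge_rep rho s t) s| <= w.
  rewrite (eq_component lb rho'E); apply: card_component_reps => //.
  by rewrite eq_reps /merge_rep rs ifN.
apply: (wp_post _ (wp_stage _ _ q_comm U_gt0 inv _ _ st_neq _ card_w)).
- by move=> st' [co' [tb' [base' inv']]]; exists (merge_rep rho s t), co', tb', base'.
- by rewrite rhoE.
- by rewrite rhoE.
- by move=> i; rewrite inp_reps ?rho'E.
Qed.

Lemma wp_sum_morphisms : 0 < n ->
  wp (N * (n.+1 * (N.-1 ^ w.+1).+1 * n.+1)) (sum_morphisms compat) (fun st => amem st 0 =
    (\sum_(f | partial_morphism lb compat f && [forall v, isSome (f v)]) weight q f)%R)
    (init_state A).
Proof.
move=> n_gt0; have N_gt0 := card_sets_gt0 U_gt0.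
have le_init : N * (n.+1 * n.+1) <= N * (n.+1 * (N.-1 ^ w.+1).+1 * n.+1).
  by rewrite leq_mul2l leq_mul2r leq_pmulr ?orbT.
have le_loop : n.+1 * (N.-1 ^ w.+1).+1 * n.-1.+1 <= N * (n.+1 * (N.-1 ^ w.+1).+1 * n.+1).
  by rewrite prednK // (leq_trans _ (leq_pmull _ N_gt0)) // leq_mul2l leqnSn orbT.
apply: (wp_bind_leq le_init) (wp_init _ U_gt0 inp_size inp_label query_weight n_gt0) _ => st0 inv0.
apply: (wp_bind_leq le_loop (P := stage_reached n.-1)).
  apply: wp_while => // [|k st lt_k reached|st [rho [co [tb [base [_ inv]]]]]].
  - by exists id, id, (fun _ => N ^ n), (N ^ n + N ^ n); split=> // v; rewrite reps0.
  - split; last exact: wp_stage_reached.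
    have [rho [co [tb [base [_ inv]]]]] := reached.
    rewrite !evE (static_size (contracted_static (invariant_contracted inv))).
    by rewrite (invariant_stage inv) subn1 subn_eq0 -ltnNge.
  - rewrite !evE (static_size (contracted_static (invariant_contracted inv))).
    by rewrite (invariant_stage inv) subn1 subnn.
move=> st [rho [co [tb [base [rhoE [con _ co_map below correct out0 _ _ _]]]]]].
pose i0 := Ordinal n_gt0; apply: (@wp_sum_tables _ rho co tb base i0) => //.
  by rewrite !muln_gt0 N_gt0.
by move=> v; rewrite rhoE (merges_to_total reps0 repsS (i0 := i0)).
Qed.

End Computation.

Lemma morphisms_eq0 (X Y : finType) (R : {set X * Y}) (G : elgraph X) (H : elgraph Y) :
  0 < #|vert G| -> #|vert H| = 0 -> morphisms R G H = set0.
Proof.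
move=> /card_gt0P[v _] /card0_eq noH; apply/setP => f.
by have := noH (val (f (exist _ v (in_setT v)))).
Qed.

Lemma evaluation_oracle_vertex (A : pzSemiRingType) (B : Type)
    (Omega : weighting A B) (tau : evaluation_time B) (X Y : finType)
    (G : elgraph X) (H : elgraph Y) (W : {ffun vert G * vert H -> B})
    (i : 'I_#|vert G|) (a : vert H) :
  evaluation_oracle Omega tau W [:: nat_of_ord i] (enum_rank a) =
    Some (index_weight Omega W i a, tau X Y G H W [set enum_val i] a).
Proof.
have vertex_i : [set v : vert G | nat_of_ord (enum_rank v) \in [:: nat_of_ord i]] =
    [set enum_val i].
  by apply/setP => v; rewrite !inE -(inj_eq enum_rank_inj v) enum_valK.
rewrite /evaluation_oracle vertex_i.
by case: pickP => [b /= /eqP/val_inj/enum_rank_inj ->|/(_ a)]; rewrite ?eqxx.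
Qed.

Lemma time_bound N M w n : 0 < M -> 0 < n ->
  N * (n.+1 * (M ^ w.+1).+1 * n.+1) <= 8 * M * N * (M ^ w * n ^ 2).
Proof.
move=> M_gt0 n_gt0; have Mw_gt0 : 0 < M ^ w.+1 by rewrite expn_gt0 M_gt0.
have -> : 8 * M * N * (M ^ w * n ^ 2) = N * (2 * n * (2 * M ^ w.+1) * (2 * n)).
  by rewrite -mulnn expnS; move: (M ^ w) => z; lia.
by rewrite leq_mul2l; apply/orP; right; apply: leq_mul; [apply: leq_mul|]; lia.
Qed.

Theorem theorem3 (A : pzSemiRingType) (B : Type)
    (Omega : weighting A B) (tau : evaluation_time B)
    (hpoly : poly_time tau)
    (hstrong : strong_pre_morphism Omega)
    (hcor : corestriction_independent Omega)
    (X Y : finType) (H : elgraph Y) (R : {set X * Y}) :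
  exists (algo : cmd) (K : nat),
    forall (G : elgraph X) (W : {ffun vert G * vert H -> B})
      (P : partition_seq G),
    0 < #|vert G| ->
    optimal_contraction_seq P ->
    computes_within (input_tape P) (evaluation_oracle Omega tau W) algo
      (Omega X Y G H W [set: vert G] [set: vert H] (morphisms R G H))
      (K * ((2 ^ #|vert H| - 1) ^ ctww G * #|vert G| ^ 2)).
Proof.
have [H_empty|H_gt0] := posnP #|vert H|.
  exists Skip, 0 => G W P G_gt0 _; exists (init_state A), 0; split=> //; first exact: ExecSkip.
  by rewrite morphisms_eq0 // (pre_morphism_empty (proj1 hstrong)).
have [c [d tau_le]] := hpoly; pose C := c * (1 + 1 + #|vert H| + #|X| + #|Y|) ^ d.
pose algo := sum_morphisms (@allowed X Y H R); pose N := #|{set vert H}|.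
exists algo, (static_cost C algo * (8 * N.-1 * N)) => G W P G_gt0 P_opt.
have oracle i a : exists2 t,
    evaluation_oracle Omega tau W [:: nat_of_ord i] (enum_rank a) =
    Some (index_weight Omega W i a, t) & t <= C.
  exists (tau X Y G H W [set enum_val i] a); first exact: evaluation_oracle_vertex.
  by apply: leq_trans (tau_le _ _ _ _ _ _ _) _; rewrite cards1.
have [s [t [halts le_t out]]] := wp_sum_morphisms (@allowed X Y H R)
  (index_weight_comm hstrong hcor W) H_gt0 (nth_tape_size P) (nth_tape_label P) oracle
  (seq_rep0 P_opt) (seq_repS P_opt) (nth_tape_rep P_opt) (card_component_seq_rep P_opt) G_gt0.
exists s, t; split=> //; first by rewrite out (Omega_morphisms hstrong hcor).
apply: leq_trans le_t _; rewrite -[leqRHS]mulnA leq_mul // -card_set_type subn1.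
exact: time_bound (pred_card_sets_gt0 H_gt0) G_gt0.
Qed.
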